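(* Let $\alpha\in[1,\infty]$. If $\alpha\le 2$, there is a constant $C>0$ such that $$\|\overline{\rho}(U(t)\gamma_0U^*(t))\|_{L^2_{t,x}(\mathbb T^2)}\le C\,\|\gamma_0\|_{\mathfrak S^\alpha}\qquad\text{for all }\gamma_0\in\mathfrak S^\alpha .$$ This is sharp in the sense that the estimate fails if $\alpha>2$: for $\alpha>2$ there is no constant $C$ such that the inequality holds for all trace-class $\gamma_0$.
   Context: $\mathbb T=\mathbb R/2\pi\mathbb Z$, and $\mathbb T^2=\mathbb T_t\times\mathbb T_x$. Put $e_n(x)=(2\pi)^{-1/2}e^{inx}$ and $\widehat\phi(n)=\int_{\mathbb T}\overline{e_n(x)}\phi(x)\,dx$. The free Schrödinger propagator on $L^2(\mathbb T)$ is $U(t)\phi=e^{it\Delta}\phi=\sum_{n\in\mathbb Z}e_n e^{-itn^2}\widehat\phi(n)$, and $U^*(t)=U(t)^*$. $\mathfrak S^\alpha=\mathfrak S^\alpha(L^2(\mathbb T))$ is the Schatten class, $\|A\|_{\mathfrak S^\alpha}=(\operatorname{Tr}|A|^\alpha)^{1/\alpha}$ for $1\le\alpha<\infty$, and $\|\cdot\|_{\mathfrak S^\infty}$ is the operator norm. For a trace-class operator $A$ on $L^2(\mathbb T)$ with singular value decomposition $A=\sum_{n\ge1}a_n|\phi_n\rangle\langle\psi_n|$ (with $a_n\ge0$ and $(\phi_n),(\psi_n)$ orthonormal systems), the density is $\rho_A=\rho(A)=\sum_n a_n\phi_n\overline{\psi_n}\in L^1(\mathbb T)$ and the renormalised density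 is $\overline\rho_A=\overline\rho(A)=\rho_A-\frac1{2\pi}\operatorname{Tr}A$. Convention for $\gamma_0$ not trace class: for $\gamma_0\in\mathfrak S^2$ (in particular $\gamma_0\in\mathfrak S^\alpha$, $\alpha\le2$), $\overline\rho(U(t)\gamma_0U^*(t))$ denotes $\widetilde T\gamma_0$, where $\widetilde T:\mathfrak S^2\to L^2_{t,x}(\mathbb T^2)$ is the unique bounded extension of the linear map $\mathfrak S^1\ni\gamma_0\mapsto\overline\rho(U(t)\gamma_0U^*(t))$; its existence is part of the assertion, equivalent to the inequality for all $\gamma_0\in\mathfrak S^1$ with $\alpha=2$. *)

(* Defs.v *)
From HB Require Import structures.
From mathcomp Require Import all_boot all_order all_algebra.
From mathcomp Require Import all_classical all_reals all_analysis.
From mathcomp Require Import complex.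

Set Implicit Arguments.
Unset Strict Implicit.
Unset Printing Implicit Defensive.

Import Order.TTheory GRing.Theory Num.Theory.
Import numFieldNormedType.Exports.

Local Open Scope classical_set_scope.
Local Open Scope ring_scope.
Local Open Scope complex_scope.

(* The library has no complex-valued integration: measurability and integrals
   of complex-valued functions are taken on real and imaginary parts. *)
Section ComplexLp.
Context d (X : measurableType d) (R : realType).
Variable m : {measure set X -> \bar R}.

Definition cmeasurable (f : X -> R[i]) : Prop :=
  measurable_fun setT (fun x => complex.Re (f x)) /\
  measurable_fun setT (fun x => complex.Im (f x)).

Definition cintegral (f : X -> R[i]) : R[i] :=
  Rintegral m setT (fun x => complex.Re (f x)) +i*
  Rintegral m setT (fun x => complex.Im (f x)).

Definition cLnorm (p : \bar R) (f : X -> R[i]) : \bar R :=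
  Lnorm m p (fun x => (Normc.normc (f x))%:E).

Definition cLp (p : \bar R) (f : X -> R[i]) : Prop :=
  cmeasurable f /\ (cLnorm p f < +oo)%E.

(* [f] represents the limit of [u] in L^p. *)
Definition cvgLp (p : \bar R) (u : nat -> X -> R[i]) (f : X -> R[i]) : Prop :=
  cLp p f /\ (fun N => cLnorm p (fun x => f x - u N x)) @ \oo --> (0 : \bar R).

Definition ceq_ae (f g : X -> R[i]) : Prop := {ae m, forall x, f x = g x}.

End ComplexLp.

(* The torus R/2piZ, as a measure space, is [0, 2pi[ with Lebesgue measure;
   functions on it are functions on R whose values outside [0, 2pi[ are
   irrelevant, and elements of L^p are handled through representatives. *)
Section Torus.
Context (R : realType).

Definition torus : set (measurableTypeR R) := `[0, 2 * pi[%classic.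

Lemma measurable_torus : measurable torus.
Proof. exact: measurable_itv. Qed.

Lemma lebesgue_torus_lty : (@lebesgue_measure R torus < +oo)%E.
Proof. by rewrite /torus lebesgue_measure_itv; case: ifP => _; rewrite ltry. Qed.

Definition torus_measure : {finite_measure set (measurableTypeR R) -> \bar R} :=
  mfrestr measurable_torus lebesgue_torus_lty.

(* Lebesgue measure on T_t x T_x; points are pairs (t, x). *)
Definition torus2_measure :
    {measure set (measurableTypeR R * measurableTypeR R) -> \bar R} :=
  (torus_measure \x torus_measure)%E.

End Torus.
Arguments torus_measure {R}.
Arguments torus2_measure {R}.

Section Schatten.
Context (R : realType).
Local Notation C := R[i].
Local Notation fT := (measurableTypeR R -> C).
Local Notation fT2 := (measurableTypeR R * measurableTypeR R -> C).
Local Notation L2T := (cLp (@torus_measure R) 2%:E).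
Local Notation normT := (cLnorm (@torus_measure R) 2%:E).

Definition inner (f g : fT) : C :=
  cintegral torus_measure (fun x => (f x)^* * g x).

Definition expi (y : R) : C := cos y +i* sin y.

Definition fourier_basis (n : int) : fT :=
  fun x => ((Num.sqrt (2 * pi))^-1)%:C * expi (n%:~R * x).

Definition fourier_coef (f : fT) (n : int) : C := inner (fourier_basis n) f.

(* The sum of F k over the integers k with |k| <= N. *)
Definition symsum (F : int -> C) (N : nat) : C :=
  \sum_(k < N.*2.+1) F ((k : nat)%:Z - N%:Z).

(* Operators on L^2(T) act on representatives; only their values on square
   integrable functions, up to a.e. equality, are meaningful. *)
Definition operator := fT -> fT.

Definition lin_op (c : C) (A B : operator) : operator :=
  fun f x => c * A f x + B f x.

Definition bounded_op (A : operator) : Prop :=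
  [/\ forall f, L2T f -> L2T (A f),
      forall (c : C) f g, L2T f -> L2T g ->
        ceq_ae torus_measure (A (fun x => c * f x + g x))
                             (fun x => c * A f x + A g x)
    & exists M : R, forall f, L2T f -> (normT (A f) <= M%:E * normT f)%E].

Definition op_norm (A : operator) : \bar R :=
  ereal_sup [set normT (A f) | f in [set f | L2T f /\ (normT f <= 1)%E]].

Definition adjoint (A : operator) : operator := fun g =>
  xget (fun=> 0)
    [set h | L2T h /\ forall f, L2T f -> inner (A f) g = inner f h].

(* The free Schroedinger propagator U(t) = exp(it Delta), as an L^2-convergent
   Fourier series. *)
Definition propagator (t : R) : operator := fun f =>
  xget (fun=> 0)
    [set g | cvgLp torus_measure 2%:E
       (fun N x => symsum (fun n => fourier_basis n x *
                           expi (- t * (n%:~R) ^+ 2) * fourier_coef f n) N) g].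

Definition evolved (t : R) (A : operator) : operator :=
  fun f => propagator t (A (adjoint (propagator t) f)).

Definition orthonormal_on (J : set nat) (phi : nat -> fT) : Prop :=
  (forall n, L2T (phi n)) /\
  (forall j k, J j -> J k -> inner (phi j) (phi k) = (j == k)%:R).

(* A = sum_n a_n |phi_n><psi_n|, strongly. Finite expansions are padded with
   zero coefficients, so orthonormality only concerns the n with a_n != 0. *)
Definition is_svd (A : operator) (a : nat -> R) (phi psi : nat -> fT) : Prop :=
  [/\ forall n, 0 <= a n,
      orthonormal_on [set n | a n != 0] phi,
      orthonormal_on [set n | a n != 0] psi
    & forall f, L2T f -> cvgLp torus_measure 2%:E
        (fun N x => \sum_(n < N) (a n)%:C * inner (psi n) f * phi n x) (A f)].

(* B = |A|: the positive square root of A^* A. *)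
Definition is_abs_op (A B : operator) : Prop :=
  [/\ bounded_op B,
      forall f, L2T f -> 0 <= inner f (B f)
    & forall f, L2T f -> ceq_ae torus_measure (B (B f)) (adjoint A (A f))].

(* P = |A|^r, by functional calculus on an eigenbasis expansion of |A|; there
   is such a P only if |A| has an eigenbasis, as when A is compact. *)
Definition is_abs_power (A : operator) (r : R) (P : operator) : Prop :=
  exists (B : operator) (s : nat -> R) (psi : nat -> fT),
    [/\ is_abs_op A B, is_svd B s psi psi
      & is_svd P (fun n => s n `^ r) psi psi].

(* Trace, in [0, +oo], of a positive operator. *)
Definition ptrace (P : operator) : \bar R :=
  (\esum_(n in [set: int])
     (complex.Re (inner (fourier_basis n) (P (fourier_basis n))))%:E)%E.

(* For finite exponents the infimum ranges over the single value
   (Tr |A|^r)^(1/r), or is +oo when |A|^r is not available, in which case A is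
   not compact and so in no Schatten class of finite exponent. *)
Definition schatten_norm (alpha : \bar R) (A : operator) : \bar R :=
  match alpha with
  | r%:E => ereal_inf [set (ptrace P `^ r^-1)%E | P in is_abs_power A r]
  | _ => op_norm A
  end.

Definition schatten (alpha : \bar R) (A : operator) : Prop :=
  bounded_op A /\ (schatten_norm alpha A < +oo)%E.

Definition trace (A : operator) : C :=
  let S := symsum (fun n => inner (fourier_basis n) (A (fourier_basis n))) in
  limn (fun N => complex.Re (S N) : R) +i* limn (fun N => complex.Im (S N) : R).

Definition density (A : operator) : fT :=
  xget (fun=> 0)
    [set rho | exists (a : nat -> R) (phi psi : nat -> fT),
       is_svd A a phi psi /\
       cvgLp torus_measure 1%:E
         (fun N x => \sum_(n < N) (a n)%:C * phi n x * (psi n x)^*) rho].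

Definition rdensity (A : operator) : fT :=
  fun x => density A x - ((2 * pi)^-1)%:C * trace A.

(* F is a jointly measurable representative of
   (t, x) |-> rdensity (U(t) A U(t)^* ) (x). *)
Definition is_rdensity_flow (A : operator) (F : fT2) : Prop :=
  cmeasurable F /\
  {ae torus_measure, forall t,
    ceq_ae torus_measure (fun x => F (t, x)) (rdensity (evolved t A))}.

(* T is a bounded linear map from S^2 to L^2(T_t x T_x) that sends each trace
   class A to the renormalised density of its free evolution. *)
Definition is_rdensity_extension (T : operator -> fT2) : Prop :=
  [/\ forall A, schatten 2%:E A -> cLp torus2_measure 2%:E (T A),
      forall (c : C) A B, schatten 2%:E A -> schatten 2%:E B ->
        ceq_ae torus2_measure (T (lin_op c A B))
                              (fun z => c * T A z + T B z),
      exists M : R, forall A, schatten 2%:E A ->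
        (cLnorm torus2_measure 2%:E (T A) <= M%:E * schatten_norm 2%:E A)%E
    & forall A, schatten 1%:E A -> is_rdensity_flow A (T A)].

End Schatten.

(* Main.v *)
(* Write g_jk = <e_j, A e_k>.  Along the free flow |e_j><e_k| has density
   (2 pi)^-1 e^(i (k^2 - j^2) t) e^(i (j - k) x).  Subtracting Tr A / 2 pi removes
   the terms j = k, and for j != k the pair (k^2 - j^2, j - k) determines (j, k):
   the remaining space-time exponentials are orthonormal.  Hence the renormalised
   density is an orthogonal series with coefficients g_jk, and its squared L^2 norm
   is at most sum_jk |g_jk|^2 = sum_n s_n^2 <= (sum_n s_n^alpha)^(2/alpha) for
   alpha <= 2, where the s_n are the singular values of A.
   For trace class A the partial sums of this series are, at fixed t, the
   renormalised densities of Fourier truncations of U(t) A U(t)^*, which converge in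
   L^1(T) to the renormalised density of U(t) A U(t)^*.  By Fatou's lemma they also
   approach, at almost every t and along a subsequence, the section at t of their
   limit in L^2(T^2), so the two limits agree.
   For alpha > 2 the truncated shift sum_(k < N) |e_(k+1)><e_k| has a flow of norm at
   least N^(1/2), while its Schatten norm is at most N^(1/alpha). *)

Require Import Defs.
From HB Require Import structures.
From mathcomp Require Import all_boot all_order all_algebra.
From mathcomp Require Import all_classical all_reals all_analysis.
From mathcomp Require Import measurable_realfun complex ring lra zify.

Set Implicit Arguments.
Unset Strict Implicit.
Unset Printing Implicit Defensive.

Import Order.TTheory GRing.Theory Num.Theory.
Import numFieldNormedType.Exports.

Local Open Scope classical_set_scope.
Local Open Scope ring_scope.

Local Notation "x %:C" := (real_complex _ x) : ring_scope.
Local Notation Re := complex.Re.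
Local Notation Im := complex.Im.
Local Notation normc := Normc.normc.

(** * Complex numbers *)

(** Functions are representatives, and [adjoint], [propagator] and [density] are arbitrary choices
    among admissible values, so most identities hold only up to null vectors. The delicate case is
    [density]: it selects some singular value decomposition and some [L^1] limit, and its selections
    at different times are unrelated. The way out is the density of [P_N A P_N], with [P_N] a
    Fourier projection: it depends on the matrix entries of [A] alone, and it tends in [L^1] to the
    density computed from any decomposition, because all decompositions have the same sum of
    coefficients. Schatten norms are infima over powers of [|A|]; polar decomposition converts an
    eigenbasis of [|A|] into a decomposition of [A] with the same coefficients, in which the
    estimates are made. The extension is the orthogonal series itself, which makes sense for every
    Hilbert-Schmidt operator; approximation by trace class operators enters only in its uniqueness.
    The factors [(2 pi)^(-1/2)] of [e_j] and [e_k] together normalise an exponential on the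
    two-dimensional torus, whence the constant 1. *)

Section ComplexModulus.
Context (R : realType).
Local Notation C := R[i].
Implicit Types z w : C.

Lemma normc_sqr z : normc z ^+ 2 = Re z ^+ 2 + Im z ^+ 2.
Proof. by case: z => a b /=; rewrite sqr_sqrtr // addr_ge0 // sqr_ge0. Qed.

Lemma ge0_normc z : 0 <= normc z.
Proof. by case: z => a b /=; rewrite sqrtr_ge0. Qed.

Lemma conjcE z : z^* = conjc z.
Proof. by []. Qed.

Lemma normcJM z : z^* * z = (normc z ^+ 2)%:C.
Proof.
rewrite normc_sqr conjcE; case: z => a b; apply/eqP; rewrite eq_complex /=.
by apply/andP; split; apply/eqP; ring.
Qed.

Lemma ler_normcD z w : normc (z + w) <= normc z + normc w.
Proof. by have := le_normcD z w. Qed.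

Lemma normcMl z w : normc (z * w) = normc z * normc w.
Proof. exact: Normc.normcM. Qed.

Lemma normcNl z : normc (- z) = normc z.
Proof. by have := normcN z. Qed.

Lemma normc_conj z : normc z^* = normc z.
Proof. by rewrite conjcE; case: z => a b /=; rewrite sqrrN. Qed.

Lemma normc_subC z w : normc (z - w) = normc (w - z).
Proof. by rewrite -normcNl opprB. Qed.

Lemma normc_realc (x : R) : normc x%:C = `|x|.
Proof. by rewrite /= expr0n /= addr0 sqrtr_sqr. Qed.

Lemma normc_eq0 z : (normc z == 0) = (z == 0).
Proof.
apply/eqP/eqP => [|->]; first exact: Normc.eq0_normc.
by rewrite Normc.normc0.
Qed.

Lemma ler_normc_sum (I : Type) (s : seq I) (F : I -> C) :
  normc (\sum_(i <- s) F i) <= \sum_(i <- s) normc (F i).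
Proof.
elim/big_rec2: _ => [|i x y _ h]; first by rewrite Normc.normc0.
by apply: (le_trans (ler_normcD _ _)); rewrite lerD2l.
Qed.

Lemma ler_Re_normc z : Re z <= normc z.
Proof.
apply: le_trans (ler_norm _) _; rewrite -sqrtr_sqr -[normc z]ger0_norm ?ge0_normc //.
by rewrite -[`|normc z|]sqrtr_sqr ler_wsqrtr // normc_sqr lerDl sqr_ge0.
Qed.

Lemma ler_normRe_normc z : `|Re z| <= normc z.
Proof.
rewrite -sqrtr_sqr -[normc z]ger0_norm ?ge0_normc //.
by rewrite -[`|normc z|]sqrtr_sqr ler_wsqrtr // normc_sqr lerDl sqr_ge0.
Qed.

Lemma ler_normIm_normc z : `|Im z| <= normc z.
Proof.
rewrite -sqrtr_sqr -[normc z]ger0_norm ?ge0_normc //.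
by rewrite -[`|normc z|]sqrtr_sqr ler_wsqrtr // normc_sqr lerDr sqr_ge0.
Qed.

Lemma ler_normc_ReIm z : normc z <= `|Re z| + `|Im z|.
Proof.
rewrite -[leRHS]ger0_norm ?addr_ge0 // -[normc z]ger0_norm ?ge0_normc //.
rewrite -ler_sqr ?nnegrE // ?ge0_normc // !real_normK ?num_real // normc_sqr.
rewrite sqrrD !real_normK ?num_real // addrAC lerDl.
by rewrite mulrn_wge0 // mulr_ge0.
Qed.

Lemma ReM z w : Re (z * w) = Re z * Re w - Im z * Im w.
Proof. by case: z; case: w. Qed.
Lemma ImM z w : Im (z * w) = Re z * Im w + Im z * Re w.
Proof. by case: z; case: w => a b c d /=; rewrite addrC [d * _]mulrC addrC mulrC. Qed.
Lemma ReDl z w : Re (z + w) = Re z + Re w.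
Proof. by case: z; case: w. Qed.
Lemma ImDl z w : Im (z + w) = Im z + Im w.
Proof. by case: z; case: w. Qed.
Lemma ReNl z : Re (- z) = - Re z.
Proof. by case: z. Qed.
Lemma ImNl z : Im (- z) = - Im z.
Proof. by case: z. Qed.
Lemma ReJ z : Re z^* = Re z.
Proof. by case: z. Qed.
Lemma ImJ z : Im z^* = - Im z.
Proof. by case: z. Qed.
Lemma ReMC (x : R) z : Re (x%:C * z) = x * Re z.
Proof. by rewrite ReM /= mul0r subr0. Qed.
Lemma ImMC (x : R) z : Im (x%:C * z) = x * Im z.
Proof. by rewrite ImM /= mul0r addr0. Qed.
Lemma realcM (x y : R) : (x * y)%:C = x%:C * y%:C.
Proof. exact: rmorphM. Qed.
Lemma realcD (x y : R) : (x + y)%:C = x%:C + y%:C.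
Proof. exact: rmorphD. Qed.
Lemma realcJ (x : R) : (x%:C)^* = x%:C.
Proof. by rewrite conjcE /conjc /= oppr0. Qed.
Lemma conjcM z w : (z * w)^* = z^* * w^*.
Proof. exact: rmorphM. Qed.
Lemma conjcD z w : (z + w)^* = z^* + w^*.
Proof. exact: rmorphD. Qed.
Lemma conjc_sum (I : Type) (s : seq I) (P : pred I) (F : I -> C) :
  (\sum_(i <- s | P i) F i)^* = \sum_(i <- s | P i) (F i)^*.
Proof. exact: rmorph_sum. Qed.
(** Convergence is read off the real distance, so that squeezing and uniqueness of limits come from
    [R]. *)
Definition ccvg (z : nat -> C) (l : C) : Prop :=
  (fun n => normc (l - z n)) @ \oo --> (0 : R).

Lemma cvg0_le (u v : nat -> R) : (forall n, 0 <= u n <= v n) ->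
  v @ \oo --> (0 : R) -> u @ \oo --> (0 : R).
Proof.
move=> uv v0; apply: (@squeeze_cvgr _ _ _ _ (fun=> 0) v) => //; last exact: cvg_cst.
by near=> n; exact: uv.
Unshelve. all: by end_near. Qed.

Lemma ccvg_unique (z : nat -> C) l l' : ccvg z l -> ccvg z l' -> l = l'.
Proof.
move=> zl zl'; apply/eqP; rewrite -subr_eq0 -normc_eq0; apply/eqP.
have h : (fun n => normc (l - z n) + normc (l' - z n)) @ \oo --> (0 : R).
  by rewrite -[X in _ --> X]addr0; exact: cvgD.
have : (fun _ : nat => normc (l - l')) @ \oo --> (0 : R).
  apply: cvg0_le h => n; rewrite ge0_normc /=.
  rewrite [normc (l' - _)]normc_subC; apply: le_trans (ler_normcD _ _).
  by rewrite addrA subrK.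
by move=> /cvg_lim <- //; rewrite lim_cst.
Qed.

Lemma ccvg_cst l : ccvg (fun=> l) l.
Proof. by rewrite /ccvg subrr Normc.normc0; exact: cvg_cst. Qed.

Lemma ccvg_ext (z w : nat -> C) l : (forall n, z n = w n) -> ccvg z l -> ccvg w l.
Proof. by move=> zw; rewrite (funext zw). Qed.

Lemma ccvg_le (z : nat -> C) l (v : nat -> R) :
  (forall n, normc (l - z n) <= v n) -> v @ \oo --> (0 : R) -> ccvg z l.
Proof. by move=> h; apply: cvg0_le => n; rewrite ge0_normc h. Qed.

Lemma ccvgD (z w : nat -> C) l k : ccvg z l -> ccvg w k ->
  ccvg (fun n => z n + w n) (l + k).
Proof.
move=> zl wk.
have h : (fun n => normc (l - z n) + normc (k - w n)) @ \oo --> (0 : R).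
  by rewrite -[X in _ --> X]addr0; exact: cvgD.
apply: ccvg_le h => n; apply: le_trans (ler_normcD _ _).
by rewrite opprD addrACA.
Qed.

Lemma ccvg_sum (I : Type) (s : seq I) (z : I -> nat -> C) (l : I -> C) :
  (forall i, ccvg (z i) (l i)) ->
  ccvg (fun n => \sum_(i <- s) z i n) (\sum_(i <- s) l i).
Proof.
move=> h; elim: s => [|i s ih].
  by rewrite big_nil; under [X in ccvg X]eq_fun do rewrite big_nil; exact: ccvg_cst.
by rewrite big_cons; under [X in ccvg X]eq_fun do rewrite big_cons; exact: ccvgD.
Qed.

Lemma ccvg_conj (z : nat -> C) l : ccvg z l -> ccvg (fun n => (z n)^*) l^*.
Proof.
apply: cvg0_le => n; rewrite ge0_normc -(normc_conj (l - _)) /=.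
by rewrite rmorphB.
Qed.

Lemma ccvg_Re (z : nat -> C) l : ccvg z l -> (fun n => Re (z n)) @ \oo --> Re l.
Proof.
move=> zl; apply/cvgrPdist_le => e e0.
move/cvgrPdist_le: zl => /(_ e e0) [N _ h]; exists N => // n /= nN.
have := h n nN; rewrite /= sub0r normrN (ger0_norm (ge0_normc _)); apply: le_trans.
by rewrite -ReNl -ReDl; exact: ler_normRe_normc.
Qed.

Lemma ccvg_Im (z : nat -> C) l : ccvg z l -> (fun n => Im (z n)) @ \oo --> Im l.
Proof.
move=> zl; apply/cvgrPdist_le => e e0.
move/cvgrPdist_le: zl => /(_ e e0) [N _ h]; exists N => // n /= nN.
have := h n nN; rewrite /= sub0r normrN (ger0_norm (ge0_normc _)); apply: le_trans.
by rewrite -ImNl -ImDl; exact: ler_normIm_normc.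
Qed.

End ComplexModulus.

(** * Hilbert spaces, up to null vectors *)

(* Vectors at distance [hnorm = 0] are not identified: the intended model is the
   space of square integrable functions, not its quotient. *)
Record hilbert (R : realType) (V : lmodType R[i]) (S : V -> Prop)
    (ip : V -> V -> R[i]) : Prop := Hilbert {
  hilbert0 : S 0;
  hilbert_lin : forall c f g, S f -> S g -> S (c *: f + g);
  ip_linr : forall c f g h, S f -> S g -> S h ->
    ip h (c *: f + g) = c * ip h f + ip h g;
  ip_conj : forall f g, ip g f = (ip f g)^*;
  ip_ge0 : forall f, S f -> 0 <= ip f f;
  hilbert_complete : forall u : nat -> V, (forall n, S (u n)) ->
    (forall e : R, 0 < e -> exists N, forall m n, (N <= m)%N -> (N <= n)%N ->
       complex.Re (ip (u m - u n) (u m - u n)) < e) ->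
    exists2 f, S f &
      (fun n => complex.Re (ip (f - u n) (f - u n))) @ \oo --> (0 : R)
}.

Section HilbertNorm.
Context (R : realType) (V : lmodType R[i]) (ip : V -> V -> R[i]).

Definition hnsq (f : V) : R := complex.Re (ip f f).
Definition hilbert_norm f : R := Num.sqrt (hnsq f).
Definition hilbert_cvg (u : nat -> V) f :=
  (fun n => hilbert_norm (f - u n)) @ \oo --> (0 : R).
Definition hilbert_eq f g := hilbert_norm (f - g) = 0.

End HilbertNorm.

Section HilbertTheory.
Context (R : realType) (V : lmodType R[i]) (S : V -> Prop)
  (ip : V -> V -> R[i]) (H : hilbert S ip).
Local Notation C := R[i].
Local Notation nsq := (hnsq ip).
Local Notation hnorm := (hilbert_norm ip).
Local Notation hcvg := (hilbert_cvg ip).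
Local Notation heq := (hilbert_eq ip).
Implicit Types (f g h : V) (c : C).

Let S0 := hilbert0 H.

Lemma hilbertZ c f : S f -> S (c *: f).
Proof. by move=> Sf; rewrite -[c *: f]addr0; exact: (hilbert_lin H). Qed.

Lemma hilbertD f g : S f -> S g -> S (f + g).
Proof. by move=> Sf Sg; rewrite -[f]scale1r; exact: (hilbert_lin H). Qed.

Lemma hilbertN f : S f -> S (- f).
Proof. by move=> Sf; rewrite -scaleN1r; exact: hilbertZ. Qed.

Lemma hilbertB f g : S f -> S g -> S (f - g).
Proof. by move=> Sf Sg; apply: hilbertD => //; exact: hilbertN. Qed.

Lemma hilbert_sum (I : Type) (s : seq I) (P : pred I) (F : I -> V) :
  (forall i, P i -> S (F i)) -> S (\sum_(i <- s | P i) F i).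
Proof. by move=> h; elim/big_ind: _ => //; exact: hilbertD. Qed.

Lemma ip0r h : S h -> ip h 0 = 0.
Proof.
move=> Sh; have := ip_linr H 1 S0 S0 Sh.
by rewrite scaler0 addr0 mul1r => /eqP; rewrite -subr_eq0 opprD addrA subrr sub0r oppr_eq0 => /eqP.
Qed.

Lemma ipZr c f h : S f -> S h -> ip h (c *: f) = c * ip h f.
Proof. by move=> Sf Sh; rewrite -[c *: f]addr0 (ip_linr H) // ip0r // addr0. Qed.

Lemma ipDr f g h : S f -> S g -> S h -> ip h (f + g) = ip h f + ip h g.
Proof. by move=> *; rewrite -[f in LHS]scale1r (ip_linr H) // mul1r. Qed.

Lemma ipNr f h : S f -> S h -> ip h (- f) = - ip h f.
Proof. by move=> *; rewrite -scaleN1r ipZr // mulN1r. Qed.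

Lemma ipBr f g h : S f -> S g -> S h -> ip h (f - g) = ip h f - ip h g.
Proof. by move=> *; rewrite ipDr ?ipNr //; exact: hilbertN. Qed.

Lemma ip_sumr (I : Type) (s : seq I) (P : pred I) (F : I -> V) h : S h ->
  (forall i, P i -> S (F i)) ->
  ip h (\sum_(i <- s | P i) F i) = \sum_(i <- s | P i) ip h (F i).
Proof.
move=> Sh SF; elim: s => [|i s ih]; first by rewrite !big_nil ip0r.
rewrite !big_cons; case: ifP => Pi //; rewrite ipDr ?ih //; first exact: SF.
exact: hilbert_sum.
Qed.

Lemma ipZl c f h : S f -> S h -> ip (c *: f) h = c^* * ip f h.
Proof. by move=> *; rewrite (ip_conj H) ipZr // conjcM -(ip_conj H). Qed.

Lemma ipDl f g h : S f -> S g -> S h -> ip (f + g) h = ip f h + ip g h.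
Proof. by move=> *; rewrite (ip_conj H) ipDr // conjcD -!(ip_conj H). Qed.

Lemma ip_suml (I : Type) (s : seq I) (P : pred I) (F : I -> V) h : S h ->
  (forall i, P i -> S (F i)) ->
  ip (\sum_(i <- s | P i) F i) h = \sum_(i <- s | P i) ip (F i) h.
Proof.
move=> Sh SF; rewrite (ip_conj H) ip_sumr // conjc_sum.
by apply: eq_bigr => i _; rewrite -(ip_conj H).
Qed.

Lemma ge0_nsq f : S f -> 0 <= nsq f.
Proof. by move=> Sf; have := ip_ge0 H Sf; rewrite lecE => /andP[]. Qed.

Lemma ge0_hnorm f : 0 <= hnorm f.
Proof. exact: sqrtr_ge0. Qed.

Lemma hnorm_sqr f : S f -> hnorm f ^+ 2 = nsq f.
Proof. by move=> Sf; rewrite sqr_sqrtr // ge0_nsq. Qed.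

Lemma nsqZ c f : S f -> nsq (c *: f) = normc c ^+ 2 * nsq f.
Proof.
move=> Sf; rewrite /hnsq ipZr ?ipZl //; last exact: hilbertZ.
by rewrite mulrA [c * _]mulrC normcJM ReMC.
Qed.

Lemma hnormZ c f : S f -> hnorm (c *: f) = normc c * hnorm f.
Proof.
by move=> Sf; rewrite /hilbert_norm nsqZ // sqrtrM ?sqr_ge0 // sqrtr_sqr ger0_norm // ge0_normc.
Qed.

Lemma hnormN f : S f -> hnorm (- f) = hnorm f.
Proof. by move=> Sf; rewrite -scaleN1r hnormZ // normcNl Normc.normc1 mul1r. Qed.

Lemma hnorm_subC f g : S f -> S g -> hnorm (f - g) = hnorm (g - f).
Proof. by move=> *; rewrite -hnormN ?opprB //; exact: hilbertB. Qed.

Lemma hnorm0 : hnorm 0 = 0.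
Proof. by rewrite /hilbert_norm /hnsq ip0r // sqrtr0. Qed.

Lemma nsqD f g : S f -> S g -> nsq (f + g) = nsq f + nsq g + 2 * Re (ip f g).
Proof.
move=> Sf Sg; rewrite /hnsq ipDr ?ipDl //; last exact: hilbertD.
by rewrite [ip g f](ip_conj H) !ReDl ReJ; ring.
Qed.

Lemma nsqB f g : S f -> S g -> nsq (f - g) = nsq f + nsq g - 2 * Re (ip f g).
Proof.
move=> Sf Sg; rewrite nsqD ?ipNr //; last exact: hilbertN.
by rewrite ReNl -[- g]scaleN1r nsqZ // normcNl Normc.normc1; ring.
Qed.

(** With [z = ip g f], the vector [f - (t z) g] has nonnegative square norm for every real [t]. If
    [nsq g > 0], take [t = 1 / nsq g]. A nonzero [g] may still have [nsq g = 0]; then the expression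
    is affine in [t], and a nonzero [z] would make it equal to -1 for a suitable [t]. *)
Lemma nsq_cauchy_schwarz f g : S f -> S g ->
  normc (ip f g) ^+ 2 <= nsq f * nsq g.
Proof.
move=> Sf Sg; set z := ip g f.
have zE : normc (ip f g) = normc z by rewrite /z (ip_conj H f) normc_conj.
have key (t : R) : 0 <= nsq f - 2 * t * normc z ^+ 2 + t ^+ 2 * normc z ^+ 2 * nsq g.
  have Sh := hilbertZ (t%:C * z) Sg; have := ge0_nsq (hilbertB Sf Sh).
  rewrite nsqB // nsqZ // normcMl normc_realc exprMn real_normK ?num_real //.
  rewrite ipZr // (ip_conj H g f) -/z -mulrA [z * _]mulrC normcJM -realcM /= => h.
  by apply: le_trans h _; lra.
rewrite zE; have g0 := ge0_nsq Sg; have f0 := ge0_nsq Sf.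
move: g0; rewrite le_eqVlt => /orP[/eqP g0|g0].
  rewrite -g0 mulr0; apply/negPn/negP; rewrite -ltNge => z0.
  have := key ((nsq f + 1) / (2 * normc z ^+ 2)); rewrite -g0 mulr0 addr0.
  have -> : 2 * ((nsq f + 1) / (2 * normc z ^+ 2)) * normc z ^+ 2 = nsq f + 1.
    by field; move: z0; rewrite lt0r expf_eq0 /= => /andP[].
  by lra.
have := key (nsq g)^-1.
have -> : (nsq g)^-1 ^+ 2 * normc z ^+ 2 * nsq g = normc z ^+ 2 / nsq g.
  by field; rewrite gt_eqF.
rewrite -mulrA [_^-1 * _]mulrC => h.
by rewrite -ler_pdivrMr //; lra.
Qed.

Lemma hnorm_cauchy_schwarz f g : S f -> S g ->
  normc (ip f g) <= hnorm f * hnorm g.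
Proof.
move=> Sf Sg; rewrite -ler_sqr ?nnegrE ?mulr_ge0 ?ge0_hnorm ?ge0_normc //.
by rewrite exprMn !hnorm_sqr // nsq_cauchy_schwarz.
Qed.

Lemma ler_hnormD f g : S f -> S g -> hnorm (f + g) <= hnorm f + hnorm g.
Proof.
move=> Sf Sg; rewrite -ler_sqr ?nnegrE ?addr_ge0 ?ge0_hnorm //.
rewrite hnorm_sqr; last exact: hilbertD.
rewrite nsqD // sqrrD !hnorm_sqr // mulr_natl addrAC lerD2r lerD2l.
rewrite lerMn2r /=; apply: le_trans (ler_Re_normc _) _.
exact: hnorm_cauchy_schwarz.
Qed.

Lemma ler_hnorm_dist f g h : S f -> S g -> S h ->
  hnorm (f - h) <= hnorm (f - g) + hnorm (g - h).
Proof.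
move=> Sf Sg Sh; apply: le_trans (ler_hnormD _ _); try exact: hilbertB.
by rewrite addrA subrK.
Qed.

Lemma heq_refl f : heq f f.
Proof. by rewrite /hilbert_eq subrr hnorm0. Qed.

Lemma heq_sym f g : S f -> S g -> heq f g -> heq g f.
Proof. by move=> Sf Sg; rewrite /hilbert_eq hnorm_subC. Qed.

Lemma heq_trans g f h : S f -> S g -> S h -> heq f g -> heq g h -> heq f h.
Proof.
move=> Sf Sg Sh fg gh; apply/eqP; rewrite eq_le ge0_hnorm andbT.
by apply: le_trans (ler_hnorm_dist Sf Sg Sh) _; rewrite fg gh addr0.
Qed.

Lemma heq_hnorm f g : S f -> S g -> heq f g -> hnorm f = hnorm g.
Proof.
move=> Sf Sg fg; apply/eqP; rewrite eq_le; apply/andP; split.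
  have := ler_hnormD (hilbertB Sf Sg) Sg; by rewrite subrK fg add0r.
have := ler_hnormD (hilbertB Sg Sf) Sf; by rewrite subrK (heq_sym Sf Sg fg) add0r.
Qed.

Lemma heqD f g f' g' : S f -> S g -> S f' -> S g' ->
  heq f f' -> heq g g' -> heq (f + g) (f' + g').
Proof.
move=> Sf Sg Sf' Sg' ff gg; apply/eqP; rewrite eq_le ge0_hnorm andbT opprD addrACA.
by apply: le_trans (ler_hnormD _ _) _; rewrite ?ff ?gg ?addr0 //; exact: hilbertB.
Qed.

Lemma heqZ c f g : S f -> S g -> heq f g -> heq (c *: f) (c *: g).
Proof.
by move=> Sf Sg fg; rewrite /hilbert_eq -scalerBr hnormZ ?fg ?mulr0 //; exact: hilbertB.
Qed.

Lemma heq_sum (I : Type) (s : seq I) (F G : I -> V) :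
  (forall i, S (F i)) -> (forall i, S (G i)) -> (forall i, heq (F i) (G i)) ->
  heq (\sum_(i <- s) F i) (\sum_(i <- s) G i).
Proof.
move=> SF SG FG; elim: s => [|i s ih]; first by rewrite !big_nil; exact: heq_refl.
by rewrite !big_cons; apply: heqD => //; exact: hilbert_sum.
Qed.

Lemma heqBr_hnorm f g g' : S f -> S g -> S g' -> heq g g' ->
  hnorm (f - g) = hnorm (f - g').
Proof.
move=> Sf Sg Sg' gg; apply: heq_hnorm; try exact: hilbertB.
apply: heqD => //; try exact: hilbertN; first exact: heq_refl.
by rewrite -[- g]scaleN1r -[- g']scaleN1r; exact: heqZ.
Qed.

(** By Cauchy-Schwarz the inner product does not see null vectors; this is what allows one
    representative to be replaced by another. *)
Lemma heq_ipr f g h : S f -> S g -> S h -> heq f g -> ip h f = ip h g.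
Proof.
move=> Sf Sg Sh fg; apply/eqP; rewrite -subr_eq0 -ipBr // -normc_eq0.
rewrite eq_le ge0_normc andbT.
have := hnorm_cauchy_schwarz Sh (hilbertB Sf Sg); by rewrite fg mulr0.
Qed.

Lemma heq_ipl f g h : S f -> S g -> S h -> heq f g -> ip f h = ip g h.
Proof. by move=> *; rewrite (ip_conj H) (heq_ipr _ _ _ (g := g)) // -(ip_conj H). Qed.

Lemma heq_orth f g : S f -> S g -> (forall h, S h -> ip h f = ip h g) -> heq f g.
Proof.
move=> Sf Sg h; rewrite /hilbert_eq /hilbert_norm /hnsq ipBr ?h ?subrr ?sqrtr0 //; exact: hilbertB.
Qed.

Lemma nsq_hcvg u f : (fun n => nsq (f - u n)) @ \oo --> (0 : R) -> hcvg u f.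
Proof.
move=> h; suff : (fun n => hnorm (f - u n)) @ \oo --> Num.sqrt (0 : R).
  by rewrite sqrtr0.
by apply: continuous_cvg => //; exact: sqrt_continuous.
Qed.

Lemma hcvg_unique u f g : (forall n, S (u n)) -> S f -> S g ->
  hcvg u f -> hcvg u g -> heq f g.
Proof.
move=> Su Sf Sg uf ug.
have h : (fun n => hnorm (f - u n) + hnorm (g - u n)) @ \oo --> (0 : R).
  by rewrite -[X in _ --> X]addr0; exact: cvgD.
have : (fun _ : nat => hnorm (f - g)) @ \oo --> (0 : R).
  apply: cvg0_le h => n; rewrite ge0_hnorm /= (hnorm_subC Sg) //.
  exact: ler_hnorm_dist.
by move=> /cvg_lim h'; rewrite /hilbert_eq -h' // lim_cst.
Qed.

Lemma hcvg_heq u f g : (forall n, S (u n)) -> S f -> S g ->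
  hcvg u f -> heq g f -> hcvg u g.
Proof.
move=> Su Sf Sg uf gf; apply: cvg0_le uf => n; rewrite ge0_hnorm /=.
by apply: le_trans (ler_hnorm_dist Sg Sf (Su n)) _; rewrite gf add0r.
Qed.

Lemma hcvgD u v f g : (forall n, S (u n)) -> (forall n, S (v n)) -> S f -> S g ->
  hcvg u f -> hcvg v g -> hcvg (fun n => u n + v n) (f + g).
Proof.
move=> Su Sv Sf Sg uf vg.
have h : (fun n => hnorm (f - u n) + hnorm (g - v n)) @ \oo --> (0 : R).
  by rewrite -[X in _ --> X]addr0; exact: cvgD.
apply: cvg0_le h => n; rewrite ge0_hnorm /= opprD addrACA.
by apply: ler_hnormD; exact: hilbertB.
Qed.

Lemma hcvgZ c u f : (forall n, S (u n)) -> S f ->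
  hcvg u f -> hcvg (fun n => c *: u n) (c *: f).
Proof.
move=> Su Sf uf.
have h : (fun n => normc c * hnorm (f - u n)) @ \oo --> (0 : R).
  by rewrite -[X in _ --> X](mulr0 (normc c)); exact: cvgMr.
apply: cvg0_le h => n; rewrite ge0_hnorm /= -scalerBr hnormZ //; exact: hilbertB.
Qed.

Lemma ccvg_ipr u f h : (forall n, S (u n)) -> S f -> S h ->
  hcvg u f -> ccvg (fun n => ip h (u n)) (ip h f).
Proof.
move=> Su Sf Sh uf.
have h' : (fun n => hnorm h * hnorm (f - u n)) @ \oo --> (0 : R).
  by rewrite -[X in _ --> X](mulr0 (hnorm h)); exact: cvgMr.
apply: ccvg_le h' => n; rewrite -ipBr //; apply: hnorm_cauchy_schwarz => //.
exact: hilbertB.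
Qed.

Lemma ccvg_ipl u f h : (forall n, S (u n)) -> S f -> S h ->
  hcvg u f -> ccvg (fun n => ip (u n) h) (ip f h).
Proof.
move=> Su Sf Sh uf; rewrite (ip_conj H).
under [X in ccvg X]eq_fun do rewrite (ip_conj H).
exact/ccvg_conj/ccvg_ipr.
Qed.

Lemma cvg_nsq u f : (forall n, S (u n)) -> S f ->
  hcvg u f -> (fun n => nsq (u n)) @ \oo --> nsq f.
Proof.
move=> Su Sf uf.
(* Write [u n] as [f - (f - u n)]: both correction terms are controlled by the distance to [f]. *)
have key n : nsq (u n) = nsq f + hnorm (f - u n) ^+ 2 - 2 * Re (ip f (f - u n)).
  rewrite hnorm_sqr; last exact: hilbertB.
  rewrite nsqB // ipBr // ReDl ReNl -/(nsq f); ring.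
under eq_fun do rewrite key.
suff : (fun n => nsq f + hnorm (f - u n) ^+ 2 - 2 * Re (ip f (f - u n))) @ \oo
    --> nsq f + 0 * 0 - 2 * 0 by rewrite !mulr0 subr0 addr0.
apply: cvgB.
  by apply: cvgD; [exact: cvg_cst|under eq_fun do rewrite expr2; exact: cvgM].
apply: cvgMr.
have h : (fun n => hnorm f * hnorm (f - u n)) @ \oo --> (0 : R).
  by rewrite -[X in _ --> X](mulr0 (hnorm f)); exact: cvgMr.
apply/norm_cvg0P; apply: cvg0_le h => n; rewrite normr_ge0 /=.
apply: le_trans (ler_normRe_normc _) _; apply: hnorm_cauchy_schwarz => //.
exact: hilbertB.
Qed.

End HilbertTheory.

(** * Orthonormal families and their series *)

Section Orthonormal.
Context (R : realType) (V : lmodType R[i]) (S : V -> Prop)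
  (ip : V -> V -> R[i]) (H : hilbert S ip).
Local Notation C := R[i].
Local Notation nsq := (hnsq ip).
Local Notation hnorm := (hilbert_norm ip).
Local Notation hcvg := (hilbert_cvg ip).
Context (I : choiceType).
Implicit Types (J : pred I) (v : I -> V) (c : I -> C).

(** The index set [J] serves three cases: all integers for the Fourier basis, the off-diagonal pairs
    for the space-time exponentials, and the support of the coefficients for singular value
    decompositions. *)
Definition orthonormal J v := (forall i, S (v i)) /\
  (forall i j, J i -> J j -> ip (v i) (v j) = (i == j)%:R).

Definition lincomb v c (s : seq I) : V := \sum_(i <- s) c i *: v i.

Lemma lincomb_in v c (s : seq I) : (forall i, S (v i)) -> S (lincomb v c s).
Proof. by move=> Sv; apply: (hilbert_sum H) => i _; exact: (hilbertZ H). Qed.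

Lemma ip_lincomb J v c (s : seq I) j : orthonormal J v -> (forall i, ~~ J i -> c i = 0) ->
  uniq s -> J j -> ip (v j) (lincomb v c s) = if j \in s then c j else 0.
Proof.
move=> [Sv on] c0 us Jj; rewrite (ip_sumr H) //; last by move=> i _; exact: (hilbertZ H).
have e i : ip (v j) (c i *: v i) = if i == j then c j else 0.
  rewrite (ipZr H) //; have [Ji|nJi] := boolP (J i); last first.
    rewrite c0 // mul0r; case: eqP => // ij; by rewrite ij Jj in nJi.
  by rewrite on // eq_sym; case: eqP => [->|]; rewrite ?mulr1 ?mulr0.
under eq_bigr do rewrite e.
rewrite -big_mkcond /=; case: ifPn => js.
  by rewrite -big_filter (_ : [seq _ <- _ | _] = [:: j]) ?big_seq1 // filter_pred1_uniq.
by rewrite big1_seq // => i /andP[/eqP-> ]; rewrite (negPf js).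
Qed.

Lemma nsq_lincomb J v c (s : seq I) : orthonormal J v -> (forall i, ~~ J i -> c i = 0) ->
  uniq s -> nsq (lincomb v c s) = \sum_(i <- s) normc (c i) ^+ 2.
Proof.
move=> on c0 us; rewrite /hnsq {1}/lincomb (ip_suml H); last 2 first.
- by apply: lincomb_in; case: on.
- by move=> i _; apply: (hilbertZ H); case: on.
rewrite (big_morph (@Re R) (@ReDl R) (erefl _)) !big_seq.
apply: eq_bigr => i si; have Sv := on.1.
rewrite (ipZl H) //; last exact: lincomb_in.
have [Ji|nJi] := boolP (J i); last by rewrite c0 // rmorph0 mul0r Normc.normc0 expr0n.
by rewrite (ip_lincomb on) // si normcJM.
Qed.

Lemma sum_uniq_subset (W : nmodType) (F : I -> W) (s s' : seq I) : uniq s -> uniq s' ->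
  {subset s <= s'} ->
  \sum_(i <- s') F i = \sum_(i <- s) F i + \sum_(i <- s' | i \notin s) F i.
Proof.
move=> us us' ss'; rewrite (bigID (mem s)) /=; congr (_ + _).
rewrite -big_filter; apply: perm_big; apply: uniq_perm => //; first exact: filter_uniq.
by move=> i; rewrite mem_filter; case: (boolP (i \in s)) => //= /ss' ->.
Qed.

Lemma lincombB v c (s s' : seq I) : uniq s -> uniq s' -> {subset s <= s'} ->
  lincomb v c s' - lincomb v c s = lincomb v c [seq i <- s' | i \notin s].
Proof.
move=> us us' ss'; rewrite /lincomb (sum_uniq_subset _ us) //.
by rewrite addrC addrA addNr add0r big_filter.
Qed.

Lemma bessel J v f (s : seq I) : orthonormal J v -> S f -> uniq s -> all J s ->
  \sum_(i <- s) normc (ip (v i) f) ^+ 2 <= nsq f.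
Proof.
move=> on Sf us Js; have Sv := on.1.
(* The coefficients are cut off outside [J], where nothing is known about the inner products of the
   [v i]. *)
pose c i := if J i then ip (v i) f else 0.
have c0 i : ~~ J i -> c i = 0 by rewrite /c => /negPf ->.
have Sl : S (lincomb v c s) by exact: lincomb_in.
have := ge0_nsq H (hilbertB H Sf Sl); rewrite (nsqB H) // (nsq_lincomb on c0) //.
rewrite (ip_sumr H) //; last by move=> i _; exact: (hilbertZ H).
have e : \sum_(i <- s) ip f (c i *: v i) = (\sum_(i <- s) normc (ip (v i) f) ^+ 2)%:C.
  rewrite (big_morph _ (@realcD R) (erefl _)) !big_seq; apply: eq_bigr => i si.
  rewrite (ipZr H) // /c (allP Js) // -normcJM mulrC; congr (_ * _).
  exact: (ip_conj H).
rewrite e /= [X in nsq f + X](_ : _ = \sum_(i <- s) normc (ip (v i) f) ^+ 2); first by lra.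
by rewrite !big_seq; apply: eq_bigr => i si; rewrite /c (allP Js).
Qed.

(* An exhaustion of the index set by finite lists fixes an order of summation. *)
Definition exhaustion (s : nat -> seq I) := [/\ forall n, uniq (s n),
  forall m n, (m <= n)%N -> {subset s m <= s n} & forall i, exists n, i \in s n].

Lemma exhaustion_subset (s : nat -> seq I) (t : seq I) : exhaustion s -> exists n, {subset t <= s n}.
Proof.
move=> [_ mono ex]; elim: t => [|i t [n tn]]; first by exists 0%N.
have [k ik] := ex i; exists (maxn n k) => j; rewrite inE => /orP[/eqP->|/tn].
  exact: mono (leq_maxr _ _) _ ik.
exact: mono (leq_maxl _ _) _.
Qed.

Section SumOverExhaustion.
Variables (s : nat -> seq I) (a : I -> R).
Hypotheses (es : exhaustion s) (a0 : forall i, 0 <= a i).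

Lemma exhaustion_sum_mono m n : (m <= n)%N ->
  \sum_(i <- s m) a i <= \sum_(i <- s n) a i.
Proof.
case: es => us mono _ mn.
by rewrite (sum_uniq_subset _ (us m) (us n) (mono m n mn)) lerDl sumr_ge0.
Qed.

(** [esum] is a supremum over finite sets, and each finite set is contained in some [s n]. Together
    with [esum_exhaustion_ge] this passes between ordered partial sums and unordered sums. *)
Lemma esum_exhaustion_le (M : \bar R) :
  (forall n, ((\sum_(i <- s n) a i)%:E <= M)%E) ->
  (\esum_(i in [set: I]) (a i)%:E <= M)%E.
Proof.
move=> h; apply: ub_ereal_sup => _ [F [finF _] <-].
have [n Fn] := exhaustion_subset (finmap.enum_fset (fset_set F)) es.
apply: le_trans (h n); rewrite fsbig_finite //= sumEFin lee_fin.
case: es => us mono _.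
by rewrite (sum_uniq_subset _ (finmap.fset_uniq _) (us n) Fn) lerDl sumr_ge0.
Qed.

Lemma esum_exhaustion_ge n :
  ((\sum_(i <- s n) a i)%:E <= \esum_(i in [set: I]) (a i)%:E)%E.
Proof.
apply: ereal_sup_ubound; exists [set` s n]; first by split => //; exact: finite_seq.
case: es => us _ _.
by rewrite -fsbig_seq // sumEFin.
Qed.

Lemma cvg_sum_esum (l : R) : (fun n => \sum_(i <- s n) a i) @ \oo --> l ->
  l%:E = (\esum_(i in [set: I]) (a i)%:E)%E.
Proof.
move=> cv; apply/eqP; rewrite eq_le; apply/andP; split; last first.
  apply: esum_exhaustion_le => n; rewrite lee_fin.
  rewrite -(cvg_lim _ cv) //; apply: nondecreasing_cvgn_le.
    by move=> p q; exact: exhaustion_sum_mono.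
  by apply/cvg_ex; eexists; exact: cv.
have {}cv : (fun n => (\sum_(i <- s n) a i)%:E) @ \oo --> l%:E.
  by apply: cvg_EFin => //; near=> n.
rewrite -(cvg_lim _ cv) //; apply: lime_le; first by apply/cvg_ex; eexists; exact: cv.
by near=> n; exact: esum_exhaustion_ge.
Unshelve. all: by end_near. Qed.

End SumOverExhaustion.

(** By Pythagoras the squared distance of two partial sums is a difference of two terms of the
    monotone bounded sequence [a], so the partial sums are Cauchy. *)
Lemma riesz_fischer J v c (s : nat -> seq I) (M : R) :
  orthonormal J v -> (forall i, ~~ J i -> c i = 0) -> exhaustion s ->
  (forall n, \sum_(i <- s n) normc (c i) ^+ 2 <= M) ->
  exists2 f, S f & hcvg (fun n => lincomb v c (s n)) f.
Proof.
move=> on c0 es hM; have Sv := on.1.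
pose a n := \sum_(i <- s n) normc (c i) ^+ 2.
have amono m n : (m <= n)%N -> a m <= a n.
  by apply: exhaustion_sum_mono => // i; rewrite sqr_ge0.
have dist m n : (m <= n)%N ->
    nsq (lincomb v c (s n) - lincomb v c (s m)) = a n - a m.
  move=> mn; case: es => us mono _; rewrite lincombB //; last exact: mono.
  rewrite (nsq_lincomb on) ?filter_uniq // big_filter /a.
  apply/eqP; rewrite eq_sym subr_eq eq_sym addrC; apply/eqP.
  by rewrite (sum_uniq_subset _ (us m) (us n) (mono m n mn)).
have acv : cvgn a.
  apply: nondecreasing_is_cvgn; first by move=> m n; exact: amono.
  by exists M => _ [n _ <-]; exact: hM.
have Sl n : S (lincomb v c (s n)) by exact: lincomb_in.
have cau (e : R) : 0 < e -> exists N, forall m n, (N <= m)%N -> (N <= n)%N ->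
    nsq (lincomb v c (s m) - lincomb v c (s n)) < e.
  move=> e0; have e20 : 0 < e / 2 by rewrite divr_gt0.
  have /cvgrPdist_lt/(_ _ e20) [N _ hN] := acv.
  exists N => m n Nm Nn.
  wlog mn : m n Nm Nn / (n <= m)%N => [wl|].
    have [nm|/ltnW mn] := leqP n m; first exact: wl.
    have SB k l : S (lincomb v c (s k) - lincomb v c (s l)) by exact: (hilbertB H).
    by have := wl _ _ Nn Nm mn; rewrite -!(hnorm_sqr H) // (hnorm_subC H).
  rewrite dist //; have := hN _ Nm; have := hN _ Nn; rewrite /=.
  by rewrite !ltr_norml => /andP[h1 h2] /andP[h3 h4]; lra.
have [f Sf fl] := hilbert_complete H Sl cau.
by exists f => //; exact: nsq_hcvg.
Qed.

Lemma bessel_pred J v f (s : seq I) : orthonormal J v -> S f -> uniq s ->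
  \sum_(i <- s | J i) normc (ip (v i) f) ^+ 2 <= nsq f.
Proof.
move=> on Sf us; rewrite -big_filter; apply: (bessel on) => //.
  exact: filter_uniq.
exact: filter_all.
Qed.

Section LimitOfSeries.
Variables (J : pred I) (v : I -> V) (c : I -> C) (s : nat -> seq I) (f : V).
Hypotheses (on : orthonormal J v) (c0 : forall i, ~~ J i -> c i = 0)
  (es : exhaustion s) (Sf : S f) (sf : hcvg (fun n => lincomb v c (s n)) f).

Let Sl n : S (lincomb v c (s n)). Proof. by apply: lincomb_in; case: on. Qed.

Lemma hcvg_coef j : J j -> ip (v j) f = c j.
Proof.
move=> Jj; have Sv := on.1.
apply: (@ccvg_unique _ (fun n => ip (v j) (lincomb v c (s n)))).
  exact: (ccvg_ipr H).
case: es => us mono ex; have [N jN] := ex j.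
apply: cvg_near_cst; exists N => // n /= Nn.
by rewrite (ip_lincomb on) // (mono _ _ Nn) // subrr Normc.normc0.
Qed.

Lemma hcvg_nsq : (nsq f)%:E = (\esum_(i in [set: I]) (normc (c i) ^+ 2)%:E)%E.
Proof.
have a0 i : 0 <= normc (c i) ^+ 2 by rewrite sqr_ge0.
have [us _ _] := es; have := cvg_nsq H Sl Sf sf.
under eq_fun do rewrite (nsq_lincomb on) //.
exact: (cvg_sum_esum es).
Qed.

End LimitOfSeries.

Definition total J v := forall f, S f -> (forall i, J i -> ip (v i) f = 0) -> hnorm f = 0.

Section Expansion.
Variables (v : I -> V) (s : nat -> seq I) (f : V).
Hypotheses (on : orthonormal xpredT v) (es : exhaustion s) (Sf : S f)
  (tot : total xpredT v).

(** Bessel and Riesz-Fischer give a limit [g] with the same coefficients as [f]; totality makes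
    [f - g] a null vector. *)
Lemma total_expansion : hcvg (fun n => lincomb v (fun i => ip (v i) f) (s n)) f.
Proof.
have c0 i : ~~ xpredT i -> ip (v i) f = 0 by [].
have bound n : \sum_(i <- s n) normc (ip (v i) f) ^+ 2 <= nsq f.
  by apply: (bessel on) => //; [case: es|exact/allP].
have [g Sg gl] := riesz_fischer on c0 es bound; have Sv := on.1.
apply: (hcvg_heq H _ Sg) => // [n|]; first exact: lincomb_in.
apply: tot; first exact: (hilbertB H).
by move=> i _; rewrite (ipBr H) // (hcvg_coef on c0 es Sg gl) // subrr.
Qed.

Lemma parseval :
  (nsq f)%:E = (\esum_(i in [set: I]) (normc (ip (v i) f) ^+ 2)%:E)%E.
Proof. by apply: (hcvg_nsq on _ es Sf total_expansion). Qed.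

End Expansion.

End Orthonormal.

(** * Singular value decompositions *)

Section Operators.
Context (R : realType) (V : lmodType R[i]) (S : V -> Prop)
  (ip : V -> V -> R[i]) (H : hilbert S ip).
Local Notation C := R[i].
Local Notation nsq := (hnsq ip).
Local Notation hnorm := (hilbert_norm ip).
Local Notation hcvg := (hilbert_cvg ip).
Local Notation heq := (hilbert_eq ip).
Local Notation orthonormal := (orthonormal S ip).
Implicit Types (A B P : V -> V) (a b : nat -> R) (phi psi : nat -> V).

Definition hbounded A : Prop :=
  [/\ forall f, S f -> S (A f),
      forall c f g, S f -> S g -> heq (A (c *: f + g)) (c *: A f + A g)
    & exists M : R, forall f, S f -> hnorm (A f) <= M * hnorm f].

Section Bounded.
Variables (A : V -> V) (bA : hbounded A).

Let SA f : S f -> S (A f). Proof. by case: bA => h _ _; exact: h. Qed.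

Lemma hbounded_ge0 : exists2 M : R, 0 <= M & forall f, S f -> hnorm (A f) <= M * hnorm f.
Proof.
case: bA => _ _ [M hM]; exists (Num.max M 0); first by rewrite le_max lexx orbT.
move=> f Sf; apply: le_trans (hM f Sf) _.
by rewrite ler_wpM2r ?ge0_hnorm // le_max lexx.
Qed.

Lemma hboundedB f g : S f -> S g -> heq (A (f - g)) (A f - A g).
Proof.
move=> Sf Sg; case: bA => _ lin _; have := lin (-1) g f Sg Sf.
by rewrite !scaleN1r ![- _ + _]addrC.
Qed.

Lemma hbounded_heq f g : S f -> S g -> heq f g -> heq (A f) (A g).
Proof.
move=> Sf Sg fg; have [M M0 hM] := hbounded_ge0.
have Sfg := hilbertB H Sf Sg.
apply/eqP; rewrite eq_le ge0_hnorm andbT.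
rewrite -(heq_hnorm H _ _ (hboundedB Sf Sg)); [|exact: SA|by apply: (hilbertB H); exact: SA].
by apply: le_trans (hM _ Sfg) _; rewrite fg mulr0.
Qed.

Lemma hbounded0 : heq (A 0) 0.
Proof.
have S0 := hilbert0 H.
have [M M0 hM] := hbounded_ge0; apply/eqP; rewrite eq_le ge0_hnorm andbT.
by rewrite subr0; apply: le_trans (hM _ S0) _; rewrite (hnorm0 H) mulr0.
Qed.

Lemma hbounded_lincomb (I : choiceType) (v : I -> V) c (s : seq I) :
  (forall i, S (v i)) -> heq (A (lincomb v c s)) (lincomb (A \o v) c s).
Proof.
move=> Sv; have SAv i : S ((A \o v) i) by exact: SA.
elim: s => [|i s ih]; first by rewrite /lincomb !big_nil; exact: hbounded0.
rewrite /lincomb !big_cons -!/(lincomb _ _ _).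
have Sl := lincomb_in H c s Sv; have SAl := lincomb_in H c s SAv.
case: bA => _ lin _; apply: (heq_trans H _ _ _ (lin _ _ _ _ _)) => //.
- by apply: SA; exact: (hilbert_lin H).
- by apply: (hilbert_lin H); exact: SA.
- exact: (hilbert_lin H).
by rewrite /hilbert_eq opprD addrACA subrr add0r.
Qed.

Lemma hbounded_cvg u f : (forall n, S (u n)) -> S f -> hcvg u f ->
  hcvg (A \o u) (A f).
Proof.
move=> Su Sf uf; have [M M0 hM] := hbounded_ge0.
have h : (fun n => M * hnorm (f - u n)) @ \oo --> (0 : R).
  by rewrite -[X in _ --> X](mulr0 M); exact: cvgMr.
apply: cvg0_le h => n; rewrite ge0_hnorm /=.
have Sfu := hilbertB H Sf (Su n); apply: le_trans (hM _ Sfu).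
by rewrite (heq_hnorm H _ _ (hboundedB Sf (Su n))) //; [exact: SA|apply: (hilbertB H); exact: SA].
Qed.

Section Adjoint.
Variables (I : choiceType) (e : I -> V) (s : nat -> seq I).
Hypotheses (one : orthonormal xpredT e) (tot : total S ip xpredT e)
  (es : exhaustion s).

(** The adjoint vector is built by coordinates: its coefficients must be [c i = ip (A (e i)) g].
    They are square summable, because testing [A] on a partial sum with these coefficients gives
    [X <= M * sqrt X * hnorm g], where [X] is the sum of their squared moduli. The identity then
    extends from partial sums to all [f] by continuity. *)
Lemma hbounded_adjoint g : S g ->
  exists2 h, S h & forall f, S f -> ip (A f) g = ip f h.
Proof.
move=> Sg; have [M M0 hM] := hbounded_ge0; have Se := one.1.
have [us _ _] := es.
have SAe i : S (A (e i)) by exact: SA.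
have ipA c (t : seq I) : ip (A (lincomb e c t)) g =
    \sum_(i <- t) (c i)^* * ip (A (e i)) g.
  rewrite (heq_ipl H _ _ _ (hbounded_lincomb c t Se)) //; last 2 first.
  - by apply: SA; exact: (lincomb_in H).
  - by apply: (lincomb_in H) => i; exact: SA.
  rewrite (ip_suml H) //; last by move=> i _; apply: (hilbertZ H); exact: SAe.
  by apply: eq_bigr => i _; rewrite (ipZl H) //; exact: SAe.
pose c i := ip (A (e i)) g.
have bound n : \sum_(i <- s n) normc (c i) ^+ 2 <= (M * hnorm g) ^+ 2.
  set X := \sum_(i <- _) _; have X0 : 0 <= X by apply: sumr_ge0 => i _; rewrite sqr_ge0.
  have Sl := lincomb_in H c (s n) Se.
  have eX : ip (A (lincomb e c (s n))) g = X%:C.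
    rewrite ipA (big_morph _ (@realcD R) (erefl _)); apply: eq_bigr => i _.
    by rewrite normcJM.
  have := hnorm_cauchy_schwarz H (SA Sl) Sg; rewrite eX normc_realc ger0_norm // => le1.
  have le2 : X <= M * hnorm (lincomb e c (s n)) * hnorm g.
    by apply: le_trans le1 _; rewrite ler_wpM2r ?ge0_hnorm // hM.
  have e3 : hnorm (lincomb e c (s n)) ^+ 2 = X.
    by rewrite (hnorm_sqr H) // (nsq_lincomb H one).
  move: e3 le2; set y := hnorm (lincomb _ _ _) => e3 le2.
  have y0 : 0 <= y by exact: ge0_hnorm.
  rewrite -e3 ler_sqr ?nnegrE ?mulr_ge0 ?ge0_hnorm //.
  move: le2; rewrite -e3 expr2 mulrAC; move: y0; rewrite le_eqVlt => /orP[/eqP <- _|y0].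
    by rewrite mulr_ge0 ?ge0_hnorm.
  by rewrite ler_pM2r.
(* Every index is active here, so the condition on coefficients at inactive indices is vacuous. *)
have [h Sh hl] := riesz_fischer H one (fun i (n : ~~ xpredT i) => False_ind _ (notF n)) es bound.
exists h => // f Sf.
have Sl n : S (lincomb e c (s n)) by exact: (lincomb_in H).
pose d i := ip (e i) f.
have Sd n : S (lincomb e d (s n)) by exact: (lincomb_in H).
have fd : hcvg (fun n => lincomb e d (s n)) f by exact: (total_expansion H one es Sf tot).
apply: (@ccvg_unique _ (fun n => ip (A (lincomb e d (s n))) g)).
  by apply: (ccvg_ipl H _ _ Sg (hbounded_cvg Sd Sf fd)) => [n|]; exact: SA.
have -> : (fun n => ip (A (lincomb e d (s n))) g) = (fun n => ip (lincomb e d (s n)) h).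
  apply: funext => n; rewrite ipA (ip_suml H) //; last by move=> i _; exact: (hilbertZ H).
  apply: eq_bigr => i _; rewrite (ipZl H) //; congr (_ * _).
  by rewrite (hcvg_coef H one _ es Sh hl).
exact: (ccvg_ipl H).
Qed.

End Adjoint.

End Bounded.

Lemma exhaustion_iota : exhaustion (index_iota 0).
Proof.
split=> [n|m n mn i|i]; first exact: iota_uniq.
  by rewrite !mem_index_iota /= => /leq_trans; exact.
by exists i.+1; rewrite mem_index_iota /=.
Qed.

Definition svd_sum a phi psi f N :=
  lincomb phi (fun n => (a n)%:C * ip (psi n) f) (index_iota 0 N).

Definition supp a : pred nat := [pred n | a n != 0].

Record hsvd A a phi psi : Prop := HSvd {
  svd_ge0 : forall n, 0 <= a n;
  svd_onl : orthonormal (supp a) phi;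
  svd_onr : orthonormal (supp a) psi;
  svd_in : forall f, S f -> S (A f);
  svd_cvg : forall f, S f -> hcvg (svd_sum a phi psi f) (A f)
}.

Lemma supp0 a x n : ~~ supp a n -> (a n)%:C * x = 0 :> C.
Proof. by rewrite /= negbK => /eqP ->; rewrite mul0r. Qed.

Lemma cvg_Re_sum_esum (b : nat -> R) (w : nat -> C) l : (forall n, 0 <= b n) ->
  (forall n, w n = (b n)%:C) ->
  ccvg (fun N => \sum_(n <- index_iota 0 N) w n) l ->
  0 <= l /\ (Re l)%:E = (\esum_(n in [set: nat]) (b n)%:E)%E.
Proof.
move=> b0 wb; have -> : (fun N => \sum_(n <- index_iota 0 N) w n) =
    (fun N => (\sum_(n <- index_iota 0 N) b n)%:C).
  apply: funext => N; rewrite (big_morph _ (@realcD R) (erefl _)).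
  exact: eq_bigr.
move=> cv; have cvR := ccvg_Re cv; have cvI := ccvg_Im cv.
split; last exact: (cvg_sum_esum exhaustion_iota).
have eR := cvg_lim (@Rhausdorff R) cvR.
have /= eI := cvg_lim (@Rhausdorff R) cvI; rewrite lim_cst // in eI.
rewrite lecE -eI eqxx /= -eR; apply: limr_ge; first by apply/cvg_ex; eexists; exact: cvR.
by near=> n; exact: sumr_ge0.
Unshelve. all: by end_near. Qed.

Section SingularValues.
Variables (A : V -> V) (a : nat -> R) (phi psi : nat -> V).
Hypothesis sA : hsvd A a phi psi.

Let a0 := svd_ge0 sA.
Let onl := svd_onl sA.
Let onr := svd_onr sA.
Let Sphi := onl.1.
Let Spsi := onr.1.
Let SA f (Sf : S f) := svd_in sA Sf.

Lemma svd_sum_in f N : S (svd_sum a phi psi f N).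
Proof. exact: (lincomb_in H). Qed.

Lemma svd_coef f n : S f -> a n != 0 -> ip (phi n) (A f) = (a n)%:C * ip (psi n) f.
Proof.
move=> Sf an; apply: (hcvg_coef H onl _ exhaustion_iota (SA Sf) (svd_cvg sA Sf)) => //.
by move=> i; exact: supp0.
Qed.

Lemma svd_ipr h f : S h -> S f ->
  ccvg (fun N => \sum_(n <- index_iota 0 N) (a n)%:C * ip (psi n) f * ip h (phi n))
    (ip h (A f)).
Proof.
move=> Sh Sf; have := ccvg_ipr H (svd_sum_in f) (SA Sf) Sh (svd_cvg sA Sf).
rewrite /svd_sum /lincomb; under [X in ccvg X]eq_fun => N.
  rewrite (ip_sumr H) //; last by move=> i _; exact: (hilbertZ H).
  under eq_bigr do rewrite (ipZr H) //.
  over.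
by [].
Qed.

Lemma svd_nsq f : S f -> (nsq (A f))%:E =
  (\esum_(n in [set: nat]) (a n ^+ 2 * normc (ip (psi n) f) ^+ 2)%:E)%E.
Proof.
move=> Sf; rewrite (hcvg_nsq H onl _ exhaustion_iota (SA Sf) (svd_cvg sA Sf)).
  by apply: eq_esum => n _; rewrite normcMl normc_realc ger0_norm // exprMn.
by move=> i; exact: supp0.
Qed.

(** The left vectors [phi] have disappeared from the sum: two operators with the same coefficients
    and the same right vectors have the same form, which identifies [A^* A] with the square of the
    modulus. *)
Lemma svd_ip h f : S h -> S f ->
  ccvg (fun N => \sum_(n <- index_iota 0 N)
      (a n ^+ 2)%:C * ip (psi n) f * (ip (psi n) h)^*) (ip (A h) (A f)).
Proof.
move=> Sh Sf; have := svd_ipr (SA Sh) Sf.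
rewrite (_ : (fun N => _) = (fun N => \sum_(n <- index_iota 0 N)
      (a n ^+ 2)%:C * ip (psi n) f * (ip (psi n) h)^*)) //.
apply: funext => N; apply: eq_bigr => n _; have [an|/negPn/eqP ->] := boolP (a n != 0).
  by rewrite (ip_conj H (phi n)) svd_coef // conjcM realcJ expr2 realcM; ring.
by rewrite expr0n /= !mul0r.
Qed.

Lemma svd_linear c f g : S f -> S g -> heq (A (c *: f + g)) (c *: A f + A g).
Proof.
move=> Sf Sg; have Sl := hilbert_lin H c Sf Sg.
apply: (hcvg_unique H (svd_sum_in (c *: f + g))); first exact: SA.
- by apply: (hilbert_lin H); exact: SA.
- exact: (svd_cvg sA).
have -> : svd_sum a phi psi (c *: f + g) =
    (fun N => c *: svd_sum a phi psi f N + svd_sum a phi psi g N).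
  apply: funext => N; rewrite /svd_sum /lincomb scaler_sumr -big_split /=.
  apply: eq_bigr => n _; rewrite scalerA -scalerDl; congr (_ *: _).
  by rewrite (ip_linr H) //; ring.
have SAf := SA Sf; have SAg := SA Sg.
apply: (hcvgD H) => // [n|n|||].
- by apply: (hilbertZ H); exact: svd_sum_in.
- exact: svd_sum_in.
- exact: (hilbertZ H).
- by apply: (hcvgZ H) => [n||] //; [exact: svd_sum_in | exact: (svd_cvg sA)].
- exact: (svd_cvg sA).
Qed.

Lemma svd_le M f : (forall n, a n <= M) -> S f -> hnorm (A f) <= M * hnorm f.
Proof.
move=> aM Sf; have M0 : 0 <= M by exact: le_trans (a0 0%N) (aM 0%N).
rewrite -ler_sqr ?nnegrE ?mulr_ge0 ?ge0_hnorm // exprMn !(hnorm_sqr H) //; last exact: SA.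
rewrite -lee_fin svd_nsq //; apply: (esum_exhaustion_le exhaustion_iota) => [n|N].
  by rewrite mulr_ge0 ?sqr_ge0.
rewrite lee_fin; apply: le_trans (_ : M ^+ 2 * \sum_(n <- index_iota 0 N | supp a n)
    normc (ip (psi n) f) ^+ 2 <= _); last first.
  by rewrite ler_wpM2l ?sqr_ge0 //; apply: (bessel_pred H onr) => //; exact: iota_uniq.
rewrite mulr_sumr [leRHS]big_mkcond /=; apply: ler_sum => n _; case: ifPn => [an|].
  by rewrite ler_wpM2r ?sqr_ge0 // ler_sqr ?nnegrE.
by rewrite negbK => /eqP ->; rewrite expr0n mul0r.
Qed.

Lemma svd_hbounded M : (forall n, a n <= M) -> hbounded A.
Proof.
move=> aM; split; [exact: SA | exact: svd_linear|].
by exists M => f Sf; exact: svd_le.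
Qed.

End SingularValues.

(** Bessel for [psi] bounds the partial sums by [M ^+ 2 * nsq f], so Riesz-Fischer provides each
    value of the operator; choice assembles these values, with 0 taken outside [S]. *)
Lemma hsvd_exists a phi psi M : (forall n, 0 <= a n <= M) ->
  orthonormal (supp a) phi -> orthonormal (supp a) psi ->
  exists A, hsvd A a phi psi.
Proof.
move=> aM onl onr.
suff ex f : exists g, S f -> S g /\ hcvg (svd_sum a phi psi f) g.
  have [A hA] := choice ex; exists A; split=> // [n|f Sf|f Sf].
  - by case/andP: (aM n).
  - by have [] := hA f Sf.
  - by have [] := hA f Sf.
have [Sf|nSf] := pselect (S f); last by exists 0.
have [|N|g Sg gl] := riesz_fischer H onl (c := fun n => (a n)%:C * ip (psi n) f) _
  exhaustion_iota (M := M ^+ 2 * nsq f); last by exists g.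
  by move=> i; exact: supp0.
apply: le_trans (_ : M ^+ 2 * \sum_(n <- index_iota 0 N | supp a n)
    normc (ip (psi n) f) ^+ 2 <= _); last first.
  by rewrite ler_wpM2l ?sqr_ge0 //; apply: (bessel_pred H onr) => //; exact: iota_uniq.
rewrite mulr_sumr [leRHS]big_mkcond /=; apply: ler_sum => n _.
have /andP[an0 anM] := aM n; rewrite normcMl normc_realc ger0_norm // exprMn.
case: ifPn => [an|].
  by rewrite ler_wpM2r ?sqr_ge0 // ler_sqr ?nnegrE // (le_trans an0).
by rewrite negbK => /eqP ->; rewrite expr0n mul0r.
Qed.

Section DiagonalOperator.
Variables (B : V -> V) (b : nat -> R) (psi : nat -> V).
Hypothesis sB : hsvd B b psi psi.
Let onp := svd_onl sB.
Let Spsi := onp.1.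
Let SB f (Sf : S f) := svd_in sB Sf.

Lemma svd_diag_form f : S f -> 0 <= ip f (B f) /\ (Re (ip f (B f)))%:E =
  (\esum_(n in [set: nat]) (b n * normc (ip (psi n) f) ^+ 2)%:E)%E.
Proof.
move=> Sf; apply: cvg_Re_sum_esum (svd_ipr sB Sf Sf) => [n|n].
  by rewrite mulr_ge0 ?sqr_ge0 // (svd_ge0 sB).
by rewrite -mulrA (ip_conj H (psi n) f) [ip _ _ * _]mulrC normcJM realcM.
Qed.

Lemma svd_diag_sym f g : S f -> S g -> ip (B f) g = ip f (B g).
Proof.
move=> Sf Sg; rewrite (ip_conj H).
apply: ccvg_unique (ccvg_conj (svd_ipr sB Sg Sf)) _.
apply: ccvg_ext (svd_ipr sB Sf Sg) => N; rewrite conjc_sum.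
by apply: eq_bigr => n _; rewrite !conjcM realcJ -!(ip_conj H) mulrAC.
Qed.

Lemma svd_diag_eigen n : b n != 0 -> heq (B (psi n)) ((b n)%:C *: psi n).
Proof.
move=> bn; have Sn := Spsi n.
apply: (hcvg_unique H (svd_sum_in sB (psi n)) (SB Sn) (hilbertZ H _ Sn) (svd_cvg sB Sn)).
apply: cvg_near_cst; exists n.+1 => // N /= nN.
rewrite /svd_sum /lincomb (bigD1_seq n) ?iota_uniq ?mem_index_iota //=.
rewrite (onp.2 n n) // eqxx mulr1 big1 ?addr0 ?subrr ?(hnorm0 H) // => m mn.
have [bm|/negPn/eqP ->] := boolP (b m != 0); last by rewrite mul0r scale0r.
by rewrite (onp.2 m n) // (negPf mn) mulr0 scale0r.
Qed.

End DiagonalOperator.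

(** * Polar decomposition *)

Section PolarDecomposition.
Variables (A A' B : V -> V) (s : nat -> R) (psi : nat -> V).
Hypotheses (bA : hbounded A) (bB : hbounded B).
Hypothesis A'in : forall g, S g -> S (A' g).
Hypothesis A'adj : forall f g, S f -> S g -> ip (A f) g = ip f (A' g).
Hypothesis BB : forall f, S f -> heq (B (B f)) (A' (A f)).
Hypothesis sB : hsvd B s psi psi.

Let SA f : S f -> S (A f). Proof. by case: bA => h _ _; exact: h. Qed.
Let SB f : S f -> S (B f). Proof. by case: bB => h _ _; exact: h. Qed.
Let onp := svd_onl sB.
Let Spsi := onp.1.

Lemma abs_ip f g : S f -> S g -> ip (A f) (A g) = ip (B f) (B g).
Proof.
move=> Sf Sg; rewrite A'adj //; last exact: SA.
rewrite -(heq_ipr H _ _ _ (BB Sg)) ?(svd_diag_sym sB) //; auto.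
Qed.

(** The left vectors are [A (psi n) / s n], the images of the eigenvectors under the partial
    isometry of the polar decomposition; since [0^-1 = 0], they vanish off the support. Convergence
    needs no new estimate: [A] and its modulus [B] have equal norms on [f - g N], so the remainder
    of the series for [A] has the same norm as the remainder for [B]. *)
Lemma abs_svd : exists phi, hsvd A s phi psi.
Proof.
have Sphi n : S ((s n)^-1%:C *: A (psi n)) by apply: (hilbertZ H); exact: SA.
exists (fun n => (s n)^-1%:C *: A (psi n)); split=> //; first exact: (svd_ge0 sB).
  split=> // i j; rewrite /= => si sj.
  rewrite (ipZr H) ?(ipZl H) //; try exact: SA.
  rewrite abs_ip // realcJ.
  rewrite (heq_ipl H _ _ _ (svd_diag_eigen sB si)); auto; last exact: (hilbertZ H).
  rewrite (heq_ipr H _ _ _ (svd_diag_eigen sB sj)); auto; try exact: (hilbertZ H).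
  rewrite (ipZr H) ?(ipZl H) //; last exact: (hilbertZ H).
  rewrite realcJ (onp.2 i j) //.
  have [<-|_] := eqVneq i j; last by rewrite !mulr0.
  by rewrite mulr1 -!realcM (_ : _ * _ = 1) //; field.
move=> f Sf.
(* Terms with [s n = 0] are dropped, because there [psi n] is arbitrary and nothing is known of
   [A (psi n)]. *)
pose d n := if s n != 0 then ip (psi n) f else 0.
pose g N := lincomb psi d (index_iota 0 N).
have Sg N : S (g N) by exact: (lincomb_in H).
apply: cvg0_le (svd_cvg sB Sf) => N; rewrite ge0_hnorm /=.
have hA : hnorm (A (f - g N)) = hnorm (B (f - g N)).
  by rewrite /hilbert_norm /hnsq abs_ip //; exact: (hilbertB H).
have eA : heq (A (g N)) (svd_sum s (fun n => (s n)^-1%:C *: A (psi n)) psi f N).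
  have := hbounded_lincomb bA d (index_iota 0 N) Spsi.
  rewrite (_ : lincomb (A \o psi) _ _ = svd_sum s (fun n => (s n)^-1%:C *: A (psi n)) psi f N) //.
  apply: eq_bigr => n _; rewrite /d scalerA; case: ifPn => [sn|/negPn/eqP ->].
    by congr (_ *: _); rewrite mulrAC -realcM divff // mul1r.
  by rewrite !mul0r.
have eB : heq (B (g N)) (svd_sum s psi psi f N).
  have := hbounded_lincomb bB d (index_iota 0 N) Spsi.
  move=> h; apply: (heq_trans H _ _ _ h).
  - by apply: SB; exact: Sg.
  - by apply: (lincomb_in H) => n; exact: SB.
  - exact: (svd_sum_in sB).
  apply: (heq_sum H) => [n|n|n] /=.
  - by apply: (hilbertZ H); exact: SB.
  - exact: (hilbertZ H).
  rewrite /d; case: ifPn => [sn|/negPn/eqP ->]; last first.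
    by rewrite mul0r !scale0r; exact: (heq_refl H).
  rewrite mulrC -scalerA; apply: (heqZ H); [exact: SB | exact: (hilbertZ H)|].
  exact: (svd_diag_eigen sB).
rewrite -(heqBr_hnorm H _ _ _ eA) -?(heqBr_hnorm H _ _ _ eB); auto.
- rewrite -(heq_hnorm H _ _ (hboundedB bA Sf (Sg N))) ?hA; auto; last first.
  + by apply: (hilbertB H); exact: SA.
  + by apply: SA; exact: (hilbertB H).
  rewrite (heq_hnorm H _ _ (hboundedB bB Sf (Sg N))) //.
  + by apply: SB; exact: (hilbertB H).
  + by apply: (hilbertB H); exact: SB.
- exact: (svd_sum_in sB).
- exact: (lincomb_in H).
Qed.

End PolarDecomposition.

Lemma esum_exchange (T1 T2 : choiceType) (w : T1 -> T2 -> \bar R) :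
  (forall i j, (0 <= w i j)%E) ->
  (\esum_(i in [set: T1]) \esum_(j in [set: T2]) w i j =
   \esum_(j in [set: T2]) \esum_(i in [set: T1]) w i j)%E.
Proof.
move=> w0; rewrite !esum_esum //.
rewrite (@reindex_esum _ _ _ [set: T1 * T2] _ id); last first.
  by split=> // -[i j] _; exists (i, j).
rewrite [RHS](@reindex_esum _ _ _ [set: T1 * T2] _ (fun p => (p.2, p.1))) //.
split=> //; first by move=> [i j] [k l] _ _ /= [-> ->].
by move=> [j i] _; exists (i, j).
Qed.

Section Weights.
Context (I : choiceType) (e : I -> V) (s : nat -> seq I).
Hypotheses (one : orthonormal xpredT e) (tot : total S ip xpredT e)
  (es : exhaustion s).

(** After the exchange of sums, Parseval applied to [sqrt (b n) psi n] sums the [n]-th row to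
    [b n * nsq (psi n)]. This is [b n]: either [psi n] is a unit vector or [b n = 0]. *)
Lemma esum_weights b psi : (forall n, 0 <= b n) -> orthonormal (supp b) psi ->
  (\esum_(k in [set: I]) \esum_(n in [set: nat])
      (b n * normc (ip (psi n) (e k)) ^+ 2)%:E = \esum_(n in [set: nat]) (b n)%:E)%E.
Proof.
move=> b0 [Spsi onp]; rewrite esum_exchange; last first.
  by move=> k n; rewrite lee_fin mulr_ge0 ?sqr_ge0.
apply: eq_esum => n _; have Sn := Spsi n.
have := parseval H one es (hilbertZ H (Num.sqrt (b n))%:C Sn) tot.
rewrite (nsqZ H) // normc_realc ger0_norm ?sqrtr_ge0 // sqr_sqrtr // => e1.
transitivity (b n * nsq (psi n))%:E; last first.
  have [bn|/negPn/eqP ->] := boolP (b n != 0); last by rewrite mul0r.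
  by rewrite /hnsq onp // eqxx mulr1.
rewrite e1; apply: eq_esum => k _; have Sk := one.1 k.
rewrite (ipZr H) // normcMl normc_realc ger0_norm ?sqrtr_ge0 // exprMn sqr_sqrtr //.
by rewrite (ip_conj H (psi n)) normc_conj.
Qed.

Lemma svd_hilbert_schmidt A a phi psi : hsvd A a phi psi ->
  (\esum_(k in [set: I]) (nsq (A (e k)))%:E = \esum_(n in [set: nat]) (a n ^+ 2)%:E)%E.
Proof.
move=> sA; rewrite -(esum_weights (b := fun n => a n ^+ 2) (psi := psi)) //.
- by apply: eq_esum => k _; apply: (svd_nsq sA); case: one.
- by move=> n; rewrite sqr_ge0.
- have [Spsi onp] := svd_onr sA; split=> // i j Ji Jj.
  by apply: onp; [move: Ji|move: Jj]; rewrite /supp /= expf_eq0.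
Qed.

Lemma svd_trace P b psi : hsvd P b psi psi ->
  (\esum_(k in [set: I]) (Re (ip (e k) (P (e k))))%:E =
   \esum_(n in [set: nat]) (b n)%:E)%E.
Proof.
move=> sP; rewrite -(esum_weights (svd_ge0 sP) (svd_onr sP)).
by apply: eq_esum => k _; have [_ ->] := svd_diag_form sP (one.1 k).
Qed.

End Weights.

(** Tested against any [h], the two sides become [ip (B h) (B f)] and [ip (A h) (A f)], which have
    the same expansion by [svd_ip]. *)
Lemma svd_abs A A' B a phi psi : hsvd A a phi psi -> hsvd B a psi psi ->
  (forall g, S g -> S (A' g)) ->
  (forall f g, S f -> S g -> ip (A f) g = ip f (A' g)) ->
  forall f, S f -> heq (B (B f)) (A' (A f)).
Proof.
move=> sA sB A'in A'adj f Sf.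
have SA g := svd_in sA (f := g); have SB g := svd_in sB (f := g).
apply: (heq_orth H) => [||h Sh]; [by auto | by auto |].
rewrite -A'adj //; last exact: SA.
rewrite -(svd_diag_sym sB) //; last exact: SB.
exact: ccvg_unique (svd_ip sB Sh Sf) (svd_ip sA Sh Sf).
Qed.

(** By symmetry the trace norm does not depend on the decomposition. For finitely many active [n],
    the sum of the [a' n = <phi'_n, A psi'_n>] is expanded in the other decomposition. The weight of
    [a m] is then a sum of products [<psi_m, psi'_n> <phi'_n, phi_m>]; by [x y <= (x^2 + y^2) / 2]
    and Bessel for both primed families it is at most 1. *)
Lemma svd_sum_le A a phi psi a' phi' psi' :
  hsvd A a phi psi -> hsvd A a' phi' psi' ->
  (\esum_(n in [set: nat]) (a' n)%:E <= \esum_(n in [set: nat]) (a n)%:E)%E.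
Proof.
move=> sA sA'; apply: (esum_exhaustion_le exhaustion_iota) => [n|K].
  exact: (svd_ge0 sA').
have a0 := svd_ge0 sA.
have [Sphi _] := svd_onl sA; have [Spsi _] := svd_onr sA.
have [Sphi' onl'] := svd_onl sA'; have [Spsi' onr'] := svd_onr sA'.
set r := [seq n <- index_iota 0 K | supp a' n].
have -> : \sum_(n <- index_iota 0 K) a' n = \sum_(n <- r) a' n.
  rewrite big_filter [RHS]big_mkcond; apply: eq_bigr => n _ /=.
  by case: ifPn => // /negPn/eqP.
have ra n : n \in r -> a' n != 0 by rewrite mem_filter => /andP[].
have cv : ccvg (fun N => \sum_(n <- r) \sum_(m <- index_iota 0 N)
    (a m)%:C * ip (psi m) (psi' n) * ip (phi' n) (phi m))
    (\sum_(n <- r) ip (phi' n) (A (psi' n))).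
  by apply: ccvg_sum => n; exact: (svd_ipr sA).
have e1 : \sum_(n <- r) ip (phi' n) (A (psi' n)) = (\sum_(n <- r) a' n)%:C.
  rewrite (big_morph _ (@realcD R) (erefl _)) !big_seq; apply: eq_bigr => n nr.
  by rewrite (svd_coef sA') ?ra // onr' ?eqxx ?mulr1 //=; exact: ra.
rewrite e1 in cv; have {}cv := ccvg_Re cv; rewrite /= in cv.
have {}cv : (fun N => (Re (\sum_(n <- r) \sum_(m <- index_iota 0 N)
    (a m)%:C * ip (psi m) (psi' n) * ip (phi' n) (phi m)))%:E) @ \oo -->
    (\sum_(n <- r) a' n)%:E by apply: cvg_EFin => //; exact: nearW.
rewrite -(cvg_lim _ cv) //; apply: lime_le; first by apply/cvg_ex; eexists; exact: cv.
apply: nearW => N; apply: (le_trans _ (esum_exhaustion_ge a exhaustion_iota N)).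
rewrite lee_fin exchange_big (big_morph (@Re R) (@ReDl R) (erefl _)).
apply: ler_sum => m _; have [am|/negPn/eqP ->] := boolP (a m != 0); last first.
  by rewrite big1 // => n _; rewrite !mul0r.
apply: le_trans (ler_Re_normc _) _; apply: le_trans (ler_normc_sum _ _) _.
apply: le_trans (_ : \sum_(n <- r) a m * ((normc (ip (psi' n) (psi m)) ^+ 2 +
    normc (ip (phi' n) (phi m)) ^+ 2) / 2) <= _).
  apply: ler_sum => n _; rewrite !normcMl normc_realc ger0_norm // -mulrA.
  rewrite ler_wpM2l // (ip_conj H (psi' n)) normc_conj.
  set x := normc _; set y := normc _.
  have : 0 <= (x - y) ^+ 2 by rewrite sqr_ge0.
  by rewrite sqrrB; lra.
rewrite -mulr_sumr -[leRHS]mulr1 ler_wpM2l // -mulr_suml big_split /=.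
have u : uniq r by rewrite filter_uniq // iota_uniq.
have ar : all (supp a') r by exact: filter_all.
have b1 := bessel H (svd_onr sA') (Spsi m) u ar.
have b2 := bessel H (svd_onl sA') (Sphi m) u ar.
have n1 : nsq (psi m) = 1 by rewrite /hnsq (svd_onr sA).2 // eqxx.
have n2 : nsq (phi m) = 1 by rewrite /hnsq (svd_onl sA).2 // eqxx.
by rewrite n1 in b1; rewrite n2 in b2; lra.
Qed.

(** The difference is written as [-1 *: A1 f + A f] to agree with [lin_op (-1) A1 A], the form to
    which linearity of an extension applies. *)
Lemma svd_tail A A1 a phi psi N :
  hsvd A a phi psi -> hsvd A1 (fun n => if (n < N)%N then a n else 0) phi psi ->
  hsvd (fun f => -1 *: A1 f + A f) (fun n => if (n < N)%N then 0 else a n) phi psi.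
Proof.
move=> sA sA1.
have sub : {subset supp (fun n => if (n < N)%N then 0 else a n) <= supp a}.
  by move=> n; rewrite /supp !inE /=; case: ifP => // _; rewrite eqxx.
have on v : orthonormal (supp a) v ->
    orthonormal (supp (fun n => if (n < N)%N then 0 else a n)) v.
  by move=> [Sv hv]; split=> // i j /sub Ji /sub Jj; exact: hv.
split.
- by move=> n; case: ifP => // _; exact: (svd_ge0 sA).
- exact: on (svd_onl sA).
- exact: on (svd_onr sA).
- by move=> f Sf; apply: (hilbert_lin H); [exact: (svd_in sA1) | exact: (svd_in sA)].
move=> f Sf; rewrite (_ : svd_sum _ _ _ _ = fun M =>
    -1 *: svd_sum (fun n => if (n < N)%N then a n else 0) phi psi f M +
    svd_sum a phi psi f M); last first.
  apply: funext => M; rewrite /svd_sum /lincomb scaler_sumr -big_split /=.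
  apply: eq_bigr => n _; rewrite scalerA -scalerDl; congr (_ *: _).
  by case: ifP => _; [rewrite mul0r mulN1r addrC subrr | rewrite mul0r mulr0 add0r].
have S1 := svd_in sA1 Sf; have S2 := svd_in sA Sf.
apply: (hcvgD H) => // [n|n|||].
- by apply: (hilbertZ H); exact: svd_sum_in sA1 _ _.
- exact: svd_sum_in sA _ _.
- exact: (hilbertZ H).
- by apply: (hcvgZ H) => // [n|]; [exact: svd_sum_in sA1 _ _ | exact: (svd_cvg sA1)].
- exact: (svd_cvg sA).
Qed.

(** An isometry preserves orthonormality, and the adjoint relation turns [ip (psi n) (U' f)] into
    [ip (U (psi n)) f]. The coefficients are unchanged, so bounds on them hold uniformly in time
    along the flow. *)
Lemma svd_conj A U U' a phi psi : hsvd A a phi psi -> hbounded U ->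
  (forall f g, S f -> S g -> ip (U f) (U g) = ip f g) ->
  (forall g, S g -> S (U' g)) ->
  (forall f g, S f -> S g -> ip (U f) g = ip f (U' g)) ->
  hsvd (fun f => U (A (U' f))) a (U \o phi) (U \o psi).
Proof.
move=> sA bU isoU U'in U'adj; have SU f : S f -> S (U f) by case: bU => h _ _; exact: h.
have [Sphi onl] := svd_onl sA; have [Spsi onr] := svd_onr sA.
have SA f := svd_in sA (f := f).
split.
- exact: (svd_ge0 sA).
- split=> [n|i j Ji Jj] /=; first exact: SU.
  by rewrite isoU // onl.
- split=> [n|i j Ji Jj] /=; first exact: SU.
  by rewrite isoU // onr.
- by move=> f Sf; apply: SU; apply: SA; exact: U'in.
move=> f Sf; have SU'f := U'in _ Sf.
have := hbounded_cvg bU (svd_sum_in sA (U' f)) (SA _ SU'f) (svd_cvg sA SU'f).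
have Sl (phi' : nat -> V) M : (forall n, S (phi' n)) -> S (svd_sum a phi' (U \o psi) f M).
  by move=> h; exact: (lincomb_in H).
apply: cvg0_le => M; rewrite ge0_hnorm /=.
have e : heq (U (svd_sum a phi psi (U' f) M)) (svd_sum a (U \o phi) (U \o psi) f M).
  have := hbounded_lincomb bU (fun n => (a n)%:C * ip (psi n) (U' f)) (index_iota 0 M) Sphi.
  congr heq; rewrite /svd_sum /lincomb; apply: eq_bigr => n _ /=.
  by rewrite U'adj.
rewrite (heqBr_hnorm H _ _ _ e) //.
- by apply: SU; apply: SA.
- by apply: SU; exact: (svd_sum_in sA).
- by apply: Sl => n; exact: SU.
Qed.

End Operators.

(** * Complex-valued L^1 and L^2 functions *)

Section ComplexLpTheory.
Context d (X : measurableType d) (R : realType) (m : {measure set X -> \bar R}).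
Local Notation C := R[i].
Local Notation L1 := (cLp m 1%:E).
Local Notation L2 := (cLp m 2%:E).
Implicit Types (f g h : X -> C) (c : C).

Lemma cmeasurableD f g : cmeasurable f -> cmeasurable g -> cmeasurable (fun x => f x + g x).
Proof.
move=> [f1 f2] [g1 g2]; split.
  by under eq_fun do rewrite ReDl; exact: measurable_funD.
by under eq_fun do rewrite ImDl; exact: measurable_funD.
Qed.

Lemma cmeasurableM f g : cmeasurable f -> cmeasurable g -> cmeasurable (fun x => f x * g x).
Proof.
move=> [f1 f2] [g1 g2]; split.
  by under eq_fun do rewrite ReM; apply: measurable_funB; exact: measurable_funM.
by under eq_fun do rewrite ImM; apply: measurable_funD; exact: measurable_funM.
Qed.

Lemma cmeasurable_cst c : cmeasurable (fun _ : X => c).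
Proof. by split; exact: measurable_cst. Qed.

Lemma cmeasurableB f g : cmeasurable f -> cmeasurable g -> cmeasurable (fun x => f x - g x).
Proof.
move=> mf mg; have := cmeasurableD mf (cmeasurableM (cmeasurable_cst (-1)) mg).
by under [X in cmeasurable X -> _]eq_fun do rewrite mulN1r.
Qed.

Lemma cmeasurable_conj f : cmeasurable f -> cmeasurable (fun x => (f x)^*).
Proof.
move=> [f1 f2]; split; first by under eq_fun do rewrite ReJ.
by under eq_fun do rewrite ImJ; exact: measurableT_comp.
Qed.

Lemma cmeasurable_sum (I : Type) (s : seq I) (F : I -> X -> C) :
  (forall i, cmeasurable (F i)) -> cmeasurable (fun x => \sum_(i <- s) F i x).
Proof.
move=> mF; elim: s => [|i s ih].
  by under eq_fun do rewrite big_nil; exact: cmeasurable_cst.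
by under eq_fun do rewrite big_cons; exact: cmeasurableD.
Qed.

Lemma cmeasurable_normc2 f : cmeasurable f ->
  measurable_fun setT (fun x => normc (f x) ^+ 2).
Proof.
move=> [f1 f2]; under eq_fun do rewrite normc_sqr.
by apply: measurable_funD; exact: measurable_funX.
Qed.

Lemma cmeasurable_normc f : cmeasurable f -> measurable_fun setT (fun x => normc (f x)).
Proof.
move=> mf; rewrite (_ : (fun x => _) = Num.sqrt \o (fun x => normc (f x) ^+ 2)).
  apply: measurableT_comp; last exact: cmeasurable_normc2.
  exact: continuous_measurable_fun (@sqrt_continuous R).
by apply: funext => x /=; rewrite sqrtr_sqr ger0_norm // ge0_normc.
Qed.

(** The squared [L^2] norm as an extended real, to which Tonelli and Fatou apply directly. *)
Definition sqint f : \bar R := (\int[m]_x (normc (f x) ^+ 2)%:E)%E.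
Definition absint f : \bar R := (\int[m]_x (normc (f x))%:E)%E.

Lemma ge0_sqint f : (0 <= sqint f)%E.
Proof. by apply: integral_ge0 => x _; rewrite lee_fin sqr_ge0. Qed.

Lemma ge0_absint f : (0 <= absint f)%E.
Proof. by apply: integral_ge0 => x _; rewrite lee_fin ge0_normc. Qed.

Lemma cLnorm2E f : cLnorm m 2%:E f = (sqint f `^ 2^-1)%E.
Proof.
rewrite /cLnorm unlock; congr (_ `^ _)%E; apply: eq_integral => x _.
by rewrite gee0_abs ?lee_fin ?ge0_normc // poweR_EFin powR_mulrn // ge0_normc.
Qed.

Lemma cLnorm1E f : cLnorm m 1%:E f = absint f.
Proof.
rewrite /cLnorm Lnorm1; apply: eq_integral => x _.
by rewrite gee0_abs // lee_fin ge0_normc.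
Qed.

Lemma L2P f : L2 f <-> cmeasurable f /\ (sqint f < +oo)%E.
Proof.
rewrite /cLp cLnorm2E; split=> -[mf h]; split => //; last exact: poweR_lty.
move: h; have := ge0_sqint f; case: (sqint f) => //= r.
- by move=> *; rewrite ltry.
- by rewrite invr_eq0 pnatr_eq0.
Qed.

Lemma L1P f : L1 f <-> cmeasurable f /\ (absint f < +oo)%E.
Proof. by rewrite /cLp cLnorm1E. Qed.

Lemma L1_integrable_Re f : L1 f -> m.-integrable setT (EFin \o (fun x => Re (f x))).
Proof.
move=> /L1P[mf fi]; have [f1 f2] := mf.
apply: (@le_integrable _ _ _ _ _ _ _ (EFin \o (fun x => normc (f x)))) => //.
- exact/measurable_EFinP.
- move=> x _ /=; rewrite lee_fin (ger0_norm (ge0_normc _)); exact: ler_normRe_normc.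
- apply/integrableP; split; first by apply/measurable_EFinP; exact: cmeasurable_normc.
  apply: le_lt_trans fi; rewrite le_eqVlt; apply/orP; left; apply/eqP.
  by apply: eq_integral => x _ /=; rewrite ger0_norm // ge0_normc.
Qed.

Lemma L1_integrable_Im f : L1 f -> m.-integrable setT (EFin \o (fun x => Im (f x))).
Proof.
move=> /L1P[mf fi]; have [f1 f2] := mf.
apply: (@le_integrable _ _ _ _ _ _ _ (EFin \o (fun x => normc (f x)))) => //.
- exact/measurable_EFinP.
- move=> x _ /=; rewrite lee_fin (ger0_norm (ge0_normc _)); exact: ler_normIm_normc.
- apply/integrableP; split; first by apply/measurable_EFinP; exact: cmeasurable_normc.
  apply: le_lt_trans fi; rewrite le_eqVlt; apply/orP; left; apply/eqP.
  by apply: eq_integral => x _ /=; rewrite ger0_norm // ge0_normc.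
Qed.

Lemma absintD f g : cmeasurable f -> cmeasurable g ->
  (absint (fun x => f x + g x)%R <= absint f + absint g)%E.
Proof.
move=> mf mg; rewrite -ge0_integralD //; try by [move=> x _; rewrite lee_fin ge0_normc |
  apply/measurable_EFinP; exact: cmeasurable_normc].
apply: ge0_le_integral => //.
- by move=> x _; rewrite lee_fin ge0_normc.
- by apply/measurable_EFinP/cmeasurable_normc; exact: cmeasurableD.
- by apply: emeasurable_funD; apply/measurable_EFinP; exact: cmeasurable_normc.
- by move=> x _; rewrite -EFinD lee_fin ler_normcD.
Qed.

Lemma absintZ c f : cmeasurable f ->
  absint (fun x => c * f x)%R = ((normc c)%:E * absint f)%E.
Proof.
move=> mf; rewrite /absint -ge0_integralZl ?lee_fin ?ge0_normc //.
- by apply: eq_integral => x _; rewrite normcMl EFinM.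
- by apply/measurable_EFinP; exact: cmeasurable_normc.
- by move=> x _; rewrite lee_fin ge0_normc.
Qed.

Lemma L1D f g : L1 f -> L1 g -> L1 (fun x => f x + g x).
Proof.
move=> /L1P[mf fi] /L1P[mg gi]; apply/L1P; split; first exact: cmeasurableD.
by apply: le_lt_trans (absintD mf mg) _; rewrite lte_add_pinfty.
Qed.

Lemma L1Z c f : L1 f -> L1 (fun x => c * f x).
Proof.
move=> /L1P[mf fi]; apply/L1P; split.
  by apply: cmeasurableM => //; exact: cmeasurable_cst.
by rewrite absintZ // lte_mul_pinfty // lee_fin ge0_normc.
Qed.

Lemma L1_0 : L1 (fun=> 0).
Proof.
apply/L1P; split; first exact: cmeasurable_cst.
by rewrite /absint; under eq_integral do rewrite Normc.normc0; rewrite integral0.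
Qed.

Lemma L1_sum (I : Type) (s : seq I) (F : I -> X -> C) :
  (forall i, L1 (F i)) -> L1 (fun x => \sum_(i <- s) F i x).
Proof.
move=> mF; elim: s => [|i s ih].
  by under eq_fun do rewrite big_nil; exact: L1_0.
by under eq_fun do rewrite big_cons; exact: L1D.
Qed.

Lemma cintegralD f g : L1 f -> L1 g ->
  cintegral m (fun x => f x + g x) = cintegral m f + cintegral m g.
Proof.
move=> Lf Lg; rewrite /cintegral; apply/eqP; rewrite eq_complex /=; apply/andP.
split; apply/eqP.
  rewrite -RintegralD //; try exact: L1_integrable_Re.
  by apply: eq_Rintegral => x _; rewrite ReDl.
rewrite -RintegralD //; try exact: L1_integrable_Im.
by apply: eq_Rintegral => x _; rewrite ImDl.
Qed.

Lemma cintegralZ c f : L1 f -> cintegral m (fun x => c * f x) = c * cintegral m f.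
Proof.
move=> Lf; have iR := L1_integrable_Re Lf; have iI := L1_integrable_Im Lf.
have iZ (k : R) (g : X -> R) : m.-integrable setT (EFin \o g) ->
    m.-integrable setT (EFin \o (fun x => k * g x)).
  by move=> h; rewrite (_ : EFin \o _ = fun x => (k%:E * (EFin \o g) x)%E) //; exact: integrableZl.
rewrite /cintegral; apply/eqP; rewrite eq_complex ReM ImM /=; apply/andP.
split; apply/eqP; rewrite -!RintegralZl //.
  rewrite -RintegralB //; [|exact: iZ|exact: iZ].
  by apply: eq_Rintegral => x _; rewrite ReM.
rewrite -RintegralD //; [|exact: iZ|exact: iZ].
by apply: eq_Rintegral => x _; rewrite ImM.
Qed.

Lemma cintegral0 : cintegral m (fun=> 0) = 0.
Proof. by rewrite -[0 in LHS](mul0r 0) cintegralZ ?mul0r //; exact: L1_0. Qed.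

Lemma cintegral_sum (I : Type) (s : seq I) (F : I -> X -> C) :
  (forall i, L1 (F i)) ->
  cintegral m (fun x => \sum_(i <- s) F i x) = \sum_(i <- s) cintegral m (F i).
Proof.
move=> LF; elim: s => [|i s ih].
  by rewrite big_nil; under eq_fun do rewrite big_nil; rewrite cintegral0.
rewrite big_cons -ih; under eq_fun do rewrite big_cons.
by rewrite cintegralD //; exact: L1_sum.
Qed.

Lemma sqintZ c f : cmeasurable f ->
  sqint (fun x => c * f x)%R = ((normc c ^+ 2)%:E * sqint f)%E.
Proof.
move=> mf; rewrite /sqint -ge0_integralZl ?lee_fin ?sqr_ge0 //.
- by apply: eq_integral => x _; rewrite normcMl exprMn EFinM.
- by apply/measurable_EFinP; exact: cmeasurable_normc2.
- by move=> x _; rewrite lee_fin sqr_ge0.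
Qed.

Lemma sqr_normcD_le (z w : C) : normc (z + w) ^+ 2 <= 2 * normc z ^+ 2 + 2 * normc w ^+ 2.
Proof.
rewrite !normc_sqr ReDl ImDl; set a := Re z; set b := Re w; set p := Im z; set q := Im w.
have := sqr_ge0 (a - b); have := sqr_ge0 (p - q); rewrite !sqrrB !sqrrD; lra.
Qed.

Lemma L2D f g : L2 f -> L2 g -> L2 (fun x => f x + g x).
Proof.
move=> /L2P[mf fi] /L2P[mg gi]; apply/L2P; split; first exact: cmeasurableD.
have mm h : cmeasurable h -> measurable_fun setT (fun x => (2 * normc (h x) ^+ 2)%:E).
  by move=> mh; apply/measurable_EFinP/measurable_funM => //; exact: cmeasurable_normc2.
apply: (@le_lt_trans _ _ (\int[m]_x ((2 * normc (f x) ^+ 2)%:E + (2 * normc (g x) ^+ 2)%:E))%E).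
  apply: ge0_le_integral => //.
  - by move=> x _; rewrite lee_fin sqr_ge0.
  - by apply/measurable_EFinP/cmeasurable_normc2; exact: cmeasurableD.
  - by apply: emeasurable_funD; exact: mm.
  - by move=> x _; rewrite -EFinD lee_fin; exact: sqr_normcD_le.
rewrite ge0_integralD //; try by [exact: mm | move=> x _; rewrite lee_fin mulr_ge0 ?sqr_ge0].
under eq_integral do rewrite EFinM; under [X in (_ + X)%E]eq_integral do rewrite EFinM.
rewrite !ge0_integralZl //; try by [move=> x _; rewrite lee_fin sqr_ge0 |
  apply/measurable_EFinP; exact: cmeasurable_normc2].
by rewrite lte_add_pinfty // lte_mul_pinfty // lee_fin.
Qed.

Lemma L2Z c f : L2 f -> L2 (fun x => c * f x).
Proof.
move=> /L2P[mf fi]; apply/L2P; split.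
  by apply: cmeasurableM => //; exact: cmeasurable_cst.
by rewrite sqintZ // lte_mul_pinfty // lee_fin sqr_ge0.
Qed.

Lemma L2_0 : L2 (fun=> 0).
Proof.
apply/L2P; split; first exact: cmeasurable_cst.
rewrite /sqint; under eq_integral do rewrite Normc.normc0 expr0n.
by rewrite integral0.
Qed.

Lemma L1M f g : L2 f -> L2 g -> L1 (fun x => (f x)^* * g x).
Proof.
move=> /L2P[mf fi] /L2P[mg gi]; apply/L1P; split.
  by apply: cmeasurableM => //; exact: cmeasurable_conj.
have mm h : cmeasurable h -> measurable_fun setT (fun x => (normc (h x) ^+ 2)%:E).
  by move=> mh; apply/measurable_EFinP; exact: cmeasurable_normc2.
apply: (@le_lt_trans _ _ (\int[m]_x ((normc (f x) ^+ 2)%:E + (normc (g x) ^+ 2)%:E))%E).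
  apply: ge0_le_integral => //.
  - by move=> x _; rewrite lee_fin ge0_normc.
  - apply/measurable_EFinP/cmeasurable_normc.
    by apply: cmeasurableM => //; exact: cmeasurable_conj.
  - by apply: emeasurable_funD; exact: mm.
  - move=> x _; rewrite -EFinD lee_fin normcMl normc_conj.
    have := sqr_ge0 (normc (f x) - normc (g x)); rewrite sqrrB.
    have := ge0_normc (f x); have := ge0_normc (g x); nra.
rewrite ge0_integralD //; try by [exact: mm | move=> x _; rewrite lee_fin sqr_ge0].
by rewrite lte_add_pinfty.
Qed.

Definition cinner f g : C := cintegral m (fun x => (f x)^* * g x).

Lemma cinner_nsq f : L2 f -> (complex.Re (cinner f f))%:E = sqint f.
Proof.
move=> Lf; rewrite /cinner /cintegral /=; have /L1_integrable_Re h := L1M Lf Lf.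
rewrite /Rintegral fineK; last exact: integrable_fin_num.
by apply: eq_integral => x _; rewrite normcJM.
Qed.

End ComplexLpTheory.

Arguments sqint {d X R} m f%_ring_scope.
Arguments absint {d X R} m f%_ring_scope.

Lemma measurable_fun_limn_einf d (X : measurableType d) (R : realType)
    (h : nat -> X -> \bar R) : (forall n, measurable_fun setT (h n)) ->
  measurable_fun setT (fun x => limn_einf (h^~ x)).
Proof.
move=> mh; apply: (emeasurable_fun_cvg (fun n x => einfs (h^~ x) n)).
  exact: measurable_fun_einfs.
by move=> x _; rewrite limn_einf_lim; exact: is_cvg_einfs.
Qed.

(** * Square integrable functions as a Hilbert space *)

Section L2Hilbert.
Context d (X : measurableType d) (R : realType) (m : {measure set X -> \bar R}).
Local Notation C := R[i].
Local Notation V := (X -> R[i]^o).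
Local Notation L2 := (cLp m 2%:E : V -> Prop).
Local Notation ip := (cinner m : V -> V -> C).
Local Notation sqint := (sqint m).
Implicit Types (f g h : V) (c : C).

Lemma L2_lin c f g : L2 f -> L2 g -> L2 (c *: f + g).
Proof. by move=> Lf Lg; exact: (L2D (L2Z c Lf) Lg). Qed.

Lemma L2B f g : L2 f -> L2 g -> L2 (f - g).
Proof. by move=> Lf Lg; rewrite -[- g]scaleN1r addrC; exact: L2_lin. Qed.

Lemma geometric_increments_cvg (u : nat -> R) (M : R) :
  (forall n, `|u n.+1 - u n| <= M * 2^-1 ^+ n) -> cvgn u.
Proof.
move=> h; have M0 : 0 <= M by have := h 0%N; rewrite expr0 mulr1; exact: le_trans.
have cs : cvgn (series (fun n => u n.+1 - u n)).
  apply: normed_cvg; apply: (@series_le_cvg _ _ (geometric M 2^-1)) => //.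
  - by move=> n; rewrite /= normr_ge0.
  - by move=> n; rewrite /geometric /= mulr_ge0 // exprn_ge0.
  - by apply: is_cvg_geometric_series; rewrite ger0_norm // invf_lt1 // ltr1n.
have -> : u = (fun n => u 0%N + series (fun n => u n.+1 - u n) n).
  apply: funext => n; rewrite /series /=; elim: n => [|n ih].
    by rewrite big_geq // addr0.
  by rewrite big_nat_recr //= addrA -ih addrC subrK.
by apply: is_cvgD => //; exact: is_cvg_cst.
Qed.

Section Completeness.
Variable v : nat -> V.
Hypothesis Lv : forall j, L2 (v j).
Hypothesis fast : forall j, (sqint (v j.+1 - v j) <= (16^-1 ^+ j)%:E)%E.

(** The weight [4 ^+ j] lies between two needs. Against squared distances [16^-j] it leaves the
    integrable total [G], of integral at most the sum of the [4^-j]; and where [G] is finite it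
    forces increments of size [sqrt G * 2^-j], hence pointwise convergence. *)
Let delta j x : R := 4 ^+ j * normc (v j.+1 x - v j x) ^+ 2.
Let G x : \bar R := (\sum_(0 <= j <oo) (delta j x)%:E)%E.
Let E : set X := [set x | (G x < +oo)%E].

Let delta_ge0 j x : 0 <= delta j x.
Proof. by rewrite mulr_ge0 ?sqr_ge0 ?exprn_ge0. Qed.

Let mv j : cmeasurable (v j). Proof. by case: (Lv j). Qed.

Let mdelta j : measurable_fun setT (delta j).
Proof.
apply: measurable_funM => //; apply: cmeasurable_normc2.
by have [] := L2B (Lv j.+1) (Lv j).
Qed.

Let mG : measurable_fun setT G.
Proof.
apply: (@ge0_emeasurable_sum _ _ _ _ (fun j x => (delta j x)%:E) xpredT).
- by move=> k x _ _; rewrite lee_fin.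
- by move=> k _; apply/measurable_EFinP; exact: mdelta.
Qed.

Let mE : measurable E.
Proof. by rewrite -[E]setTI; apply: emeasurable_fun_infty_o. Qed.

Let intG : (\int[m]_x G x < +oo)%E.
Proof.
rewrite integral_nneseries //; last 2 first.
- by move=> n; apply/measurable_EFinP; exact: mdelta.
- by move=> n x _; rewrite lee_fin.
apply: (@le_lt_trans _ _ (\sum_(0 <= j <oo) (4^-1 ^+ j)%:E)%E).
  apply: lee_nneseries => [j _ _|j _]; first by apply: integral_ge0 => x _; rewrite lee_fin.
  have -> : (\int[m]_x (delta j x)%:E = (4 ^+ j)%:E * sqint (v j.+1 - v j))%E.
    rewrite -ge0_integralZl ?lee_fin ?exprn_ge0 //.
    - by apply/measurable_EFinP/cmeasurable_normc2; have [] := L2B (Lv j.+1) (Lv j).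
    - by move=> x _; rewrite lee_fin sqr_ge0.
  apply: le_trans (_ : ((4 ^+ j)%:E * (16^-1 ^+ j)%:E <= _)%E).
    by rewrite lee_wpmul2l // lee_fin exprn_ge0.
  rewrite -EFinM lee_fin -exprMn (_ : 4 * 16^-1 = 4^-1) //.
  by field.
have : cvgn (series (geometric (1 : R) 4^-1)).
  by apply: is_cvg_geometric_series; rewrite ger0_norm // invf_lt1 // ltr1n.
move=> cs; rewrite (_ : (fun n => _) = EFin \o series (geometric (1 : R) 4^-1)).
  by rewrite EFin_lim // ltry.
apply: funext => n; rewrite /series /= -sumEFin; apply: eq_bigr => i _.
by rewrite /geometric /= mul1r.
Qed.

Let aeE : {ae m, forall x, E x}.
Proof.
have iG : m.-integrable setT G.
  apply/integrableP; split; first exact: mG.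
  rewrite (eq_integral G) // => x _; rewrite gee0_abs //.
  by apply: nneseries_ge0 => j _ _; rewrite lee_fin.
have := integrable_ae measurableT iG; apply: filterS => x /(_ Logic.I).
by rewrite fin_numElt => /andP[].
Qed.

Let incr x : E x -> exists M : R, forall j, normc (v j.+1 x - v j x) <= M * 2^-1 ^+ j.
Proof.
move=> Ex; have G0 : (0 <= G x)%E by apply: nneseries_ge0 => j _ _; rewrite lee_fin.
have Gf : (fine (G x))%:E = G x by rewrite fineK // ge0_fin_numE.
exists (Num.sqrt (fine (G x))) => j.
have : ((delta j x)%:E <= G x)%E.
  apply: le_trans (_ : (\sum_(0 <= i < j.+1) (delta i x)%:E <= _)%E).
    rewrite big_nat_recr //= leeDr //; apply: sume_ge0 => i _; by rewrite lee_fin.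
  by apply: nneseries_lim_ge => i _ _; rewrite lee_fin.
rewrite -Gf lee_fin /delta => h.
rewrite -ler_sqr ?nnegrE ?ge0_normc ?mulr_ge0 ?sqrtr_ge0 ?exprn_ge0 //.
rewrite exprMn sqr_sqrtr; last by rewrite -lee_fin Gf.
rewrite -exprM mulnC exprM (_ : 2^-1 ^+ 2 = 4^-1); last by rewrite exprVn -natrX.
by rewrite exprVn ler_pdivlMr ?exprn_gt0 // mulrC.
Qed.

(** Cutting off to the set [E] of convergence makes the limit exist at every point, so that it is
    measurable. *)
Let w (j : nat) (x : X) : C := (\1_E x)%:C * v j x.

Let w_cvg_Re x : cvgn (fun j => Re (w j x)).
Proof.
rewrite /w indicE; have [/set_mem/incr[M hM]|_] := boolP (x \in E); last first.
  by under eq_fun do rewrite mul0r; exact: is_cvg_cst.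
apply: (@geometric_increments_cvg _ M) => n; rewrite !mul1r -ReNl -ReDl.
exact: le_trans (ler_normRe_normc _) (hM n).
Qed.

Let w_cvg_Im x : cvgn (fun j => Im (w j x)).
Proof.
rewrite /w indicE; have [/set_mem/incr[M hM]|_] := boolP (x \in E); last first.
  by under eq_fun do rewrite mul0r; exact: is_cvg_cst.
apply: (@geometric_increments_cvg _ M) => n; rewrite !mul1r -ImNl -ImDl.
exact: le_trans (ler_normIm_normc _) (hM n).
Qed.

Let lim_w : V := fun x => Complex (limn (fun j => Re (w j x))) (limn (fun j => Im (w j x))).

Let mw j : cmeasurable (w j).
Proof.
have mi : measurable_fun setT (fun x : X => \1_E x : R) by exact: measurable_indic.
have [m1 m2] := mv j; split; rewrite /w.
  by under eq_fun do rewrite ReMC; exact: measurable_funM.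
by under eq_fun do rewrite ImMC; exact: measurable_funM.
Qed.

Let mlim : cmeasurable lim_w.
Proof.
split.
- apply: (@measurable_fun_cvg _ _ _ _ (fun j x => Re (w j x))).
    by move=> j; have [] := mw j.
  by move=> x _; exact: w_cvg_Re.
- apply: (@measurable_fun_cvg _ _ _ _ (fun j x => Im (w j x))).
    by move=> j; have [] := mw j.
  by move=> x _; exact: w_cvg_Im.
Qed.

Let lim_normc x g : E x ->
  (fun j => (normc (v j x - g x) ^+ 2)%:E) @ \oo --> (normc (lim_w x - g x) ^+ 2)%:E.
Proof.
move=> Ex; apply: cvg_EFin; first exact: nearW.
have wv j : w j x = v j x by rewrite /w indicE mem_set // mul1r.
have cR := @w_cvg_Re x; have cI := @w_cvg_Im x.
rewrite /comp /= normc_sqr ReDl ImDl ReNl ImNl /lim_w /=.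
under eq_fun do rewrite normc_sqr ReDl ImDl ReNl ImNl -wv.
by apply: cvgD; under eq_fun do rewrite expr2; rewrite expr2; apply: cvgM;
  apply: cvgB => //; exact: cvg_cst.
Qed.

(** Fatou for [|v j - g|^2]; a bound for arbitrarily large [j] is enough for a lower limit. With [g]
    a term of the original Cauchy sequence this yields both the square integrability of [f] and
    convergence along the whole sequence. *)
Lemma L2_limit : exists2 f, cmeasurable f & forall g (l : \bar R), L2 g ->
  (forall N, exists2 j, (N <= j)%N & (sqint (v j - g) <= l)%E) ->
  (sqint (f - g) <= l)%E.
Proof.
exists lim_w => // g l Lg hl.
have mvg j : measurable_fun setT (fun x => (normc (v j x - g x) ^+ 2)%:E).
  by apply/measurable_EFinP/cmeasurable_normc2; have [] := L2B (Lv j) Lg.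
have mlg : measurable_fun setT (fun x => (normc (lim_w x - g x) ^+ 2)%:E).
  apply/measurable_EFinP/cmeasurable_normc2.
  by have [mg _] := Lg; exact: cmeasurableB.
apply: (@le_trans _ _ (\int[m]_x limn_einf (fun j => (normc (v j x - g x) ^+ 2)%:E))%E).
  apply: ae_ge0_le_integral => //.
  - by move=> x _; rewrite lee_fin sqr_ge0.
  - move=> x _; rewrite limn_einf_lim; apply: lime_ge; first exact: is_cvg_einfs.
    by apply: nearW => n; apply: le_ereal_inf_tmp => _ [k _ <-]; rewrite lee_fin sqr_ge0.
  - exact: measurable_fun_limn_einf mvg.
  - apply: filterS aeE => x Ex _; have [-> _] := cvg_limn_einf_sup (@lim_normc x g Ex).
    by [].
apply: le_trans (fatou m measurableT mvg _) _.
  by move=> n x _; rewrite lee_fin sqr_ge0.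
rewrite limn_einf_lim; apply: lime_le; first exact: is_cvg_einfs.
apply: nearW => N; have [j Nj hj] := hl N.
by apply: ereal_inf_le; exists (sqint (v j - g)) => //; exists j.
Qed.

End Completeness.

Lemma cinner_linr c f g h : L2 f -> L2 g -> L2 h ->
  ip h (c *: f + g) = c * ip h f + ip h g.
Proof.
move=> Lf Lg Lh; rewrite /cinner -cintegralZ; last exact: L1M.
rewrite -cintegralD; [|by apply: L1Z; exact: L1M|exact: L1M].
congr cintegral; apply: funext => x /=.
by rewrite mulrDr mulrCA.
Qed.

(** This holds for every [F], integrable or not: the integral of the imaginary part is split into
    positive and negative parts, and [fine] sends infinite values to 0 on both sides. *)
Lemma cintegral_conjE (F : X -> C) : cintegral m (fun x => (F x)^*) = (cintegral m F)^*.
Proof.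
rewrite /cintegral; apply/eqP; rewrite eq_complex ReJ ImJ /=; apply/andP.
split; apply/eqP; first by apply: eq_Rintegral => x _; rewrite ReJ.
rewrite /Rintegral.
under eq_integral do rewrite ImJ EFinN.
rewrite integralE [in RHS]integralE funeposN funenegN.
set p := (\int[m]_x _)%E; set q := (\int[m]_x _)%E.
have p0 : (0 <= p)%E by apply: integral_ge0.
have q0 : (0 <= q)%E by apply: integral_ge0.
by move: p q p0 q0 => [p| |] [q| |] //= _ _; rewrite ?oppr0 // opprB.
Qed.

Lemma cinner_conj f g : ip g f = (ip f g)^*.
Proof.
rewrite /cinner -cintegral_conjE; congr cintegral; apply: funext => x.
by rewrite conjcM conjCK mulrC.
Qed.

Lemma L2_complete (u : nat -> V) : (forall n, L2 (u n)) ->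
  (forall e : R, 0 < e -> exists N, forall i n, (N <= i)%N -> (N <= n)%N ->
     Re (ip (u i - u n) (u i - u n)) < e) ->
  exists2 f, L2 f & (fun n => Re (ip (f - u n) (f - u n))) @ \oo --> (0 : R).
Proof.
move=> Lu cau.
have Luu i n : L2 (u i - u n) by exact: L2B.
have e_gt0 j : 0 < 16^-1 ^+ j :> R by rewrite exprn_gt0.
have [N hN] := choice (fun j => cau _ (e_gt0 j)).
(* A nondecreasing choice of indices that dominates both [j] and [N j]. *)
pose k j := (j + \sum_(i < j.+1) N i)%N.
have kN j : (N j <= k j)%N.
  by rewrite /k big_ord_recr /= addnA leq_addl.
have kS j : (k j <= k j.+1)%N.
  by apply: leq_add => //; rewrite [leqRHS]big_ord_recr leq_addr.
have fast j : (sqint (u (k j.+1) - u (k j)) <= (16^-1 ^+ j)%:E)%E.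
  rewrite -cinner_nsq // lee_fin ltW // hN //.
  exact: leq_trans (kN j) (kS j).
have [f mf hf] := L2_limit (fun j => Lu (k j)) fast.
have lim_le (e : R) : 0 < e -> exists n0, forall n, (n0 <= n)%N -> (sqint (f - u n) <= e%:E)%E.
  move=> e0; have [n0 hn0] := cau _ e0; exists n0 => n n0n.
  apply: hf => // M; exists (maxn M n0); first exact: leq_maxl.
  rewrite -cinner_nsq // lee_fin ltW // hn0 //.
  by rewrite (leq_trans (leq_maxr M n0)) // /k leq_addr.
have Lfu n : L2 (f - u n).
  have [n0 h0] := lim_le 1 ltr01.
  have Ln0 : L2 (f - u n0).
    apply/L2P; split; last by apply: le_lt_trans (h0 _ (leqnn _)) _; rewrite ltry.
    by have [mu _] := Lu n0; exact: cmeasurableB.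
  have -> : f - u n = 1 *: (f - u n0) + (u n0 - u n) by rewrite scale1r addrA subrK.
  exact: L2_lin.
exists f.
  have -> : f = 1 *: (f - u 0%N) + u 0%N by rewrite scale1r subrK.
  exact: L2_lin.
apply/cvgrPdist_le => e e0; have [n0 h0] := lim_le e e0.
exists n0 => // n /= n0n; rewrite sub0r normrN.
have := h0 n n0n; rewrite -cinner_nsq // lee_fin; apply: le_trans.
by rewrite ger0_norm // -lee_fin cinner_nsq // ge0_sqint.
Qed.

Lemma hilbert_L2 : hilbert L2 ip.
Proof.
split.
- exact: L2_0.
- exact: L2_lin.
- exact: cinner_linr.
- exact: cinner_conj.
- move=> f Lf; rewrite lecE.
  have -> : Im (ip f f) = 0.
    rewrite /cinner /cintegral /= /Rintegral; under eq_integral do rewrite normcJM /=.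
    by rewrite integral0.
  by rewrite eqxx -lee_fin cinner_nsq // ge0_sqint.
- exact: L2_complete.
Qed.

Local Notation hnorm := (hilbert_norm ip).

Lemma cLnorm2_hnorm f : L2 f -> cLnorm m 2%:E f = (hnorm f)%:E.
Proof.
move=> Lf; rewrite cLnorm2E -cinner_nsq // /hilbert_norm /hnsq poweR_EFin.
by rewrite powR12_sqrt // -lee_fin cinner_nsq // ge0_sqint.
Qed.

Lemma hnorm0_ae f g : L2 f -> L2 g -> hnorm (f - g) = 0 <-> ceq_ae m f g.
Proof.
move=> Lf Lg; have Lfg := L2B Lf Lg; have H := hilbert_L2.
have mfg : measurable_fun setT (fun x => (normc (f x - g x) ^+ 2)%:E).
  by apply/measurable_EFinP/cmeasurable_normc2; have [] := Lfg.
have e1 : sqint (f - g) = (\int[m]_x `|(normc (f x - g x) ^+ 2)%:E|)%E.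
  by apply: eq_integral => x _; rewrite gee0_abs // lee_fin sqr_ge0.
split=> [h|fg].
  have s0 : sqint (f - g) = 0%E.
    by rewrite -cinner_nsq // -/(hnsq _ _) -(hnorm_sqr H) // h expr0n.
  have /ae_eq_integral_abs := etrans (esym e1) s0.
  move=> /(_ measurableT mfg); apply: filterS => x /(_ Logic.I) /=.
  move=> /eqP; rewrite eqe sqrf_eq0 normc_eq0 subr_eq0 => /eqP.
  by [].
have s0 : sqint (f - g) = 0%E.
  rewrite e1; apply/ae_eq_integral_abs => //; apply: filterS fg => x -> _ /=.
  by rewrite subrr Normc.normc0 expr0n.
by apply/eqP; rewrite sqrtr_eq0 -lee_fin cinner_nsq // s0.
Qed.

Lemma cvgLp_hcvg (u : nat -> V) f : (forall n, L2 (u n)) ->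
  cvgLp m 2%:E u f <-> L2 f /\ hilbert_cvg ip u f.
Proof.
move=> Lu; split=> -[Lf h]; split => //.
  have {}h : (fun n => (hnorm (f - u n))%:E) @ \oo --> 0%E.
    rewrite (_ : (fun n => _) = fun n => cLnorm m 2%:E (fun x => f x - u n x)) //.
    by apply: funext => n; rewrite -cLnorm2_hnorm //; exact: L2B.
  by move/fine_cvg: h.
have : (fun n => (hnorm (f - u n))%:E) @ \oo --> 0%E.
  by apply: cvg_EFin => //; exact: nearW.
rewrite (_ : (fun n => _) = fun n => cLnorm m 2%:E (fun x => f x - u n x)) //.
by apply: funext => n; rewrite -cLnorm2_hnorm //; exact: L2B.
Qed.

End L2Hilbert.

(** * Completeness of the Fourier basis *)

Section ExponentialFunctions.
Context (R : realType).
Local Notation C := R[i].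
Implicit Types (x y : R) (k : int).

Lemma expiD x y : expi (x + y) = expi x * expi y.
Proof.
apply/eqP; rewrite eq_complex ReM ImM /= cosD sinD.
by apply/andP; split => //; rewrite addrC.
Qed.

Lemma expi0 : expi (0 : R) = 1.
Proof. by rewrite /expi cos0 sin0. Qed.

Lemma expi_conj x : (expi x)^* = expi (- x).
Proof. by rewrite conjcE /expi cosN sinN. Qed.

Lemma normc_expi x : normc (expi x) = 1.
Proof. by rewrite /= cos2Dsin2 sqrtr1. Qed.

Lemma expi_conjM x : (expi x)^* * expi x = 1.
Proof. by rewrite normcJM normc_expi expr1n. Qed.

Lemma expi_natmul x (n : nat) : expi (n%:R * x) = expi x ^+ n.
Proof.
elim: n => [|n ih]; first by rewrite mul0r expi0 expr0.
by rewrite -addn1 natrD mulrDl mul1r expiD ih addn1 exprSr.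
Qed.

Lemma expi_2pi_int k : expi (k%:~R * (2 * pi : R)) = 1.
Proof.
have e2 : expi (2 * pi : R) = 1 by rewrite /expi mulr_natl cos2pi sin2pi.
case: k => n; first by rewrite expi_natmul e2 expr1n.
by rewrite NegzE mulrNz mulNr -expi_conj expi_natmul e2 expr1n rmorph1.
Qed.

Lemma continuous_expi_Re (k : R) : continuous (fun x => cos (k * x)).
Proof.
move=> x; apply: (@continuous_comp _ _ _ (fun x => k * x) cos).
  exact: mulrl_continuous.
exact: continuous_cos.
Qed.

Lemma continuous_expi_Im (k : R) : continuous (fun x => sin (k * x)).
Proof.
move=> x; apply: (@continuous_comp _ _ _ (fun x => k * x) sin).
  exact: mulrl_continuous.
exact: continuous_sin.
Qed.

Lemma cmeasurable_expi (k : R) :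
  cmeasurable ((fun x => expi (k * x)) : measurableTypeR R -> C).
Proof.
split; apply: continuous_measurable_fun.
  exact: continuous_expi_Re.
exact: continuous_expi_Im.
Qed.

Lemma integral_comp_scaled (g G : R -> R) (k a b : R) : k != 0 -> a < b ->
  continuous g -> (forall x, is_derive x 1 G (g x)) ->
  (\int[lebesgue_measure]_(x in `[a, b]) (g (k * x))%:E =
   ((G (k * b) - G (k * a)) / k)%:E)%E.
Proof.
move=> k0 ab cg dG; pose F : R -> R := k^-1 *: (G \o (k *: @id R)).
have dF x : is_derive x 1 F (g (k * x)).
  have dk : is_derive x 1 (k *: @id R : R -> R) k.
    by apply: is_derive_eq; rewrite /GRing.scale /= mulr1.
  have dGk : is_derive x 1 (G \o (k *: @id R)) (g (k * x) * k).
    exact: (@is_derive1_comp _ G (k *: @id R) x _ _ (dG (k * x)) dk).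
  by apply: is_derive_eq; rewrite /GRing.scale /= mulrC mulfK.
have cF : continuous F.
  by move=> x; apply: differentiable_continuous; apply/derivable1_diffP; case: (dF x).
rewrite (@continuous_FTC2 _ _ F) //.
- rewrite -EFinB (_ : F b - F a = k^-1 * G (k * b) - k^-1 * G (k * a)) //.
  by rewrite -mulrBr mulrC.
- apply: continuous_subspaceT => x.
  by apply: (@continuous_comp _ _ _ (fun x => k * x) g); [exact: mulrl_continuous|exact: cg].
- split; [by move=> x _; case: (dF x)| |].
  + by apply: cvg_at_right_filter; exact: cF.
  + by apply: cvg_at_left_filter; exact: cF.
- by move=> x _; rewrite derive1E; apply: derive_val.
Qed.

Lemma integral_expi_period (k : int) : k != 0 ->
  (\int[lebesgue_measure]_(x in `[0%R, (2 * pi)%R]) (cos (k%:~R * x))%:E = 0 :> \bar R)%E /\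
  (\int[lebesgue_measure]_(x in `[0%R, (2 * pi)%R]) (sin (k%:~R * x))%:E = 0 :> \bar R)%E.
Proof.
move=> k0; have k0' : k%:~R != 0 :> R by rewrite intr_eq0.
have pi0 : 0 < 2 * pi :> R by rewrite mulr_gt0 // pi_gt0.
have [e1 e2] : cos (k%:~R * (2 * pi) : R) = 1 /\ sin (k%:~R * (2 * pi) : R) = 0.
  by have := expi_2pi_int k; rewrite /expi => -[-> ->].
split.
  rewrite (@integral_comp_scaled cos sin) //; last exact: continuous_cos.
  by rewrite e2 mulr0 sin0 subrr mul0r.
have dc (x : R) : is_derive x 1 (- cos : R -> R) (sin x).
  by apply: is_derive_eq; rewrite opprK.
rewrite (integral_comp_scaled k0' pi0 (@continuous_sin R) dc).
by rewrite !fctE e1 mulr0 cos0 subrr mul0r.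
Qed.

End ExponentialFunctions.

Section TorusIntegral.
Context (R : realType).
Local Notation C := R[i].
Local Notation T := (measurableTypeR R).
Local Notation tm := (@torus_measure R).
Local Notation leb := (@lebesgue_measure R).

Lemma torus_compl0 : tm (~` @torus R) = 0%E.
Proof. by rewrite /torus_measure /= /mfrestr /mrestr setICl measure0. Qed.

Lemma ae_torus : {ae tm, forall x, @torus R x}.
Proof.
exists (~` @torus R); split => //; last exact: torus_compl0.
by apply: measurableC; exact: measurable_torus.
Qed.

Lemma ae_torus_lebesgue (P : T -> Prop) :
  {ae leb, forall x, @torus R x -> P x} -> {ae tm, forall x, P x}.
Proof.
move=> [N [mN N0 PN]]; have : {ae tm, forall x, @torus R x -> P x}.
  exists N; split => //=.
  rewrite /torus_measure /= /mfrestr /mrestr; apply: (subset_measure0 _ _ _ N0) => //.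
  by apply: measurableI => //; exact: measurable_torus.
by apply: filterS2 ae_torus => x tx; exact.
Qed.

Lemma torus_integralE (f : T -> \bar R) : measurable_fun setT f ->
  (\int[tm]_x f x = \int[leb]_(x in @torus R) f x)%E.
Proof.
move=> mf; have mT := @measurable_torus R.
transitivity (\int[tm]_(x in @torus R) f x)%E; last first.
  apply: eq_measure_integral => A mA AT.
  by rewrite /torus_measure /= /mfrestr /mrestr setIidl.
rewrite [RHS]integral_mkcond; apply: ae_eq_integral => //.
  by apply/(measurable_restrictT _ _).1 => //; exact: measurable_funS mf.
by apply: filterS ae_torus => x tx _; rewrite patchE mem_set.
Qed.

Lemma torus_measure_lty : (tm setT < +oo)%E.
Proof. by rewrite ltey_eq fin_num_measure. Qed.

Lemma torus_measureT : tm setT = (2 * pi)%:E.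
Proof.
rewrite /torus_measure /= /mfrestr /mrestr setTI /torus lebesgue_measure_itv /= lte_fin.
by rewrite mulr_gt0 ?pi_gt0 // oppr0 adde0.
Qed.

Lemma ae_torus_neq (a : R) : {ae tm, forall x : T, x != a}.
Proof.
apply: ae_torus_lebesgue; exists [set a]; split => //.
  exact: lebesgue_measure_set1.
by move=> x /= /not_implyP[_ /negP]; rewrite negbK => /eqP.
Qed.

Lemma torus_Rintegral_itv (f : R -> R) : continuous f ->
  (\int[tm]_x (f x)%:E = \int[leb]_(x in `[0%R, (2 * pi)%R]) (f x)%:E)%E.
Proof.
move=> cf; have mf : measurable_fun setT (fun x : T => (f x)%:E).
  by apply/measurable_EFinP; exact: continuous_measurable_fun.
rewrite torus_integralE // /torus integral_itv_bndo_bndc //.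
exact: measurable_funS mf.
Qed.

Lemma cintegral_expi_torus (k : int) :
  cintegral tm (fun x => expi (k%:~R * x)) = if k == 0 then (2 * pi)%:C else 0.
Proof.
have [->|k0] := eqVneq k 0.
  under eq_fun do rewrite mul0r expi0.
  rewrite /cintegral /= !Rintegral_cst // mul0r mul1r.
  by rewrite -[(2 * pi)%:C]/(Complex (fine (2 * pi)%:E) 0) -torus_measureT.
have [e1 e2] := integral_expi_period R k0.
rewrite /cintegral /Rintegral /=; rewrite !torus_Rintegral_itv ?e1 ?e2 //.
  exact: continuous_expi_Im.
exact: continuous_expi_Re.
Qed.

End TorusIntegral.

(** * Trigonometric polynomials that approximate indicators *)

Section TrigonometricPolynomials.
Context (R : realType).
Local Notation C := R[i].
Implicit Types (p q : R -> R) (x y : R).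

Definition trig_poly p := exists s : seq (C * int),
  forall x, (p x)%:C = \sum_(e <- s) e.1 * expi (e.2%:~R * x).

Lemma trig_poly_cst (c : R) : trig_poly (fun=> c).
Proof.
by exists [:: (c%:C, 0%R)] => x; rewrite big_seq1 /= mul0r expi0 mulr1.
Qed.

Lemma trig_polyD p q : trig_poly p -> trig_poly q -> trig_poly (fun x => p x + q x).
Proof.
by move=> [s ps] [t qt]; exists (s ++ t) => x; rewrite big_cat /= realcD ps qt.
Qed.

Lemma trig_polyM p q : trig_poly p -> trig_poly q -> trig_poly (fun x => p x * q x).
Proof.
move=> [s ps] [t qt].
exists [seq (z.1.1 * z.2.1, z.1.2 + z.2.2) | z <- [seq (e, e') | e <- s, e' <- t]] => x.
rewrite realcM ps qt big_map big_allpairs /= mulr_suml; apply: eq_bigr => e _.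
rewrite mulr_sumr; apply: eq_bigr => e' _.
by rewrite intrD mulrDl expiD; ring.
Qed.

Lemma trig_polyX p n : trig_poly p -> trig_poly (fun x => p x ^+ n).
Proof.
move=> tp; elim: n => [|n ih].
  by under [X in trig_poly X]eq_fun do rewrite expr0; exact: trig_poly_cst.
by under [X in trig_poly X]eq_fun do rewrite exprS; exact: trig_polyM.
Qed.

Lemma trig_poly_cos : trig_poly cos.
Proof.
exists [:: ((2^-1)%:C, 1%R); ((2^-1)%:C, -1)] => x.
rewrite !big_cons big_nil /= mul1r mulN1r addr0.
apply/eqP; rewrite eq_complex !ReDl !ImDl !ReMC !ImMC /= cosN sinN.
by apply/andP; split; apply/eqP; lra.
Qed.

Lemma trig_poly_sin : trig_poly sin.
Proof.
exists [:: (Complex 0 (- 2^-1), 1%R); (Complex 0 2^-1, -1)] => x.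
rewrite !big_cons big_nil /= mul1r mulN1r addr0.
apply/eqP; rewrite eq_complex !ReDl !ImDl !ReM !ImM /= cosN sinN.
by apply/andP; split; apply/eqP; lra.
Qed.

Lemma bernoulli (x : R) n : -1 <= x -> 1 + n%:R * x <= (1 + x) ^+ n.
Proof.
move=> x1; elim: n => [|n ih]; first by rewrite mul0r addr0 expr0.
rewrite exprSr; apply: le_trans (_ : (1 + n%:R * x) * (1 + x) <= _); last first.
  by rewrite ler_wpM2r //; lra.
rewrite -natr1; have : 0 <= n%:R * x ^+ 2 by rewrite mulr_ge0 ?sqr_ge0.
by rewrite expr2; lra.
Qed.

(* The polynomials [(1 - v^n)^(2^n)] tend on [0, 1] to the indicator of [v < 1/2],
   except at [v = 1/2]. *)
Definition step (n : nat) (v : R) : R := (1 - v ^+ n) ^+ (2 ^ n).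

Lemma step_bound n v : 0 <= v <= 1 -> 0 <= step n v <= 1.
Proof.
move=> /andP[v0 v1]; have vn0 : 0 <= v ^+ n by rewrite exprn_ge0.
have vn1 : v ^+ n <= 1 by rewrite exprn_ile1.
by rewrite /step exprn_ge0 ?exprn_ile1 //; lra.
Qed.

(** Bernoulli at [- v^n] with exponent [2^n] bounds [step n v] below by [1 - (2 v)^n]. *)
Lemma step_cvg1 v : 0 <= v < 2^-1 -> (fun n => step n v) @ \oo --> (1 : R).
Proof.
move=> /andP[v0 v1].
apply: (@squeeze_cvgr _ _ _ _ (fun n => 1 - (2 * v) ^+ n) (fun=> 1)).
- apply: nearW => n; have /andP[_ ->] : 0 <= step n v <= 1 by apply: step_bound; lra.
  rewrite andbT /step; have vn0 : 0 <= v ^+ n by rewrite exprn_ge0.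
  have vn1 : v ^+ n <= 1 by rewrite exprn_ile1 //; lra.
  have := @bernoulli (- v ^+ n) (2 ^ n); rewrite mulrN natrX exprMn; apply; lra.
- rewrite -[X in _ --> X]subr0; apply: cvgB; first exact: cvg_cst.
  by apply: cvg_expr; rewrite ger0_norm; lra.
- exact: cvg_cst.
Qed.

(** With [y = v^n], the product of [(1 - y)^(2^n)] and [(1 + y)^(2^n)] is at most 1, and by
    Bernoulli the second factor is at least [(2 v)^n]. *)
Lemma step_cvg0 v : 2^-1 < v <= 1 -> (fun n => step n v) @ \oo --> (0 : R).
Proof.
move=> /andP[v0 v1]; have v0' : 0 < v by lra.
apply: (@cvg0_le _ _ (fun n => (2 * v)^-1 ^+ n)); last first.
  by apply: cvg_expr; rewrite ger0_norm ?invr_ge0 ?invf_lt1; lra.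
move=> n; have /andP[-> _] : 0 <= step n v <= 1 by apply: step_bound; lra.
have vn0 : 0 < v ^+ n by rewrite exprn_gt0.
have vn1 : v ^+ n <= 1 by rewrite exprn_ile1 //; lra.
have vv : 0 < (2 * v) ^+ n by rewrite exprn_gt0; lra.
rewrite exprVn -[leRHS]mul1r ler_pdivlMr //.
have b : (2 * v) ^+ n <= (1 + v ^+ n) ^+ (2 ^ n).
  have := @bernoulli (v ^+ n) (2 ^ n); rewrite natrX exprMn => h.
  by apply: le_trans (h _); lra.
apply: le_trans (_ : step n v * (1 + v ^+ n) ^+ (2 ^ n) <= _).
  by rewrite ler_wpM2l // /step exprn_ge0 //; lra.
rewrite /step -exprMn exprn_ile1 //; first by rewrite mulr_ge0; lra.
by have := sqr_ge0 (v ^+ n); rewrite expr2; lra.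
Qed.

(** The affine map sends [[-1, 1]] to [[0, 1]] and [w x > 0] to values below 1/2, so these functions
    tend to the indicator of [0 < w x] and are trigonometric polynomials whenever [w] is one. *)
Definition half_step n (w : R -> R) x := step n ((1 - w x) / 2).

Lemma half_step_bound n w x : -1 <= w x <= 1 -> 0 <= half_step n w x <= 1.
Proof. by move=> h; apply: step_bound; lra. Qed.

Lemma half_step_cvg w x : -1 <= w x <= 1 -> w x != 0 ->
  (fun n => half_step n w x) @ \oo --> ((0 < w x)%R%:R : R).
Proof.
move=> h; rewrite neq_lt => /orP[w0|w0].
  by rewrite ltNge ltW //=; apply: step_cvg0; lra.
by rewrite w0; apply: step_cvg1; lra.
Qed.

Lemma trig_poly_half_step n w : trig_poly w -> trig_poly (half_step n w).
Proof.
move=> tw; rewrite /half_step /step; apply: trig_polyX.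
under [X in trig_poly X]eq_fun do rewrite -mulN1r.
apply: trig_polyD; first exact: trig_poly_cst.
apply: trig_polyM; first exact: trig_poly_cst.
apply: trig_polyX; apply: trig_polyM; last exact: trig_poly_cst.
under [X in trig_poly X]eq_fun do rewrite -mulN1r.
apply: trig_polyD; first exact: trig_poly_cst.
by apply: trig_polyM => //; exact: trig_poly_cst.
Qed.

Lemma trig_poly_sinB (b : R) : trig_poly (fun x => sin (b - x)).
Proof.
under [X in trig_poly X]eq_fun do rewrite sinB -mulN1r.
apply: trig_polyD.
  by apply: trig_polyM; [exact: trig_poly_cst | exact: trig_poly_cos].
apply: trig_polyM; first exact: trig_poly_cst.
by apply: trig_polyM; [exact: trig_poly_cst | exact: trig_poly_sin].
Qed.

End TrigonometricPolynomials.

(** * Integrable functions with vanishing Fourier coefficients *)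

Section FourierCompleteness.
Context (R : realType).
Local Notation C := R[i].
Local Notation T := (measurableTypeR R).
Local Notation tm := (@torus_measure R).
Local Notation leb := (@lebesgue_measure R).
Local Notation L1 := (cLp tm 1%:E).

Lemma L1_expiM (f : T -> C) (k : R) : L1 f -> L1 (fun x => expi (k * x) * f x).
Proof.
move=> /L1P[mf fi]; apply/L1P; split.
  by apply: cmeasurableM => //; exact: cmeasurable_expi.
by rewrite /absint; under eq_integral do rewrite normcMl normc_expi mul1r.
Qed.

Section RealZeroCoefficients.
Variable g : T -> R.
Hypotheses (ig : tm.-integrable setT (EFin \o g))
  (g0 : forall p, trig_poly p -> \int[tm]_x (p x * g x) = 0).

Let mg : measurable_fun setT g.
Proof. by have /integrableP[/measurable_EFinP] := ig. Qed.

Let mhs n (w : R -> R) : continuous w -> measurable_fun setT (half_step n w : T -> R).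
Proof.
move=> cw; rewrite /half_step /step; apply: measurable_funX.
apply: measurable_funB => //; apply: measurable_funX; apply: measurable_funM => //.
by apply: measurable_funB => //; exact: continuous_measurable_fun.
Qed.

Let mpos (w1 w2 : R -> R) : continuous w1 -> continuous w2 ->
  measurable_fun setT ((fun x => ((0 < w1 x) && (0 < w2 x))%R%:R) : T -> R).
Proof.
move=> c1 c2; rewrite (_ : (fun x => _) =
  fun x : T => if (0 < w1 x) && (0 < w2 x) then 1 else 0 : R); last first.
  by apply: funext => x; case: (_ && _).
apply: measurable_fun_ifT => //; apply: measurable_and;
  apply: measurable_fun_ltr => //; exact: continuous_measurable_fun.
Qed.

(** Dominated convergence with majorant [|g|]: a product of two half steps is a trigonometric
    polynomial with values in [[0, 1]], so each integral in the sequence is zero. *)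
Lemma half_step_product_lim (w1 w2 : R -> R) :
  trig_poly w1 -> trig_poly w2 -> continuous w1 -> continuous w2 ->
  (forall x, -1 <= w1 x <= 1) -> (forall x, -1 <= w2 x <= 1) ->
  {ae tm, forall x : T, w1 x != 0 /\ w2 x != 0} ->
  \int[tm]_x (((0 < w1 x) && (0 < w2 x))%R%:R * g x) = 0.
Proof.
move=> t1 t2 c1 c2 b1 b2 ne.
pose f_ n (x : T) := (half_step n w1 x * half_step n w2 x * g x)%:E.
pose f (x : T) := (((0 < w1 x) && (0 < w2 x))%R%:R * g x)%:E.
have mf_ n : measurable_fun setT (f_ n).
  apply/measurable_EFinP; apply: measurable_funM => //.
  by apply: measurable_funM; exact: mhs.
have mf : measurable_fun setT f.
  by apply/measurable_EFinP; apply: measurable_funM => //; exact: mpos.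
have f_f : {ae tm, forall x : T, setT x -> f_ ^~ x @ \oo --> f x}.
  apply: filterS ne => x [n1 n2] _; apply: cvg_EFin; first exact: nearW.
  apply: cvgM; last exact: cvg_cst.
  rewrite -mulnb natrM; apply: cvgM; exact: half_step_cvg.
have f_g : {ae tm, forall (x : T) n, setT x -> (`|f_ n x| <= `|(g x)%:E|)%E}.
  apply: nearW => x n _; rewrite lee_fin normrM ler_piMl //.
  have /andP[p0 p1] := half_step_bound n (b1 x).
  have /andP[q0 q1] := half_step_bound n (b2 x).
  by rewrite ger0_norm ?mulr_ge0 // mulr_ile1.
have [_ _] := dominated_convergence measurableT mf_ mf f_f (integrable_abse ig) f_g.
rewrite /Rintegral => cv; rewrite -/(f _).
have : (fun n => (\int[tm]_x f_ n x)%E) @ \oo --> 0%E.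
  rewrite (_ : (fun n => _) = fun=> 0%E); first exact: cvg_cst.
  apply: funext => n; rewrite -[RHS]/(0%R%:E).
  rewrite -(g0 (trig_polyM (trig_poly_half_step n t1) (trig_poly_half_step n t2))).
  rewrite /Rintegral fineK //; apply: integrable_fin_num => //.
  apply: (le_integrable measurableT (mf_ n) _ ig) => x _.
  rewrite lee_fin normrM ler_piMl //.
  have /andP[p0 p1] := half_step_bound n (b1 x).
  have /andP[q0 q1] := half_step_bound n (b2 x).
  by rewrite ger0_norm ?mulr_ge0 // mulr_ile1.
by move=> cv0; rewrite (cvg_unique _ cv cv0).
Qed.

Lemma sin_eq0_lt2pi (z : R) : `|z| < 2 * pi -> sin z = 0 -> [\/ z = - pi, z = 0 | z = pi].
Proof.
have key (y : R) : 0 <= y < 2 * pi -> sin y = 0 -> y = 0 \/ y = pi.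
  move=> /andP[]; rewrite le_eqVlt => /orP[/eqP <- _ _|y0 y2 sy]; first by left.
  have [yp|yp|->] := ltgtP y pi; last by right.
  - by have := @sin_gt0_pi _ y; rewrite y0 yp sy ltxx => /(_ isT).
  - have := @sin_gt0_pi _ (y - pi); rewrite -(opprK (sin _)) -sinDpi subrK sy oppr0 ltxx.
    by move=> h; have : false by apply: h; lra.
have [z0|z0] := leP 0 z.
  rewrite ger0_norm // => z2 /key; rewrite z0 z2 => /(_ isT) [->|->].
    by constructor 2.
  by constructor 3.
rewrite ltr0_norm // => z2 sz; have := key (- z); rewrite sinN sz oppr0 z2 oppr_ge0 ltW //.
move=> /(_ isT erefl) [h|h]; last by constructor 1; rewrite -h opprK.
by move: z0; rewrite -oppr_gt0 h ltxx.
Qed.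

Lemma sin_gt0E (y : R) : - pi <= y < 2 * pi -> (0 < sin y) = (0 < y < pi).
Proof.
move=> /andP[y1 y2]; have [/sin_gt0_pi ->//|] := boolP (0 < y < pi).
rewrite negb_and -!leNgt => /orP[y0|yp]; apply/negbTE; rewrite -leNgt.
  by rewrite -oppr_ge0 -sinN sin_ge0_pi //; lra.
rewrite -[y](subrK pi) sinDpi oppr_le0 sin_ge0_pi //; lra.
Qed.

(** The first sine confines [x] to the half period after [c]; there [b - x] lies in []-pi, pi[],
    where the sign of the sine is the sign of its argument. Since this only reaches intervals
    shorter than [pi], the torus is treated in two halves, [c = 0] and [c = pi]. *)
Lemma sin_interval (c b x : R) : c = 0 \/ c = pi -> c < b < c + pi ->
  0 <= x < 2 * pi -> x != b -> (0 < sin (x - c)) && (0 < sin (b - x)) = (c < x <= b).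
Proof.
move=> hc /andP[cb bc] /andP[x0 x2] xb; have pi0 := @pi_gt0 R.
rewrite sin_gt0E; last by case: hc => ->; lra.
have [h|h] := boolP (0 < x - c < pi) => /=; last first.
  by apply/esym/negbTE/negP => h'; move/negP: h; apply; lra.
rewrite sin_gt0E; last by lra.
have {}xb : x < b \/ b < x by apply/orP; rewrite -neq_lt.
by apply/idP/idP => h'; case: xb => xb; lra.
Qed.

Lemma interval_zero (c b : R) : c = 0 \/ c = pi -> c < b < c + pi ->
  \int[leb]_(x in `]c, b]) (g \_ (@torus R)) x = 0.
Proof.
move=> hc /andP[cb bc]; have pi0 := @pi_gt0 R.
pose w1 (x : R) := sin (x - c); pose w2 (x : R) := sin (b - x).
have sb (y : R) : -1 <= sin y <= 1 by rewrite sin_geN1 sin_le1.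
have c1 : continuous w1.
  move=> x; apply: (@continuous_comp _ _ _ (fun x => x - c) sin); last exact: continuous_sin.
  by apply: cvgB; [exact: cvg_id|exact: cvg_cst].
have c2 : continuous w2.
  move=> x; apply: (@continuous_comp _ _ _ (fun x => b - x) sin); last exact: continuous_sin.
  by apply: cvgB; [exact: cvg_cst|exact: cvg_id].
have t1 : trig_poly w1.
  rewrite /w1 (_ : (fun x => _) = (fun x => -1 * sin (c - x))); last first.
    by apply: funext => x; rewrite mulN1r -sinN opprB.
  by apply: trig_polyM; [exact: trig_poly_cst|exact: trig_poly_sinB].
have range (x : R) : @torus R x -> 0 <= x < 2 * pi.
  by rewrite /torus /= in_itv.
(* On the torus both arguments have modulus below [2 pi], so the sines can vanish only at the six
   points [c], [c - pi], [c + pi], [b], [b - pi], [b + pi]. *)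
have ne : {ae tm, forall x : T, w1 x != 0 /\ w2 x != 0}.
  apply: filterS2 (ae_torus R) (filterI (filterI (ae_torus_neq (c - pi))
    (filterI (ae_torus_neq c) (ae_torus_neq (c + pi)))) (filterI (ae_torus_neq (b + pi))
    (filterI (ae_torus_neq b) (ae_torus_neq (b - pi))))).
  move=> x /range /andP[x0 x2] [[x3 [x4 x5]] [x6 [x7 x8]]]; split; apply/eqP.
    have z2 : `|x - c| < 2 * pi by rewrite ltr_norml; case: hc => ->; lra.
    move=> /(sin_eq0_lt2pi z2) [h|/subr0_eq h|h].
    - by case/eqP: x3; rewrite -h; ring.
    - by case/eqP: x4.
    - by case/eqP: x5; rewrite -h; ring.
  have z2 : `|b - x| < 2 * pi.
    by rewrite ltr_norml; case: hc => hc'; rewrite hc' in cb bc; lra.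
  move=> /(sin_eq0_lt2pi z2) [h|/subr0_eq h|h].
  - by case/eqP: x6; rewrite -[pi]opprK -h; ring.
  - by case/eqP: x7.
  - by case/eqP: x8; rewrite -h; ring.
have h0 := half_step_product_lim t1 (trig_poly_sinB b) c1 c2 (fun x => sb _) (fun x => sb _) ne.
have mi : measurable (`]c, b]%classic : set T) by exact: measurable_itv.
rewrite Rintegral_mkcond -[RHS]h0 /Rintegral; congr fine.
rewrite torus_integralE; last first.
  by apply/measurable_EFinP; apply: measurable_funM => //; exact: mpos.
rewrite [RHS]integral_mkcond; apply: ae_eq_integral => //.
- apply/measurable_EFinP; apply/(measurable_restrictT _ _).1 => //.
  apply: measurable_funTS; apply/(measurable_restrictT _ _).1 => //.
    exact: measurable_torus.
  exact: measurable_funTS.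
- apply/(measurable_restrictT _ _).1 => //; first exact: measurable_torus.
  apply: measurable_funTS.
  by apply/measurable_EFinP; apply: measurable_funM => //; exact: mpos.
have : {ae leb, forall x : T, x != b}.
  exists [set b]; split => //; first exact: lebesgue_measure_set1.
  by move=> x /= /negP; rewrite negbK => /eqP.
apply: filterS => x xb _; rewrite !patchE.
have -> : (x \in (`]c, b]%classic : set T)) = (c < x <= b).
  by apply/idP/idP => [/set_mem|h]; rewrite ?inE /= in_itv.
have [xt|] := boolP (x \in @torus R); last by case: ifP.
rewrite /w1 sin_interval ?cb //; last by apply: range; exact: set_mem.
by case: ifP => _; rewrite ?mul1r ?mul0r.
Qed.

(** By Lebesgue differentiation [g] is almost everywhere the derivative of its integral [F] from
    [c], and [interval_zero] says that [F] vanishes on the half torus. *)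
Lemma half_torus_zero (c : R) : c = 0 \/ c = pi ->
  {ae leb, forall x : T, c < x < c + pi -> (g \_ (@torus R)) x = 0}.
Proof.
move=> hc; have mT := @measurable_torus R.
have igT : leb.-integrable (@torus R) (EFin \o g).
  have /integrableP[mgE h] := ig; apply/integrableP; split.
    exact: measurable_funS mgE.
  rewrite -torus_integralE //; exact: measurableT_comp.
have igl : leb.-integrable setT (EFin \o (g \_ (@torus R))).
  by rewrite -restrict_EFin -integrable_mkcond.
have int y : leb.-integrable [set` Interval (BRight c) (BRight y)] (EFin \o (g \_ (@torus R))).
  by apply: integrableS igl => //; exact: measurable_itv.
pose F (y : R) := \int[leb]_(t in `]c, y]) (g \_ (@torus R)) t.
have ftc : {ae leb, forall x : T, (BRight c < BRight (x : R))%E ->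
    derivable F x 1 /\ F^`()%classic x = (g \_ (@torus R)) x}.
  exact: FTC1 int (integrable_locally mT igT).
apply: filterS ftc => x h /andP[cx xc].
have [dF <-] := h cx.
rewrite derive1E (@near_eq_derive _ _ _ _ (cst 0)) ?derive_cst //.
have : \forall y \near x, y \in `]c, (c + pi)[ by apply: near_in_itvoo; rewrite in_itv /= cx.
by apply: filterS => y; rewrite in_itv /= => hy; exact: interval_zero.
Qed.

(** The two open halves miss only the points 0 and [pi] of the torus. *)
Lemma real_zero_coefficients : {ae tm, forall x, g x = 0}.
Proof.
apply: ae_torus_lebesgue; have pi0 := @pi_gt0 R.
have ne0 (a : T) : {ae leb, forall x : T, x != a}.
  exists [set a]; split => //; first exact: lebesgue_measure_set1.
  by move=> x /= /negP; rewrite negbK => /eqP.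
apply: filterS2 (filterI (half_torus_zero (or_introl erefl)) (half_torus_zero (or_intror erefl)))
  (filterI (ne0 0) (ne0 pi)) => x [h1 h2] [x0 xp] tx.
rewrite patchE mem_set // in h1; rewrite patchE mem_set // in h2.
move: tx; rewrite /torus /= in_itv /= => /andP[x1 x2].
have {}x1 : 0 < x by rewrite lt_neqAle eq_sym x0.
have [xl|xg] := ltP x pi; first by apply: h1; lra.
have xg' : pi < x by rewrite lt_neqAle eq_sym xp.
by apply: h2; lra.
Qed.

End RealZeroCoefficients.

Section ZeroCoefficients.
Variable f : T -> C.
Hypotheses (Lf : L1 f)
  (f0 : forall k : int, cintegral tm (fun x => expi (k%:~R * x) * f x) = 0).

Lemma trig_poly_orth p : trig_poly p ->
  cintegral tm (fun x => (p x)%:C * f x) = 0.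
Proof.
move=> [s ps]; under [X in cintegral _ X]eq_fun do rewrite ps mulr_suml.
rewrite cintegral_sum => [|e]; last first.
  under [X in cLp _ _ X]eq_fun do rewrite -mulrA.
  by apply: L1Z; exact: L1_expiM.
rewrite big1 // => e _; under [X in cintegral _ X]eq_fun do rewrite -mulrA.
by rewrite cintegralZ ?f0 ?mulr0 //; exact: L1_expiM.
Qed.

Lemma zero_coefficients : ceq_ae tm f (fun=> 0).
Proof.
have [mf _] := Lf; have [m1 m2] := mf.
have tp p : trig_poly p -> \int[tm]_x (p x * Re (f x)) = 0 /\ \int[tm]_x (p x * Im (f x)) = 0.
  move=> /trig_poly_orth; rewrite /cintegral.
  under eq_Rintegral do rewrite ReMC; under [X in Complex _ X]eq_Rintegral do rewrite ImMC.
  by move=> /eqP; rewrite eq_complex /= => /andP[/eqP -> /eqP ->].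
have h1 := real_zero_coefficients (L1_integrable_Re Lf) (fun p hp => (tp p hp).1).
have h2 := real_zero_coefficients (L1_integrable_Im Lf) (fun p hp => (tp p hp).2).
apply: filterS2 h1 h2 => x e1 e2.
by apply/eqP; rewrite eq_complex /= e1 e2 eqxx.
Qed.

End ZeroCoefficients.
End FourierCompleteness.

Section FourierBasis.
Context (R : realType).
Local Notation C := R[i].
Local Notation T := (measurableTypeR R).
Local Notation V := (T -> R[i]^o).
Local Notation tm := (@torus_measure R).
Local Notation L1 := (cLp tm 1%:E).
Local Notation L2 := (cLp tm 2%:E : V -> Prop).
Local Notation ip := (@inner R : V -> V -> C).
Local Notation e := (@fourier_basis R : int -> V).

Lemma hilbert_torus : hilbert L2 ip.
Proof. exact: hilbert_L2. Qed.

Lemma L2_const_lty (c : C) : L2 (fun=> c).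
Proof.
apply/L2P; split; first exact: cmeasurable_cst.
rewrite /sqint integral_cst //; apply: lte_mul_pinfty; rewrite ?lee_fin ?sqr_ge0 //.
exact: torus_measure_lty.
Qed.

Lemma L2_expi (k : R) (c : C) : L2 (fun x => c * expi (k * x)).
Proof.
have /L2P[_ h] := L2_const_lty c; apply/L2P; split.
  by apply: cmeasurableM; [exact: cmeasurable_cst|exact: cmeasurable_expi].
rewrite /sqint in h *; under eq_integral do rewrite normcMl normc_expi mulr1.
exact: h.
Qed.

Lemma L2_L1 f : L2 f -> L1 f.
Proof.
move=> Lf; have := L1M (L2_const_lty 1) Lf.
by under [X in cLp _ _ X]eq_fun do rewrite rmorph1 mul1r.
Qed.

Lemma L2_fourier_basis n : L2 (e n).
Proof. exact: L2_expi. Qed.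

Lemma orthonormal_fourier_basis : orthonormal L2 ip xpredT e.
Proof.
split=> [n|j k _ _]; first exact: L2_fourier_basis.
have pi0 : 0 < 2 * pi :> R by rewrite mulr_gt0 // pi_gt0.
rewrite /inner /fourier_basis.
transitivity (cintegral tm (fun x => ((2 * pi)^-1)%:C * expi ((k - j)%:~R * x))).
  congr cintegral; apply: funext => x; rewrite conjcM realcJ expi_conj.
  rewrite mulrACA -realcM -expiD -invfM -expr2 sqr_sqrtr; last exact: ltW.
  by rewrite intrB mulrBl addrC.
have L1e : L1 (fun x => expi ((k - j)%:~R * x)).
  have := L2_L1 (L2_expi (k - j)%:~R 1).
  by under [X in cLp _ _ X]eq_fun do rewrite mul1r.
rewrite cintegralZ // cintegral_expi_torus subr_eq0 eq_sym.
by case: eqP => _; rewrite ?mulr0 // -realcM mulVf // gt_eqF.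
Qed.

(** The torus has finite measure, so [L^2] lies in [L^1], where vanishing coefficients already force
    the function to be zero almost everywhere. *)
Lemma total_fourier_basis : total L2 ip xpredT e.
Proof.
move=> f Lf f0; have pi0 : 0 < 2 * pi :> R by rewrite mulr_gt0 // pi_gt0.
have f0' (k : int) : cintegral tm (fun x => expi (k%:~R * x) * f x) = 0.
  have := f0 (- k) isT; rewrite /inner /fourier_basis.
  under [X in cintegral _ X]eq_fun do rewrite conjcM realcJ expi_conj rmorphN /= mulNr opprK -mulrA.
  rewrite cintegralZ; last by apply: L1_expiM; exact: L2_L1.
  move=> /eqP; rewrite mulf_eq0 => /orP[|/eqP //].
  by rewrite -normc_eq0 normc_realc normr_eq0 invr_eq0 sqrtr_eq0 leNgt pi0.
have := zero_coefficients (L2_L1 Lf) f0'.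
by move=> /(hnorm0_ae Lf (L2_0 tm)) ; rewrite [f - _]subr0.
Qed.

Definition sym_range (N : nat) : seq int :=
  [seq (k : nat)%:Z - N%:Z | k <- index_iota 0 N.*2.+1].

Lemma mem_sym_range N (i : int) : (i \in sym_range N) = (- N%:Z <= i <= N%:Z).
Proof.
apply/mapP/idP => [[k]|/andP[h1 h2]].
  by rewrite mem_index_iota /= => kN ->; lia.
exists (absz (i + N%:Z)%R); last by lia.
by rewrite mem_index_iota /=; lia.
Qed.

Lemma exhaustion_sym_range : exhaustion sym_range.
Proof.
split=> [n|m n mn i|i].
- rewrite map_inj_uniq ?iota_uniq // => a b; lia.
- by rewrite !mem_sym_range; lia.
- by exists `|i|%N; rewrite mem_sym_range; lia.
Qed.

Lemma symsumE (F : int -> C) N : symsum F N = \sum_(i <- sym_range N) F i.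
Proof. by rewrite /symsum /sym_range big_map big_mkord. Qed.

End FourierBasis.

(** * Operators on the torus and the free propagator *)

Section TorusOperators.
Context (R : realType).
Local Notation C := R[i].
Local Notation T := (measurableTypeR R).
Local Notation V := (T -> R[i]^o).
Local Notation tm := (@torus_measure R).
Local Notation L2 := (cLp tm 2%:E : V -> Prop).
Local Notation ip := (@inner R : V -> V -> C).
Local Notation e := (@fourier_basis R : int -> V).
Local Notation nsq := (hnsq ip).
Local Notation hnorm := (hilbert_norm ip).
Local Notation hcvg := (hilbert_cvg ip).
Local Notation heq := (hilbert_eq ip).
Local Notation bounded := (hbounded L2 ip).
Local Notation svd := (hsvd L2 ip).
Local Notation H := (hilbert_torus R).
Local Notation one := (orthonormal_fourier_basis R).
Local Notation tot := (total_fourier_basis (R := R)).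
Local Notation es := exhaustion_sym_range.
Implicit Types (A B P : V -> V) (f g h : V).

Lemma lincomb_fctE (I : choiceType) (v : I -> V) (c : I -> C) (s : seq I) x :
  lincomb v c s x = \sum_(i <- s) c i * v i x.
Proof. by rewrite /lincomb fct_sumE. Qed.

Lemma ae_heq f g : L2 f -> L2 g -> ceq_ae tm f g <-> heq f g.
Proof. by move=> Lf Lg; split=> /(hnorm0_ae Lf Lg). Qed.

Lemma cLnorm2_inner f : L2 f -> cLnorm tm 2%:E f = (hnorm f)%:E.
Proof. exact: cLnorm2_hnorm. Qed.

Lemma bounded_opP A : bounded_op A <-> bounded A.
Proof.
have L2l := hilbert_lin H; split=> -[inA lin [M hM]]; split=> //.
- move=> c f g Lf Lg; apply/ae_heq; last exact: lin.
    by apply: inA; exact: L2l.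
  by apply: L2l; exact: inA.
- exists M => f Lf; have := hM f Lf.
  by rewrite !cLnorm2_inner ?lee_fin //; exact: inA.
- move=> c f g Lf Lg.
  have LA : L2 (A (c *: f + g)) by apply: inA; exact: L2l.
  have LA' : L2 (c *: A f + A g) by apply: L2l; exact: inA.
  exact: (ae_heq LA LA').2 (lin c f g Lf Lg).
- exists M => f Lf; have := hM f Lf.
  by rewrite !cLnorm2_inner ?lee_fin //; exact: inA.
Qed.

Lemma svd_sum_fctE (a : nat -> R) (phi psi : nat -> V) f :
  svd_sum ip a phi psi f =
  (fun N x => \sum_(n < N) (a n)%:C * inner (psi n) f * phi n x).
Proof.
by apply: funext => N; apply: funext => x; rewrite /svd_sum lincomb_fctE big_mkord.
Qed.

Lemma is_svdP A (a : nat -> R) (phi psi : nat -> V) :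
  is_svd A a phi psi <-> svd A a phi psi.
Proof.
split=> [[a0 onl onr cv]|[a0 onl onr inA cv]].
  have Ls f N : L2 (svd_sum ip a phi psi f N) by apply: (lincomb_in H); exact: onl.1.
  have cv' f : L2 f -> L2 (A f) /\ hcvg (svd_sum ip a phi psi f) (A f).
    by move=> Lf; apply/(cvgLp_hcvg (A f) (Ls f)); rewrite svd_sum_fctE; exact: cv.
  by split=> // f /cv'[].
split=> // f Lf; rewrite -svd_sum_fctE.
apply/(@cvgLp_hcvg _ _ _ tm); first by move=> N; apply: (lincomb_in H); exact: onl.1.
by split; [exact: inA|exact: cv].
Qed.

(** The vector built in [hbounded_adjoint] shows that [adjoint] chooses from a nonempty set. *)
Lemma adjointP A : bounded A -> forall g, L2 g ->
  L2 (adjoint A g) /\ forall f, L2 f -> ip (A f) g = ip f (adjoint A g).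
Proof.
move=> bA g Lg; have [h Lh hh] := hbounded_adjoint H bA one tot es Lg.
exact: (@xgetPex _ (fun=> 0) [set h | L2 h /\ forall f, L2 f -> inner (A f) g = inner f h]
  (ex_intro _ h (conj Lh hh))).
Qed.

Lemma adjoint_in A : bounded A -> forall g, L2 g -> L2 (adjoint A g).
Proof. by move=> bA g /(adjointP bA)[]. Qed.

Lemma adjoint_ip A : bounded A ->
  forall f g, L2 f -> L2 g -> ip (A f) g = ip f (adjoint A g).
Proof. by move=> bA f g Lf /(adjointP bA)[_]; exact. Qed.

Lemma ptraceE P (b : nat -> R) (psi : nat -> V) : svd P b psi psi ->
  ptrace P = (\esum_(n in [set: nat]) (b n)%:E)%E.
Proof. exact: (svd_trace H one tot es). Qed.

(** Polar decomposition transports the eigenbasis of [|A|] hidden in the witness to a decomposition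
    of [A] itself. *)
Lemma abs_power_svd A (r : R) P : bounded A -> is_abs_power A r P ->
  exists (s : nat -> R) (phi psi : nat -> V), svd A s phi psi /\
    ptrace P = (\esum_(n in [set: nat]) (s n `^ r)%:E)%E.
Proof.
move=> bA [B [s [psi [[/bounded_opP bB B0 BB] /is_svdP sB /is_svdP sP]]]].
have BB' f : L2 f -> heq (B (B f)) (adjoint A (A f)).
  move=> Lf; apply/ae_heq; last exact: BB.
    by case: bB => h _ _; do 2 apply: (h).
  by apply: adjoint_in => //; case: bA => h _ _; exact: h.
have [phi sA] := abs_svd H bA bB (adjoint_in bA) (adjoint_ip bA) BB' sB.
by exists s, phi, psi; split=> //; exact: ptraceE sP.
Qed.

(** Converse to [abs_power_svd]: [|A|] and its power are taken diagonal in the right vectors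
    [psi]. *)
Lemma svd_abs_power A (a : nat -> R) (phi psi : nat -> V) (M r : R) : r != 0 ->
  svd A a phi psi -> (forall n, a n <= M) -> 0 <= r ->
  exists2 P, is_abs_power A r P &
    ptrace P = (\esum_(n in [set: nat]) (a n `^ r)%:E)%E.
Proof.
move=> r0 sA aM r_ge0; have a0 := svd_ge0 sA.
have bA := svd_hbounded H sA aM.
have [|B sB] := @hsvd_exists _ _ _ _ H a psi psi M _ (svd_onr sA) (svd_onr sA).
  by move=> n; rewrite a0 aM.
have onr : orthonormal L2 ip (supp (fun n => a n `^ r)) psi.
  have [Lpsi onp] := svd_onr sA; split=> // i j Ji Jj; apply: onp.
    (* A zero coefficient has zero power because [r] is nonzero, so the support of the powers lies
       in the support of [a]. *)
    by apply: contra_neq Ji => ->; rewrite powR0.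
  by apply: contra_neq Jj => ->; rewrite powR0.
have [|P sP] := @hsvd_exists _ _ _ _ H (fun n => a n `^ r) psi psi (M `^ r) _ onr onr.
  move=> n; rewrite powR_ge0 /=; apply: ge0_ler_powR => //; rewrite nnegrE //.
  exact: le_trans (a0 n) (aM n).
exists P; last exact: ptraceE sP.
exists B, a, psi; split; [|exact/is_svdP|exact/is_svdP].
split; first by apply/bounded_opP; exact: (svd_hbounded H sB aM).
  by move=> f Lf; have [] := svd_diag_form H sB Lf.
move=> f Lf; have LBB : L2 (B (B f)) by apply: (svd_in sB); exact: (svd_in sB).
have LAA : L2 (adjoint A (A f)) by apply: adjoint_in => //; exact: (svd_in sA).
by apply/(ae_heq LBB LAA); apply: (svd_abs H sA sB (adjoint_in bA) (adjoint_ip bA)).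
Qed.

Lemma svd_schatten A (a : nat -> R) (phi psi : nat -> V) (M r : R) : 1 <= r ->
  svd A a phi psi -> (forall n, a n <= M) ->
  (\esum_(n in [set: nat]) (a n `^ r)%:E < +oo)%E ->
  schatten r%:E A /\
  (schatten_norm r%:E A <= (\esum_(n in [set: nat]) (a n `^ r)%:E) `^ r^-1)%E.
Proof.
move=> r1 sA aM fin; have r0 : 0 < r by exact: lt_le_trans ltr01 r1.
have [|P AP eP] := svd_abs_power _ sA aM (ltW r0); first by rewrite gt_eqF.
have le : (schatten_norm r%:E A <= (\esum_(n in [set: nat]) (a n `^ r)%:E) `^ r^-1)%E.
  by apply: ereal_inf_lbound; exists P => //; rewrite eP.
split=> //; split; first by apply/bounded_opP; exact: (svd_hbounded H sA aM).
by apply: le_lt_trans le _; rewrite poweR_lty.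
Qed.

Lemma heq_coef f g : L2 f -> L2 g -> (forall i, ip (e i) f = ip (e i) g) -> heq f g.
Proof.
move=> Lf Lg h; apply: tot; first exact: (hilbertB H).
by move=> i _; rewrite (ipBr H) ?h ?subrr //; exact: L2_fourier_basis.
Qed.

Lemma parseval_ip f g : L2 f -> L2 g ->
  ccvg (fun N => \sum_(i <- sym_range N) (ip (e i) f)^* * ip (e i) g) (ip f g).
Proof.
move=> Lf Lg; have Le := @L2_fourier_basis R.
have Ll N : L2 (lincomb e (fun i => ip (e i) g) (sym_range N)) by exact: (lincomb_in H).
apply: ccvg_ext (ccvg_ipr H Ll Lg Lf (total_expansion H one es Lg tot)) => N.
rewrite (ip_sumr H) //; last by move=> i _; exact: (hilbertZ H).
by apply: eq_bigr => i _; rewrite (ipZr H) // mulrC; congr (_ * _); exact: (ip_conj H).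
Qed.

Section Propagator.
Variable t : R.
Local Notation U := (propagator t : V -> V).
Local Notation phase n := (expi (- t * n%:~R ^+ 2)).

(** The phases have modulus 1, so Bessel for [f] bounds the partial sums and Riesz-Fischer supplies
    a limit for [propagator] to choose. *)
Lemma propagator_spec f : L2 f ->
  L2 (U f) /\ hcvg (fun N => lincomb e (fun n => phase n * ip (e n) f) (sym_range N)) (U f).
Proof.
move=> Lf; pose c n := phase n * ip (e n) f.
have Ll N : L2 (lincomb e c (sym_range N)).
  by apply: (lincomb_in H); exact: L2_fourier_basis.
have seqE : (fun N x => symsum (fun n => fourier_basis n x *
    expi (- t * n%:~R ^+ 2) * fourier_coef f n) N) = (fun N => lincomb e c (sym_range N)).
  apply: funext => N; apply: funext => x; rewrite symsumE lincomb_fctE.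
  by apply: eq_bigr => n _; rewrite -mulrA mulrC.
have bound N : \sum_(n <- sym_range N) normc (c n) ^+ 2 <= nsq f.
  under eq_bigr do rewrite normcMl normc_expi mul1r.
  have [us _ _] := es; apply: (bessel H one) => //; exact/allP.
have [g Lg gl] := riesz_fischer H one (fun i (n : ~~ xpredT i) => False_ind _ (notF n)) es bound.
have : cvgLp tm 2%:E (fun N x => symsum (fun n => fourier_basis n x *
    expi (- t * n%:~R ^+ 2) * fourier_coef f n) N) (U f).
  apply: (@xgetPex _ (fun=> 0) [set g | cvgLp tm 2%:E (fun N x => symsum (fun n =>
    fourier_basis n x * expi (- t * n%:~R ^+ 2) * fourier_coef f n) N) g]).
  by exists g; rewrite /= seqE; apply/(cvgLp_hcvg g Ll).
by rewrite seqE => /(cvgLp_hcvg _ Ll).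
Qed.

Local Opaque inner propagator adjoint.

Lemma propagator_in f : L2 f -> L2 (U f).
Proof. by move=> /propagator_spec[]. Qed.

Lemma propagator_coef f n : L2 f -> ip (e n) (U f) = phase n * ip (e n) f.
Proof.
move=> Lf; have [LUf cv] := propagator_spec Lf.
exact: (hcvg_coef H one (fun i (n : ~~ xpredT i) => False_ind _ (notF n)) es LUf cv).
Qed.

Lemma propagator_isometry f g : L2 f -> L2 g -> ip (U f) (U g) = ip f g.
Proof.
move=> Lf Lg; have := parseval_ip (propagator_in Lf) (propagator_in Lg).
move=> /ccvg_unique; apply; apply: ccvg_ext (parseval_ip Lf Lg) => N.
apply: eq_bigr => n _.
rewrite [X in _ = X^* * _](propagator_coef n Lf) [X in _ = _ * X](propagator_coef n Lg).
by rewrite conjcM [RHS]mulrACA expi_conjM mul1r.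
Qed.

Lemma propagator_bounded : bounded U.
Proof.
split; first exact: propagator_in.
  move=> c f g Lf Lg; have Le := @L2_fourier_basis R.
  have LUf := propagator_in Lf; have LUg := propagator_in Lg.
  apply: heq_coef => [||i].
  - by apply: propagator_in; exact: (hilbert_lin H).
  - exact: (hilbert_lin H).
  rewrite propagator_coef; last exact: (hilbert_lin H).
  rewrite [RHS](ip_linr H) // [X in _ * X = _](ip_linr H) //.
  rewrite [X in _ = _ * X + _](propagator_coef i Lf) [X in _ = _ + X](propagator_coef i Lg).
  by ring.
by exists 1 => f Lf; rewrite mul1r /hilbert_norm /hnsq propagator_isometry.
Qed.

Lemma adjoint_propagator_basis k :
  heq (adjoint U (e k)) ((phase k)^* *: e k).
Proof.
have bU := propagator_bounded; have Lk := @L2_fourier_basis R k.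
have La := adjoint_in bU Lk.
apply: (heq_orth H) => // [|h Lh]; first exact: (hilbertZ H).
rewrite -adjoint_ip // (ipZr H) // (ip_conj H (e k)) propagator_coef // conjcM.
by congr (_ * _); rewrite -(ip_conj H).
Qed.

(** The propagator is diagonal in the Fourier basis; the product of the two phases is the source of
    the time frequency [k^2 - j^2]. *)
Lemma evolved_coef A j k : bounded A ->
  ip (e j) (evolved t A (e k)) = phase j * (phase k)^* * ip (e j) (A (e k)).
Proof.
move=> bA; have bU := propagator_bounded; have Le := @L2_fourier_basis R.
have La := adjoint_in bU (Le k).
have LA f : L2 f -> L2 (A f) by case: bA => h _ _; exact: h.
have LZ : L2 ((phase k)^* *: e k) by exact: (hilbertZ H).
rewrite /evolved propagator_coef; last exact: LA.
rewrite -mulrA; congr (_ * _).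
rewrite (heq_ipr H (LA _ La) (LA _ LZ) (Le j)
  (hbounded_heq H bA La LZ (adjoint_propagator_basis k))).
(* A combination with one term: homogeneity of [A] up to null vectors. *)
have := hbounded_lincomb H bA (fun=> (phase k)^*) [:: k] Le.
rewrite /lincomb !big_seq1 => h.
have LZA : L2 ((phase k)^* *: (A \o e) k) by apply: (hilbertZ H); exact: LA.
by rewrite (heq_ipr H (LA _ LZ) LZA (Le j) h) (ipZr H) //; exact: LA.
Qed.

Lemma evolved_svd A (a : nat -> R) (phi psi : nat -> V) : svd A a phi psi ->
  svd (evolved t A) a (U \o phi) (U \o psi).
Proof.
move=> sA; have bU := propagator_bounded.
exact: (svd_conj H sA bU propagator_isometry (adjoint_in bU) (adjoint_ip bU)).
Qed.

End Propagator.

End TorusOperators.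

(** * Space-time series *)

Section ProductMeasure.
Context d1 d2 (X : measurableType d1) (Y : measurableType d2) (R : realType).
Variables (m1 : {sigma_finite_measure set X -> \bar R})
  (m2 : {sigma_finite_measure set Y -> \bar R}).
Local Notation C := R[i].
Local Notation m12 := (m1 \x m2)%E.

Lemma prod_integral (p : X -> R) (q : Y -> R) :
  m1.-integrable setT (EFin \o p) -> m2.-integrable setT (EFin \o q) ->
  m12.-integrable setT (fun z => (p z.1 * q z.2)%:E) /\
  (\int[m12]_z (p z.1 * q z.2)%:E = ((\int[m1]_x p x)%R * (\int[m2]_y q y)%R)%:E)%E.
Proof.
move=> ip iq; have /integrableP[/measurable_EFinP mp fp] := ip.
have /integrableP[/measurable_EFinP mq fq] := iq.
have mf : measurable_fun setT (fun z : X * Y => (p z.1 * q z.2)%:E).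
  apply/measurable_EFinP; apply: measurable_funM.
    exact: measurableT_comp mp measurable_fst.
  exact: measurableT_comp mq measurable_snd.
have i12 : m12.-integrable setT (fun z => (p z.1 * q z.2)%:E).
  apply/integrable12ltyP => //.
  have fq' : (\int[m2]_y `|(q y)%:E| \is a fin_num)%E.
    by rewrite ge0_fin_numE // integral_ge0.
  have ex x : (\int[m2]_y `|(p x * q y)%:E| = `|p x|%:E * \int[m2]_y `|(q y)%:E|)%E.
    rewrite -ge0_integralZl ?lee_fin //; last first.
      by apply/measurable_EFinP; exact: measurableT_comp.
    by apply: eq_integral => y _; rewrite /= normrM EFinM.
  rewrite (eq_integral (fun x => `|p x|%:E * \int[m2]_y `|(q y)%:E|)%E) => [|x _]; last exact: ex.
  rewrite ge0_integralZr //; last 2 first.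
  - by apply/measurable_EFinP; exact: measurableT_comp.
  - by apply: integral_ge0.
  have p0 : (0 <= \int[m1]_x `|p x|%:E)%E by apply: integral_ge0 => x _; rewrite lee_fin.
  apply: lte_mul_pinfty => //; rewrite ge0_fin_numE //; exact: fp.
split => //; rewrite -integral12_prod_meas1 // /fubini_F.
have ex x : (\int[m2]_y (p x * q y)%:E = (p x)%:E * (\int[m2]_y q y)%:E)%E.
  rewrite fineK; last exact: integrable_fin_num.
  by rewrite -integralZl //; apply: eq_integral => y _; rewrite EFinM.
rewrite (eq_integral (fun x => (p x)%:E * (\int[m2]_y q y)%:E)%E) => [|x _]; last exact: ex.
rewrite integralZr // EFinM; congr (_ * _)%E.
by rewrite /Rintegral fineK //; exact: (integrable_fin_num _ ip).
Qed.

Lemma cmeasurable_fst (a : X -> C) : cmeasurable a ->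
  cmeasurable (fun z : X * Y => a z.1).
Proof.
move=> [ma1 ma2]; split.
  exact: measurableT_comp ma1 measurable_fst.
exact: measurableT_comp ma2 measurable_fst.
Qed.

Lemma cmeasurable_snd (b : Y -> C) : cmeasurable b ->
  cmeasurable (fun z : X * Y => b z.2).
Proof.
move=> [mb1 mb2]; split.
  exact: measurableT_comp mb1 measurable_snd.
exact: measurableT_comp mb2 measurable_snd.
Qed.

Lemma cmeasurable_section (F : X * Y -> C) (t : X) : cmeasurable F ->
  cmeasurable (fun y => F (t, y)).
Proof.
have mp : measurable_fun setT (fun y : Y => (t, y)) by exact: measurable_pair1.
move=> [mF1 mF2]; split.
  exact: measurableT_comp mF1 mp.
exact: measurableT_comp mF2 mp.
Qed.

Lemma L2_prod (a : X -> C) (b : Y -> C) : cLp m1 2%:E a -> cLp m2 2%:E b ->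
  cLp m12 2%:E (fun z => a z.1 * b z.2).
Proof.
move=> /L2P[ma fa] /L2P[mb fb]; apply/L2P; split.
  by apply: cmeasurableM; [exact: cmeasurable_fst|exact: cmeasurable_snd].
have int d (Z : measurableType d) (m : {measure set Z -> \bar R}) (f : Z -> C) :
    cmeasurable f -> (sqint m f < +oo)%E ->
    m.-integrable setT (EFin \o (fun x => normc (f x) ^+ 2)).
  move=> mf ff; apply/integrableP; split.
    by apply/measurable_EFinP; exact: cmeasurable_normc2.
  rewrite (eq_integral (fun x => (normc (f x) ^+ 2)%:E)) //.
  by move=> x _; rewrite gee0_abs // lee_fin sqr_ge0.
have [_ e12] := prod_integral (int _ _ _ _ ma fa) (int _ _ _ _ mb fb).
rewrite /sqint; under eq_integral do rewrite normcMl exprMn.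
by rewrite e12 ltry.
Qed.

Lemma cintegral_prod (a : X -> C) (b : Y -> C) : cLp m1 1%:E a -> cLp m2 1%:E b ->
  cintegral m12 (fun z => a z.1 * b z.2) = cintegral m1 a * cintegral m2 b.
Proof.
move=> La Lb.
have aR := L1_integrable_Re La; have aI := L1_integrable_Im La.
have bR := L1_integrable_Re Lb; have bI := L1_integrable_Im Lb.
have [i1 e1] := prod_integral aR bR; have [i2 e2] := prod_integral aI bI.
have [i3 e3] := prod_integral aR bI; have [i4 e4] := prod_integral aI bR.
apply/eqP; rewrite eq_complex ReM ImM /cintegral /=; apply/andP; split; apply/eqP.
  transitivity (\int[m12]_z (complex.Re (a z.1) * complex.Re (b z.2) -
      complex.Im (a z.1) * complex.Im (b z.2))).
    by apply: eq_Rintegral => z _; rewrite ReM.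
  by rewrite RintegralB // /Rintegral e1 e2.
transitivity (\int[m12]_z (complex.Re (a z.1) * complex.Im (b z.2) +
    complex.Im (a z.1) * complex.Re (b z.2))).
  by apply: eq_Rintegral => z _; rewrite ImM.
by rewrite RintegralD // /Rintegral e3 e4.
Qed.

Lemma sqint_prod (F : X * Y -> C) : cmeasurable F ->
  measurable_fun setT (fun t => sqint m2 (fun x => F (t, x))) /\
  sqint m12 F = (\int[m1]_t sqint m2 (fun x => F (t, x)))%E.
Proof.
move=> mF; have mn : measurable_fun setT (fun z => (normc (F z) ^+ 2)%:E).
  by apply/measurable_EFinP; exact: cmeasurable_normc2.
have n0 z : (0 <= (normc (F z) ^+ 2)%:E)%E by rewrite lee_fin sqr_ge0.
split; last by rewrite /sqint fubini_tonelli1.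
exact: (measurable_fun_fubini_tonelli_F (fun z => (normc (F z) ^+ 2)%:E) mn n0).
Qed.

Lemma sqint_eq0 d (Z : measurableType d) (m : {measure set Z -> \bar R}) (F G : Z -> C) :
  cmeasurable F -> cmeasurable G ->
  sqint m (fun z => F z - G z) = 0%E <-> ceq_ae m F G.
Proof.
move=> mF mG; have mFG : measurable_fun setT (fun z => (normc (F z - G z) ^+ 2)%:E).
  by apply/measurable_EFinP/cmeasurable_normc2; exact: cmeasurableB.
have -> : sqint m (fun z => F z - G z) = (\int[m]_z `|(normc (F z - G z) ^+ 2)%:E|)%E.
  by apply: eq_integral => z _; rewrite gee0_abs // lee_fin sqr_ge0.
split=> [/ae_eq_integral_abs h|h].
  apply: filterS (h measurableT mFG) => z /(_ Logic.I) /= /eqP.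
  by rewrite eqe sqrf_eq0 normc_eq0 subr_eq0 => /eqP.
apply/ae_eq_integral_abs => //; apply: filterS h => z -> _ /=.
by rewrite subrr Normc.normc0 expr0n.
Qed.

(** Tonelli for [|F - G|^2], which is where joint measurability is used. *)
Lemma ceq_ae_sections (F G : X * Y -> C) : cmeasurable F -> cmeasurable G ->
  {ae m1, forall t, ceq_ae m2 (fun x => F (t, x)) (fun x => G (t, x))} ->
  ceq_ae m12 F G.
Proof.
move=> mF mG h; apply/sqint_eq0 => //.
have mFG : cmeasurable (fun z => F z - G z) by exact: cmeasurableB.
have [ms ->] := sqint_prod mFG.
rewrite (ae_eq_integral (cst 0%E)) ?integral0 //.
apply: filterS h => t ht _ /=; apply/sqint_eq0 => //; exact: cmeasurable_section.
Qed.

End ProductMeasure.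

Section SpaceTimeSeries.
Context (R : realType).
Local Notation C := R[i].
Local Notation T := (measurableTypeR R).
Local Notation V := (T -> R[i]^o).
Local Notation W := (T * T -> R[i]^o).
Local Notation tm := (@torus_measure R).
Local Notation tm2 := (@torus2_measure R).
Local Notation L2 := (cLp tm 2%:E : V -> Prop).
Local Notation LL2 := (cLp tm2 2%:E : W -> Prop).
Local Notation ip := (@inner R : V -> V -> C).
Local Notation ip2 := (cinner tm2 : W -> W -> C).
Local Notation e := (@fourier_basis R : int -> V).
Local Notation H := (hilbert_torus R).
Local Notation H2 := (hilbert_L2 tm2).

Definition off_diagonal : pred (int * int) := [pred p | p.1 != p.2].

(* The density of |e_j><e_k| along the free flow, a function of (t, x). *)
Definition spacetime_basis (p : int * int) : W :=
  fun z => e (p.2 * p.2 - p.1 * p.1) z.1 * e (p.1 - p.2) z.2.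

(* Off the diagonal, j - k and j^2 - k^2 determine j and k. *)
Lemma spacetime_frequency_inj (p q : int * int) : off_diagonal p ->
  p.2 * p.2 - p.1 * p.1 = q.2 * q.2 - q.1 * q.1 -> p.1 - p.2 = q.1 - q.2 -> p = q.
Proof.
case: p q => [j k] [j' k'] /= jk e1 e2.
have d0 : j - k != 0 by rewrite subr_eq0.
have : (j - k) * (j + k) = (j - k) * (j' + k').
  rewrite [in RHS]e2; move: e1 e2; lia.
move=> /(mulfI d0) e3; congr pair; lia.
Qed.

Lemma orthonormal_spacetime_basis : orthonormal LL2 ip2 off_diagonal spacetime_basis.
Proof.
have Le := @L2_fourier_basis R.
split=> [p|p q Jp Jq]; first exact: L2_prod.
transitivity (ip (e (p.2 * p.2 - p.1 * p.1)) (e (q.2 * q.2 - q.1 * q.1)) *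
              ip (e (p.1 - p.2)) (e (q.1 - q.2))).
  rewrite /inner -(cintegral_prod (L1M (Le _) (Le _)) (L1M (Le _) (Le _))).
  congr cintegral; apply: funext => z /=.
  by rewrite /spacetime_basis conjcM mulrACA.
have on := (orthonormal_fourier_basis R).2.
rewrite !on // -natrM mulnb; congr (_%:R); congr nat_of_bool.
apply/andP/eqP => [[/eqP e1 /eqP e2]|->]; last by [].
exact: spacetime_frequency_inj.
Qed.

Definition box (N : nat) : seq (int * int) :=
  [seq (j, k) | j <- sym_range N, k <- sym_range N].

Lemma exhaustion_box : exhaustion box.
Proof.
have [us mono ex] := exhaustion_sym_range.
split=> [n|m n mn p|[j k]].
- by apply: allpairs_uniq => // -[a b] [c d'] _ _.
- move=> /allpairsP[[j k] /= [jm km ->]].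
  by apply: allpairs_f; exact: mono mn _ _.
- have [m jm] := ex j; have [n kn] := ex k; exists (maxn m n).
  by apply: allpairs_f; [apply: mono jm; exact: leq_maxl|apply: mono kn; exact: leq_maxr].
Qed.

Definition matrix_coef (A : V -> V) (p : int * int) : C := ip (e p.1) (A (e p.2)).

(** The diagonal is removed here; by [flow_sumE] this is the effect of subtracting the trace. *)
Definition flow_coef (A : V -> V) (p : int * int) : C :=
  if p.1 == p.2 then 0 else matrix_coef A p.

Definition flow_sum (A : V -> V) (N : nat) : W :=
  lincomb spacetime_basis (flow_coef A) (box N).

(** The witness for the extension. It is the sum of the series for Hilbert-Schmidt [A], and 0 when
    the series has no limit in [L^2]. *)
Definition density_flow (A : V -> V) : W :=
  xget (fun=> 0) [set F | LL2 F /\ hilbert_cvg ip2 (flow_sum A) F].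

Lemma flow_coef0 A p : ~~ off_diagonal p -> flow_coef A p = 0.
Proof. by rewrite /flow_coef /= negbK => ->. Qed.

Lemma flow_sum_in A N : LL2 (flow_sum A N).
Proof. by apply: (lincomb_in H2); exact: orthonormal_spacetime_basis.1. Qed.

Section HilbertSchmidt.
Variables (A : V -> V) (M : R).
Hypothesis inA : forall f, L2 f -> L2 (A f).
Hypothesis hs : forall N, \sum_(k <- sym_range N) hnsq ip (A (e k)) <= M.

(** Bessel for the vector [A (e k)] in each column [k] of the matrix. *)
Lemma flow_coef_bound N : \sum_(p <- box N) normc (flow_coef A p) ^+ 2 <= M.
Proof.
apply: le_trans (hs N); rewrite /box big_allpairs exchange_big /=.
apply: ler_sum => k _; have Le := @L2_fourier_basis R.
have [us _ _] := exhaustion_sym_range.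
apply: le_trans (bessel H (orthonormal_fourier_basis R) (inA (Le k)) (us N) _); last exact/allP.
apply: ler_sum => j _; rewrite /flow_coef /matrix_coef /=.
by case: ifP => // _; rewrite Normc.normc0 expr0n sqr_ge0.
Qed.

Lemma density_flowP : LL2 (density_flow A) /\
  hilbert_cvg ip2 (flow_sum A) (density_flow A).
Proof.
have [F LF cF] := riesz_fischer H2 orthonormal_spacetime_basis (@flow_coef0 A) exhaustion_box
  flow_coef_bound.
exact: (@xgetPex _ (fun=> 0) [set F | LL2 F /\ hilbert_cvg ip2 (flow_sum A) F]
  (ex_intro _ F (conj LF cF))).
Qed.

Lemma density_flow_nsq : hnsq ip2 (density_flow A) <= M.
Proof.
have [LF cF] := density_flowP; rewrite -lee_fin.
rewrite (hcvg_nsq H2 orthonormal_spacetime_basis (@flow_coef0 A) exhaustion_box LF cF).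
apply: (esum_exhaustion_le exhaustion_box) => [p|N]; first by rewrite sqr_ge0.
by rewrite lee_fin flow_coef_bound.
Qed.

Lemma density_flow_coef p : off_diagonal p -> ip2 (spacetime_basis p) (density_flow A) = matrix_coef A p.
Proof.
move=> Jp; have [LF cF] := density_flowP.
rewrite (hcvg_coef H2 orthonormal_spacetime_basis (@flow_coef0 A) exhaustion_box LF cF) //.
by rewrite /flow_coef (negbTE (Jp : p.1 != p.2)).
Qed.

End HilbertSchmidt.

End SpaceTimeSeries.

(** * Densities of trace class operators *)

Lemma cvg_sum0 (R : realType) (I : Type) (s : seq I) (F : I -> nat -> R) :
  (forall i, F i @ \oo --> (0 : R)) -> (fun K => \sum_(i <- s) F i K) @ \oo --> (0 : R).
Proof.
move=> hF; elim: s => [|i s ih].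
  by rewrite (_ : (fun K => _) = cst 0); [exact: cvg_cst|apply: funext => K; rewrite big_nil].
rewrite (_ : (fun K => _) = F i \+ (fun K => \sum_(i <- s) F i K)); last first.
  by apply: funext => K; rewrite big_cons.
by rewrite -[X in _ --> X]addr0; exact: cvgD.
Qed.

Lemma tail_sum (R : realType) (a : nat -> R) (S eps : R) : (forall n, 0 <= a n) ->
  (forall K, \sum_(n <- index_iota 0 K) a n <= S) ->
  0 < eps -> exists K0, forall K L, (K0 <= K)%N -> (K <= L)%N ->
  \sum_(n <- index_iota K L) a n <= eps.
Proof.
move=> a0 aS eps0; pose u K := \sum_(n <- index_iota 0 K) a n.
have umono : {homo u : m n / (m <= n)%N >-> m <= n}.
  by move=> m n; exact: (exhaustion_sum_mono exhaustion_iota a0).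
have ucv : cvgn u.
  by apply: nondecreasing_is_cvgn => //; exists S => _ [K _ <-]; exact: aS.
have e20 : 0 < eps / 2 by rewrite divr_gt0.
have /cvgrPdist_lt/(_ _ e20) [K0 _ hK] := ucv.
exists K0 => K L K0K KL; have -> : \sum_(n <- index_iota K L) a n = u L - u K.
  by rewrite /u (@big_cat_nat _ _ _ K 0 L) //= addrAC subrr add0r.
have := hK _ K0K; have := hK _ (leq_trans K0K KL); rewrite /=.
by rewrite !ltr_norml => /andP[h1 h2] /andP[h3 h4]; lra.
Qed.

Lemma cauchy_is_cvgn (R : realType) (u : nat -> R) :
  (forall eps : R, 0 < eps -> exists K, forall n, (K <= n)%N -> `|u K - u n| < eps) -> cvgn u.
Proof.
move=> cau; apply/cauchy_cvgP; apply: cauchy_exP => eps eps0.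
have [K hK] := cau _ eps0; exists (u K); exists K => // n Kn; exact: hK.
Qed.

Lemma liminf_eq0_frequently (R : realType) (h : nat -> \bar R) :
  (forall n, (0 <= h n)%E) -> limn_einf h = 0%E ->
  forall (eps : R) K0, 0 < eps -> exists2 N, (K0 <= N)%N & (h N <= eps%:E)%E.
Proof.
move=> h0 hl eps K0 eps0; apply: contrapT => /forall2NP hN.
have : (eps%:E <= limn_einf h)%E.
  rewrite limn_einf_lim; apply: lime_ge; first exact: is_cvg_einfs.
  exists K0 => // n K0n; apply: le_ereal_inf_tmp => _ [k nk <-].
  have [|/negP] := hN k; first by rewrite (leq_trans K0n nk).
  by rewrite -ltNge => /ltW.
by rewrite hl lee_fin leNgt eps0.
Qed.

Section RenormalisedDensity.
Context (R : realType).
Local Notation C := R[i].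
Local Notation T := (measurableTypeR R).
Local Notation V := (T -> R[i]^o).
Local Notation W := (T * T -> R[i]^o).
Local Notation tm := (@torus_measure R).
Local Notation tm2 := (@torus2_measure R).
Local Notation L1 := (cLp tm 1%:E).
Local Notation L2 := (cLp tm 2%:E : V -> Prop).
Local Notation LL2 := (cLp tm2 2%:E : W -> Prop).
Local Notation ip := (@inner R : V -> V -> C).
Local Notation ip2 := (cinner tm2 : W -> W -> C).
Local Notation e := (@fourier_basis R : int -> V).
Local Notation hnorm := (hilbert_norm ip).
Local Notation svd := (hsvd L2 ip).
Local Notation H := (hilbert_torus R).
Local Notation H2 := (hilbert_L2 tm2).
Local Notation one := (orthonormal_fourier_basis R).
Local Notation tot := (total_fourier_basis (R := R)).
Local Notation es := exhaustion_sym_range.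
Local Notation phase t n := (expi (- t * n%:~R ^+ 2)).
Implicit Types (A B : V -> V) (f g h : V) (F G : T -> C) (r X : R) (s : nat -> R).

Let Le := @L2_fourier_basis R.

Lemma L2_normc f : L2 f -> L2 (fun x => (normc (f x))%:C).
Proof.
move=> /L2P[mf ff]; apply/L2P; split.
  by split; [exact: cmeasurable_normc | exact: measurable_cst].
rewrite /sqint; under eq_integral do rewrite normc_realc real_normK ?num_real //.
exact: ff.
Qed.

Lemma hnorm_normc f : L2 f -> hnorm (fun x => (normc (f x))%:C) = hnorm f.
Proof.
move=> Lf; rewrite /hilbert_norm /hnsq; congr Num.sqrt; apply/EFin_inj.
have e1 := cinner_nsq Lf; have e2 := cinner_nsq (L2_normc Lf).
rewrite -[LHS]/(Re (cinner tm (fun x => (normc (f x))%:C) (fun x => (normc (f x))%:C)))%:E.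
rewrite -[RHS]/(Re (cinner tm f f))%:E e1 e2.
by apply: eq_integral => x _; rewrite normc_realc real_normK ?num_real.
Qed.

(** Cauchy-Schwarz is applied to the moduli of [f] and [g], since for [f] and [g] themselves it
    would only bound the modulus of an integral. *)
Lemma absint_mul_conj f g : L2 f -> L2 g ->
  (absint tm (fun x => (f x * (g x)^*)%R) <= (hnorm f * hnorm g)%:E)%E.
Proof.
move=> Lf Lg; have Lf' := L2_normc Lf; have Lg' := L2_normc Lg.
have := hnorm_cauchy_schwarz H Lf' Lg'; rewrite !hnorm_normc // => cs.
have iR := integrable_fin_num measurableT (L1_integrable_Re (L1M Lf' Lg')).
have -> : absint tm (fun x => f x * (g x)^*) =
    (Re (cinner tm (fun x => (normc (f x))%:C) (fun x => (normc (g x))%:C)))%:E.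
  rewrite /cinner /cintegral /= /Rintegral fineK //.
  by apply: eq_integral => x _; rewrite /= normcMl normc_conj oppr0 mul0r subr0.
by rewrite lee_fin; apply: le_trans (ler_Re_normc _) _; exact: cs.
Qed.

Lemma absint_triangle (f g h : T -> C) : cmeasurable f -> cmeasurable g -> cmeasurable h ->
  (absint tm (fun x => (f x - h x)%R) <=
   absint tm (fun x => (f x - g x)%R) + absint tm (fun x => (g x - h x)%R))%E.
Proof.
move=> mf mg mh.
have := absintD tm (cmeasurableB mf mg) (cmeasurableB mg mh).
by under [X in (absint _ X <= _)%E -> _]eq_fun do rewrite addrA subrK.
Qed.

Lemma absint_subC (f g : T -> C) :
  absint tm (fun x => f x - g x) = absint tm (fun x => g x - f x).
Proof. by apply: eq_integral => x _; rewrite normc_subC. Qed.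

Lemma absint_sum_le (I : eqType) (s : seq I) (F : I -> T -> C) (r : I -> R) :
  (forall i, cmeasurable (F i)) ->
  (forall i, (absint tm (F i) <= (r i)%:E)%E) ->
  (absint tm (fun x => (\sum_(i <- s) F i x)%R) <= (\sum_(i <- s) r i)%:E)%E.
Proof.
move=> mF hF; elim: s => [|i s ih].
  rewrite big_nil /absint; under eq_integral do rewrite big_nil Normc.normc0.
  by rewrite integral0.
rewrite big_cons EFinD; under [X in (absint _ X <= _)%E]eq_fun do rewrite big_cons.
apply: le_trans (absintD tm (mF i) (cmeasurable_sum s mF)) _.
exact: leeD.
Qed.

Definition projection N f : V := lincomb e (fun i => ip (e i) f) (sym_range N).

Lemma projection_in N f : L2 (projection N f).
Proof. exact: (lincomb_in H). Qed.

Lemma projection_cvg f : L2 f -> (fun N => hnorm (f - projection N f)) @ \oo --> (0 : R).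
Proof. by move=> Lf; exact: (total_expansion H one es Lf tot). Qed.

Lemma hnorm_projection N f : L2 f -> hnorm (projection N f) <= hnorm f.
Proof.
move=> Lf; rewrite ler_wsqrtr //; have [us _ _] := es.
rewrite (nsq_lincomb H one) //.
by apply: (bessel H one) => //; exact/allP.
Qed.

Lemma cmeas f : L2 f -> cmeasurable f. Proof. by case. Qed.

Lemma cmeas_mul_conj f g : L2 f -> L2 g -> cmeasurable (fun x => f x * (g x)^*).
Proof.
move=> /cmeas mf /cmeas mg; apply: cmeasurableM => //; exact: cmeasurable_conj.
Qed.

(** The density of [P_N A P_N], with [P_N] the map [projection N]. It is expressed by matrix entries
    alone, so it refers to no decomposition of [A]. *)
Definition truncated_density A N : T -> C :=
  fun x => \sum_(p <- box N) matrix_coef A p * (e p.1 x * (e p.2 x)^*).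

Lemma cmeas_truncated_density A N : cmeasurable (truncated_density A N).
Proof.
apply: cmeasurable_sum => p; apply: cmeasurableM; first exact: cmeasurable_cst.
exact: cmeas_mul_conj.
Qed.

Section Approximation.
Variables (A : V -> V) (a : nat -> R) (phi psi : nat -> V) (S : R).
Hypotheses (sA : svd A a phi psi) (aS : forall K, \sum_(n <- index_iota 0 K) a n <= S).

Let a0 := svd_ge0 sA.
Let Lphi n : L2 (phi n). Proof. exact: (svd_onl sA).1. Qed.
Let Lpsi n : L2 (psi n). Proof. exact: (svd_onr sA).1. Qed.

Definition partial_density K : T -> C :=
  fun x => \sum_(n <- index_iota 0 K) (a n)%:C * (phi n x * (psi n x)^*).

Lemma cmeas_partial_density K : cmeasurable (partial_density K).
Proof.
apply: cmeasurable_sum => n; apply: cmeasurableM; first exact: cmeasurable_cst.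
exact: cmeas_mul_conj.
Qed.

Let hphi n : a n != 0 -> hnorm (phi n) = 1.
Proof. by move=> an; rewrite /hilbert_norm /hnsq (svd_onl sA).2 // eqxx sqrtr1. Qed.

Let hpsi n : a n != 0 -> hnorm (psi n) = 1.
Proof. by move=> an; rewrite /hilbert_norm /hnsq (svd_onr sA).2 // eqxx sqrtr1. Qed.

Lemma term_bound n f g : L2 f -> L2 g ->
  (absint tm (fun x => ((a n)%:C * (f x * (g x)^*))%R) <= (a n * (hnorm f * hnorm g))%:E)%E.
Proof.
move=> Lf Lg; rewrite absintZ; last exact: cmeas_mul_conj.
rewrite normc_realc ger0_norm // EFinM lee_wpmul2l ?lee_fin //.
exact: absint_mul_conj.
Qed.

Lemma partial_density_dist K L : (K <= L)%N ->
  (absint tm (fun x => (partial_density L x - partial_density K x)%R) <=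
   (\sum_(n <- index_iota K L) a n)%:E)%E.
Proof.
move=> KL; rewrite (_ : (fun x => _) =
    fun x => \sum_(n <- index_iota K L) (a n)%:C * (phi n x * (psi n x)^*)); last first.
  apply: funext => x; rewrite /partial_density (@big_cat_nat _ _ _ K 0 L) //=.
  by rewrite addrAC subrr add0r.
apply: absint_sum_le => n.
  by apply: cmeasurableM; [exact: cmeasurable_cst|exact: cmeas_mul_conj].
apply: le_trans (term_bound n (Lphi n) (Lpsi n)) _; rewrite lee_fin.
by have [an|/negPn/eqP ->] := boolP (a n != 0); rewrite ?mul0r // hphi // hpsi // !mulr1.
Qed.

Let d n N := hnorm (phi n - projection N (phi n)) + hnorm (psi n - projection N (psi n)).

Let d_ge0 n N : 0 <= d n N. Proof. by rewrite addr_ge0 // ge0_hnorm. Qed.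

Let d_cvg n : d n @ \oo --> (0 : R).
Proof. by rewrite -[X in _ --> X]addr0; apply: cvgD; exact: projection_cvg. Qed.

Let d_le n N : a n != 0 -> d n N <= 4.
Proof.
move=> an; have h f : L2 f -> hnorm f = 1 -> hnorm (f - projection N f) <= 2.
  move=> Lf f1; have LP := projection_in N f.
  have := ler_hnormD H Lf (hilbertN H LP); rewrite (hnormN H) //.
  by have := hnorm_projection N Lf; rewrite f1; lra.
apply: le_trans (lerD (h _ (Lphi n) (hphi an)) (h _ (Lpsi n) (hpsi an))) _.
by rewrite -natrD.
Qed.

(** The density of [P_N A_K P_N], where [A_K] is the sum of the first [K] terms of the
    decomposition: the link between [partial_density] and [truncated_density]. *)
Definition projected_density N K : T -> C := fun x => \sum_(n <- index_iota 0 K)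
  (a n)%:C * (projection N (phi n) x * (projection N (psi n) x)^*).

Lemma cmeas_projected_density N K : cmeasurable (projected_density N K).
Proof.
apply: cmeasurable_sum => n; apply: cmeasurableM; first exact: cmeasurable_cst.
by apply: cmeas_mul_conj; exact: projection_in.
Qed.

Lemma partial_projected_dist N K :
  (absint tm (fun x => (partial_density K x - projected_density N K x)%R) <=
   (\sum_(n <- index_iota 0 K) a n * d n N)%:E)%E.
Proof.
have LB f : L2 f -> L2 (f - projection N f).
  by move=> Lf; apply: (hilbertB H) => //; exact: projection_in.
(* The two factors of each product are replaced one at a time. *)
rewrite (_ : (fun x => _) = fun x => \sum_(n <- index_iota 0 K)
   ((a n)%:C * ((phi n - projection N (phi n)) x * (psi n x)^*) +
    (a n)%:C * (projection N (phi n) x * ((psi n - projection N (psi n)) x)^*))); last first.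
  apply: funext => x; rewrite /partial_density /projected_density -sumrB.
  apply: eq_bigr => n _; rewrite -mulrBr -mulrDr; congr (_ * _).
  rewrite !fctE rmorphB /=; ring.
have LP := projection_in N.
apply: absint_sum_le => n.
  apply: cmeasurableD; apply: cmeasurableM; try exact: cmeasurable_cst.
    by apply: cmeas_mul_conj => //; exact: LB.
  by apply: cmeas_mul_conj => //; exact: LB.
have t1 := term_bound n (LB _ (Lphi n)) (Lpsi n).
have t2 := term_bound n (LP (phi n)) (LB _ (Lpsi n)).
have := absintD tm
  (cmeasurableM (cmeasurable_cst _ (a n)%:C) (cmeas_mul_conj (LB _ (Lphi n)) (Lpsi n)))
  (cmeasurableM (cmeasurable_cst _ (a n)%:C) (cmeas_mul_conj (LP (phi n)) (LB _ (Lpsi n)))).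
move=> /le_trans; apply; apply: le_trans (leeD t1 t2) _; rewrite -EFinD lee_fin.
have [an|/negPn/eqP ->] := boolP (a n != 0); last by rewrite !mul0r addr0.
rewrite -mulrDr ler_wpM2l // /d hpsi // mulr1 lerD2l.
by rewrite ler_piMl ?ge0_hnorm // -(hphi an); exact: hnorm_projection.
Qed.

(** For fixed [N] only finitely many matrix entries occur, and each entry of the partial sums of the
    decomposition converges to that of [A]. *)
Lemma projected_truncated_cvg N (eps : R) : 0 < eps -> exists K0, forall K, (K0 <= K)%N ->
  (absint tm (fun x => (projected_density N K x - truncated_density A N x)%R) <= eps%:E)%E.
Proof.
move=> eps0.
pose c (p : int * int) K := \sum_(n <- index_iota 0 K)
  (a n)%:C * ip (psi n) (e p.2) * ip (e p.1) (phi n).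
have cc p : ccvg (c p) (matrix_coef A p) by exact: (svd_ipr H sA).
have cv : (fun K => \sum_(p <- box N) normc (matrix_coef A p - c p K)) @ \oo --> (0 : R).
  by apply: cvg_sum0 => p; exact: cc.
have /cvgrPdist_le/(_ _ eps0) [K0 _ hK] := cv.
exists K0 => K K0K.
rewrite (_ : (fun x => _) = fun x => \sum_(p <- box N)
   (c p K - matrix_coef A p) * (e p.1 x * (e p.2 x)^*)); last first.
  apply: funext => x; rewrite /projected_density /truncated_density.
  under [RHS]eq_bigr do rewrite mulrBl; rewrite sumrB; congr (_ - _).
  rewrite /c; under [RHS]eq_bigr do rewrite mulr_suml; rewrite exchange_big /=.
  apply: eq_bigr => n _; rewrite /projection !lincomb_fctE conjc_sum /box big_allpairs /=.
  rewrite mulr_suml mulr_sumr; apply: eq_bigr => j _.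
  rewrite !mulr_sumr; apply: eq_bigr => k _.
  by rewrite conjcM -(ip_conj H); ring.
apply: le_trans (absint_sum_le _ (r := fun p => normc (matrix_coef A p - c p K)) _ _) _.
- move=> p; apply: cmeasurableM; first exact: cmeasurable_cst.
  exact: cmeas_mul_conj.
- move=> p; rewrite absintZ; last exact: cmeas_mul_conj.
  rewrite normc_subC -[leRHS]mule1 lee_wpmul2l ?lee_fin ?ge0_normc //.
  apply: le_trans (absint_mul_conj (Le _) (Le _)) _.
  have h1 i : hnorm (e i) = 1 by rewrite /hilbert_norm /hnsq one.2 // eqxx sqrtr1.
  by rewrite !h1 mulr1.
rewrite lee_fin; have := hK _ K0K; rewrite /= sub0r normrN.
by apply: le_trans; exact: ler_norm.
Qed.

(** The bound is uniform in [K]: a finite head tends to 0 with the projection errors, and the tail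
    is small by summability of [a]. *)
Lemma weighted_error (eps : R) : 0 < eps -> exists N0, forall N K, (N0 <= N)%N ->
  \sum_(n <- index_iota 0 K) a n * d n N <= eps.
Proof.
(* The errors [d n N] are at most 4 where [a n != 0], so a tail of mass [eps / 8] contributes at
   most [eps / 2]. *)
move=> eps0; have [K1 hK1] := tail_sum a0 aS (divr_gt0 eps0 (ltr0n R 8)).
have cv : (fun N => \sum_(n <- index_iota 0 K1) a n * d n N) @ \oo --> (0 : R).
  apply: cvg_sum0 => n; rewrite -[X in _ --> X](mulr0 (a n)); apply: cvgMl_tmp.
  exact: d_cvg.
have e20 : 0 < eps / 2 by rewrite divr_gt0.
have /cvgrPdist_le/(_ _ e20) [N0 _ hN] := cv.
exists N0 => N K N0N.
have := hN _ N0N; rewrite /= sub0r normrN => /(le_trans (ler_norm _)) h1.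
have t0 n : 0 <= a n * d n N by rewrite mulr_ge0.
have [KK1|/ltnW KK1] := leqP K K1.
  have := exhaustion_sum_mono exhaustion_iota t0 KK1; lra.
rewrite (@big_cat_nat _ _ _ K1 0 K) //=.
have : \sum_(K1 <= n < K) a n * d n N <= 4 * \sum_(K1 <= n < K) a n.
  rewrite mulr_sumr; apply: ler_sum => n _.
  have [an|/negPn/eqP ->] := boolP (a n != 0); last by rewrite !mul0r mulr0.
  by rewrite mulrC ler_wpM2r // d_le.
have := hK1 _ _ (leqnn _) KK1; lra.
Qed.

(** [K] and [N] are independent. The comparison passes through a length [L], at least [K] and chosen
    after [N]: from [K] to [L] terms by the tail of [a], then to the projected terms uniformly in
    [L], then to the truncation for this fixed [N]. *)
Lemma partial_truncated (eps : R) : 0 < eps -> exists K0, forall K N, (K0 <= K)%N ->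
  (K0 <= N)%N ->
  (absint tm (fun x => (partial_density K x - truncated_density A N x)%R) <= eps%:E)%E.
Proof.
move=> eps0; have e30 : 0 < eps / 3 by rewrite divr_gt0.
have [K0 hK0] := tail_sum a0 aS e30; have [N0 hN0] := weighted_error e30.
exists (maxn K0 N0) => K N; rewrite !geq_max => /andP[K0K _] /andP[_ N0N].
have [L0 hL0] := projected_truncated_cvg N e30.
pose L := maxn K L0; have KL : (K <= L)%N by exact: leq_maxl.
have mp := cmeas_partial_density; have mt := cmeas_truncated_density A N.
have mq := cmeas_projected_density N L.
apply: le_trans (absint_triangle (mp K) (mp L) mt) _.
have b1 : (absint tm (fun x => (partial_density K x - partial_density L x)%R) <= (eps / 3)%:E)%E.
  rewrite absint_subC; apply: le_trans (partial_density_dist KL) _.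
  by rewrite lee_fin; exact: hK0.
have b2 : (absint tm (fun x => (partial_density L x - projected_density N L x)%R)
    <= (eps / 3)%:E)%E.
  by apply: le_trans (partial_projected_dist N L) _; rewrite lee_fin; exact: hN0.
have b3 := hL0 L (leq_maxr _ _).
have := leeD b1 (le_trans (absint_triangle (mp L) mq mt) (leeD b2 b3)).
move=> /le_trans; apply; rewrite -!EFinD lee_fin; lra.
Qed.

End Approximation.

Lemma absint_eq0 F G : cmeasurable F -> cmeasurable G ->
  (forall eps : R, 0 < eps -> (absint tm (fun x => (F x - G x)%R) <= eps%:E)%E) ->
  ceq_ae tm F G.
Proof.
move=> mF mG h.
have mN : measurable_fun setT (fun x => (normc (F x - G x))%:E).
  by apply/measurable_EFinP/cmeasurable_normc; exact: cmeasurableB.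
have : (\int[tm]_x `|(normc (F x - G x))%:E| = 0)%E.
  apply/eqP; rewrite eq_le integral_ge0 // andbT; apply/lee_addgt0Pr => eps eps0.
  rewrite add0e; apply: le_trans (h _ eps0); rewrite le_eqVlt; apply/orP; left; apply/eqP.
  by apply: eq_integral => x _; rewrite gee0_abs // lee_fin ge0_normc.
move/(ae_eq_integral_abs tm measurableT mN); apply: filterS => x /(_ Logic.I) /= /eqP.
by rewrite eqe normc_eq0 subr_eq0 => /eqP.
Qed.

(** Real and imaginary parts are bounded separately, whence the factor 2. *)
Lemma normc_cintegral_le F : L1 F ->
  (((normc (cintegral tm F)))%:E <= absint tm F + absint tm F)%E.
Proof.
move=> LF; have iR := L1_integrable_Re LF; have iI := L1_integrable_Im LF.
have [mF _] := LF; have mN := cmeasurable_normc mF; have [mR mI] := mF.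
apply: (@le_trans _ _ (`|Re (cintegral tm F)|%:E + `|Im (cintegral tm F)|%:E)%E).
  by rewrite -EFinD lee_fin ler_normc_ReIm.
apply: leeD; rewrite /cintegral /= /Rintegral -abse_EFin fineK ?integrable_fin_num //.
  apply: le_trans (le_abse_integral _ _ _) _ => //; first exact/measurable_EFinP.
  apply: ge0_le_integral => //; try exact/measurable_EFinP.
    by apply/measurable_EFinP/measurableT_comp.
  by move=> x _; rewrite lee_fin ler_normRe_normc.
apply: le_trans (le_abse_integral _ _ _) _ => //; first exact/measurable_EFinP.
apply: ge0_le_integral => //; try exact/measurable_EFinP.
  by apply/measurable_EFinP/measurableT_comp.
by move=> x _; rewrite lee_fin ler_normIm_normc.
Qed.

Lemma absint_cst (c : C) : absint tm (fun=> c) = (normc c * (2 * pi))%:E.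
Proof.
by rewrite /absint integral_cst // EFinM; congr (_ * _)%E; exact: torus_measureT.
Qed.

Definition partial_trace A N : C := \sum_(n <- sym_range N) matrix_coef A (n, n).

Lemma L1_mul_conj f g : L2 f -> L2 g -> L1 (fun x => f x * (g x)^*).
Proof.
move=> Lf Lg; apply/L1P; split; first exact: cmeas_mul_conj.
by apply: le_lt_trans (absint_mul_conj Lf Lg) _; rewrite ltry.
Qed.

Lemma L1_truncated_density A N : L1 (truncated_density A N).
Proof. by apply: L1_sum => p; apply: L1Z; exact: L1_mul_conj. Qed.

(** This makes convergence of the symmetric partial traces a consequence of the [L^1] convergence of
    the truncated densities. *)
Lemma cintegral_truncated_density A N :
  cintegral tm (truncated_density A N) = partial_trace A N.
Proof.
rewrite /truncated_density cintegral_sum; last first.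
  by move=> p; apply: L1Z; exact: L1_mul_conj.
rewrite /box big_allpairs /partial_trace.
have [us _ _] := exhaustion_sym_range.
rewrite !big_seq; apply: eq_bigr => j jN.
rewrite (bigD1_seq j) // [X in _ + X = _]big1 ?addr0 => [|k kj];
  rewrite cintegralZ; try exact: L1_mul_conj.
  rewrite (_ : cintegral _ _ = 1) ?mulr1 //.
  rewrite -[RHS](_ : ip (e j) (e j) = 1); last by rewrite one.2 // eqxx.
  by congr cintegral; apply: funext => x; rewrite mulrC.
rewrite (_ : cintegral _ _ = 0) ?mulr0 //.
rewrite -[RHS](_ : ip (e k) (e j) = 0); last by rewrite one.2 // (negbTE kj).
by congr cintegral; apply: funext => x; rewrite mulrC.
Qed.

Section TraceClass.
Variables (A : V -> V) (a : nat -> R) (phi psi : nat -> V) (S : R).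
Hypotheses (sA : svd A a phi psi) (aS : forall K, \sum_(n <- index_iota 0 K) a n <= S).

(** [trace] is defined through [limn], which says nothing until the sequence is known to converge;
    the partial traces are Cauchy as integrals of an [L^1] Cauchy sequence. *)
Lemma partial_trace_cvg : ccvg (partial_trace A) (trace A).
Proof.
have cau (eps : R) : 0 < eps -> exists K, forall n, (K <= n)%N ->
    normc (partial_trace A K - partial_trace A n) < eps.
  (* Two comparisons with the same partial density cost [eps / 4], and [normc_cintegral_le] doubles
     this. *)
  move=> eps0; have e8 : 0 < eps / 8 by rewrite divr_gt0.
  have [K hK] := partial_truncated sA aS e8; exists K => n Kn.
  have mt := cmeas_truncated_density A; have mp := cmeas_partial_density sA K.
  have LB : L1 (fun x => truncated_density A K x - truncated_density A n x).
    have := L1D (L1_truncated_density A K) (L1Z (-1) (L1_truncated_density A n)).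
    by under [X in cLp _ _ X -> _]eq_fun do rewrite mulN1r.
  have ab : (absint tm (fun x => (truncated_density A K x - truncated_density A n x)%R) <=
      (eps / 8)%:E + (eps / 8)%:E)%E.
    apply: le_trans (absint_triangle (mt K) mp (mt n)) _; apply: leeD; last exact: hK.
    by rewrite absint_subC; exact: hK.
  have := le_trans (normc_cintegral_le LB) (leeD ab ab).
  rewrite -!EFinD lee_fin => h.
  have -> : partial_trace A K - partial_trace A n =
      cintegral tm (fun x => truncated_density A K x - truncated_density A n x).
    rewrite -!cintegral_truncated_density.
    rewrite -[X in _ + X]mulN1r -cintegralZ; last exact: L1_truncated_density.
    rewrite -cintegralD; [|exact: L1_truncated_density|exact/L1Z/L1_truncated_density].
    by under eq_fun do rewrite mulN1r.
  by apply: le_lt_trans h _; lra.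
have cvR : cvgn (fun N => Re (partial_trace A N)).
  apply: cauchy_is_cvgn => eps /cau[K hK]; exists K => n /hK; apply: le_lt_trans.
  by rewrite -ReNl -ReDl ler_normRe_normc.
have cvI : cvgn (fun N => Im (partial_trace A N)).
  apply: cauchy_is_cvgn => eps /cau[K hK]; exists K => n /hK; apply: le_lt_trans.
  by rewrite -ImNl -ImDl ler_normIm_normc.
have -> : trace A = 
    Complex (limn (fun N => Re (partial_trace A N))) (limn (fun N => Im (partial_trace A N))).
  rewrite /trace; congr Complex; congr (lim (_ @ \oo)); apply: funext => N;
  by rewrite symsumE.
have dist0 (u : nat -> R) : cvgn u -> (fun N => `|limn u - u N|) @ \oo --> (0 : R).
  move=> cu; apply/cvgrPdist_le => eps eps0; have /cvgrPdist_le/(_ _ eps0) := cu.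
  by apply: filterS => N; rewrite sub0r normrN normr_id.
set lR := limn _; set lI := limn _.
have : (fun N => `|lR - Re (partial_trace A N)| + `|lI - Im (partial_trace A N)|) @ \oo --> (0 : R).
  rewrite -[X in _ --> X]addr0; apply: cvgD.
    exact: dist0 cvR.
  exact: dist0 cvI.
apply: ccvg_le => N; apply: le_trans (ler_normc_ReIm _) _.
by rewrite ReDl ImDl ReNl ImNl.
Qed.

(** The hypothesis asks for closeness only at arbitrarily large [N], since Fatou provides no more
    than a subsequence; [partial_truncated] restores convergence along the whole sequence in [K]. *)
Lemma partial_density_cvg F : cmeasurable F ->
  (forall (eps : R) K0, 0 < eps -> exists2 N, (K0 <= N)%N &
     (absint tm (fun x => (F x - truncated_density A N x)%R) <= eps%:E)%E) ->
  forall eps : R, 0 < eps -> exists K0, forall K, (K0 <= K)%N ->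
    (absint tm (fun x => (F x - partial_density a phi psi K x)%R) <= eps%:E)%E.
Proof.
move=> mF hF eps eps0; have e2 : 0 < eps / 2 by rewrite divr_gt0.
have [K0 hK] := partial_truncated sA aS e2; exists K0 => K K0K.
have [N K0N hN] := hF _ K0 e2; have mt := cmeas_truncated_density A N.
have mp := cmeas_partial_density sA K.
apply: le_trans (absint_triangle mF mt mp) _; rewrite [in leRHS](splitr eps) EFinD.
by apply: leeD => //; rewrite absint_subC; exact: hK.
Qed.

End TraceClass.

Lemma partial_densityE (a : nat -> R) (phi psi : nat -> T -> C) :
  (fun (N : nat) (x : T) => \sum_(n < N) (a n)%:C * phi n x * (psi n x)^*) =
  partial_density a phi psi.
Proof.
apply: funext => N; apply: funext => x; rewrite /partial_density big_mkord.
by apply: eq_bigr => n _; rewrite mulrA.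
Qed.

Section TraceClassUniqueness.
Variables (A : V -> V) (a : nat -> R) (phi psi : nat -> V) (S : R).
Hypotheses (sA : svd A a phi psi) (aS : forall K, \sum_(n <- index_iota 0 K) a n <= S).

(** The decomposition and the limit chosen by [density A] may differ from those at hand. Both
    decompositions lead to the same truncated densities, so the chosen limit coincides with [F]; [F]
    itself shows that there is something to choose. *)
Lemma density_ae F : L1 F ->
  (forall (eps : R) K0, 0 < eps -> exists2 N, (K0 <= N)%N &
     (absint tm (fun x => (F x - truncated_density A N x)%R) <= eps%:E)%E) ->
  ceq_ae tm F (density A).
Proof.
move=> LF hF; have [mF _] := LF.
have : [set rho | exists (a : nat -> R) (phi psi : nat -> T -> C),
       is_svd A a phi psi /\
       cvgLp tm 1%:E
         (fun (N : nat) x => \sum_(n < N) (a n)%:C * phi n x * (psi n x)^*) rho] (density A).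
  apply: xgetPex; exists F, a, phi, psi; split; first exact/is_svdP.
  suff : cvgLp tm 1%:E (partial_density a phi psi) F by rewrite -partial_densityE.
  split=> //.
  have cv := partial_density_cvg sA aS mF hF.
  apply/fine_cvgP; split.
    have [K0 hK] := cv 1 ltr01; exists K0 => // K /hK; rewrite cLnorm1E => le1.
    by rewrite ge0_fin_numE ?ge0_absint // (le_lt_trans le1) // ltry.
  apply/cvgrPdist_le => eps eps0; have [K0 hK] := cv _ eps0; exists K0 => // K /hK.
  rewrite /= cLnorm1E sub0r normrN => le1.
  rewrite ger0_norm ?fine_ge0 ?ge0_absint // -lee_fin fineK //.
  by rewrite ge0_fin_numE ?ge0_absint // (le_lt_trans le1) // ltry.
move=> [a' [phi' [psi' [/is_svdP sA' cD']]]].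
have [[mD _] cD] : cvgLp tm 1%:E (partial_density a' phi' psi') (density A).
  by rewrite -partial_densityE.
(* Summability of the chosen coefficients is not part of the choice; it comes from [svd_sum_le]. *)
have a'S K : \sum_(n <- index_iota 0 K) a' n <= S.
  rewrite -lee_fin; apply: le_trans (esum_exhaustion_ge a' exhaustion_iota K) _.
  apply: le_trans (svd_sum_le (hilbert_torus R) sA sA') _.
  by apply: (esum_exhaustion_le exhaustion_iota) => [n|L]; [exact: svd_ge0 sA n|rewrite lee_fin aS].
have cv := partial_density_cvg sA' a'S mF hF.
apply: absint_eq0 => // eps eps0; have e2 : 0 < eps / 2 by rewrite divr_gt0.
have [K0 hK] := cv _ e2.
have /fine_cvgP[[K1 _ fK] /cvgrPdist_le/(_ _ e2)[K2 _ hK2]] := cD.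
pose K := maxn K0 (maxn K1 K2).
have K0K : (K0 <= K)%N by exact: leq_maxl.
have K1K : (K1 <= K)%N by rewrite (leq_trans (leq_maxl K1 K2)) // leq_maxr.
have K2K : (K2 <= K)%N by rewrite (leq_trans (leq_maxr K1 K2)) // leq_maxr.
have mp := cmeas_partial_density sA' K.
apply: le_trans (absint_triangle mF mp mD) _; rewrite [in leRHS](splitr eps) EFinD.
apply: leeD; first exact: hK.
rewrite absint_subC -cLnorm1E -(fineK (fK _ K1K)) lee_fin.
by have := hK2 _ K2K; rewrite /= sub0r normrN; apply: le_trans; exact: ler_norm.
Qed.

(** The constant [c] is added back to apply [density_ae]. A constant has [L^1] norm [2 pi] times its
    modulus, so the error made by using partial traces is exactly their distance to the trace. *)
Lemma rdensity_ae G : L1 G ->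
  (forall (eps : R) K0, 0 < eps -> exists2 N, (K0 <= N)%N &
     (absint tm (fun x => (G x - (truncated_density A N x -
        ((2 * pi)^-1)%:C * partial_trace A N))%R) <= eps%:E)%E) ->
  ceq_ae tm G (rdensity A).
Proof.
move=> LG hG; have [mG _] := LG; have pi0 : 0 < 2 * pi :> R by rewrite mulr_gt0 // pi_gt0.
pose c := ((2 * pi)^-1)%:C * trace A.
have LF : L1 (fun x => G x + c) by apply: L1D => //; exact/L2_L1/L2_const_lty.
suff : ceq_ae tm (fun x => G x + c) (density A).
  by apply: filterS => x; rewrite /rdensity => <-; rewrite addrK.
apply: density_ae => // eps K0 eps0; have e2 : 0 < eps / 2 by rewrite divr_gt0.
have /cvgrPdist_le/(_ _ e2)[K1 _ hK1] := partial_trace_cvg sA aS.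
have [N] := hG _ (maxn K0 K1) e2; rewrite geq_max => /andP[K0N K1N] hN; exists N => //.
have := absintD tm (cmeasurableB mG (cmeasurableB (cmeas_truncated_density A N)
   (cmeasurable_cst _ (((2 * pi)^-1)%:C * partial_trace A N))))
   (cmeasurable_cst _ (c - ((2 * pi)^-1)%:C * partial_trace A N)).
rewrite (_ : (fun x => _ + _) = fun x => G x + c - truncated_density A N x); last first.
  by apply: funext => x; ring.
move=> /le_trans; apply; rewrite [in leRHS](splitr eps) EFinD; apply: leeD => //.
rewrite absint_cst lee_fin -mulrBr normcMl normc_realc ger0_norm ?invr_ge0 ?(ltW pi0) //.
rewrite mulrAC mulVf ?gt_eqF // mul1r.
by have := hK1 _ K1N; rewrite /= sub0r normrN; apply: le_trans; exact: ler_norm.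
Qed.

End TraceClassUniqueness.

(** * The flow of a trace class operator *)

(** The product [e_j e_k^*] carries [(2 pi)^-1], which is already the normalisation of an
    exponential on the two-dimensional torus; no constant is lost. *)
Lemma spacetime_basisE (p : int * int) t x :
  phase t p.1 * (phase t p.2)^* * (e p.1 x * (e p.2 x)^*) = spacetime_basis p (t, x).
Proof.
rewrite /spacetime_basis /fourier_basis /= !conjcM !expi_conj realcJ.
set r := (_^-1)%:C.
transitivity (r * r * (expi (- t * p.1%:~R ^+ 2) * expi (- (- t * p.2%:~R ^+ 2)) *
    (expi (p.1%:~R * x) * expi (- (p.2%:~R * x))))); first by ring.
rewrite -!expiD; transitivity (r * r * (expi ((p.2 * p.2 - p.1 * p.1)%:~R * t) *
  expi ((p.1 - p.2)%:~R * x))); last by ring.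
rewrite -expiD; congr (_ * expi _); rewrite !rmorphB !rmorphM /=; ring.
Qed.

Lemma fourier_basis_diag n x : e n x * (e n x)^* = ((2 * pi)^-1)%:C.
Proof.
have pi0 : 0 < 2 * pi :> R by rewrite mulr_gt0 // pi_gt0.
rewrite mulrC normcJM normcMl normc_expi mulr1 normc_realc ger0_norm ?invr_ge0 ?sqrtr_ge0 //.
by rewrite exprVn sqr_sqrtr // ltW.
Qed.

(** The products [e_n e_n^*] are the constant [1 / (2 pi)], so subtracting the partial trace deletes
    precisely the diagonal terms of the box. *)
Lemma flow_sumE A t N x : bounded_op A ->
  truncated_density (evolved t A) N x - ((2 * pi)^-1)%:C * partial_trace (evolved t A) N =
  flow_sum A N (t, x).
Proof.
move=> /bounded_opP bA; rewrite /flow_sum /lincomb fct_sumE /truncated_density.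
transitivity (\sum_(p <- box N) (if p.1 == p.2 then 0 else
    matrix_coef (evolved t A) p * (e p.1 x * (e p.2 x)^*))); last first.
  apply: eq_bigr => p _; rewrite !fctE /flow_coef.
  case: ifP => _; first by rewrite scale0r.
  rewrite -spacetime_basisE /matrix_coef (evolved_coef t _ _ bA).
  by rewrite -[RHS]/(_ * _); ring.
have -> : ((2 * pi)^-1)%:C * partial_trace (evolved t A) N =
    \sum_(p <- box N) (if p.1 == p.2 then
      matrix_coef (evolved t A) p * (e p.1 x * (e p.2 x)^*) else 0).
  rewrite /box big_allpairs mulr_sumr !big_seq; apply: eq_bigr => j jN.
  have [us _ _] := exhaustion_sym_range.
  rewrite (bigD1_seq j) // [X in _ = _ + X]big1 => [|k kj]; last first.
    by rewrite /= eq_sym (negbTE kj).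
  by rewrite addr0 /= eqxx fourier_basis_diag mulrC.
rewrite -sumrB; apply: eq_bigr => p _; case: ifP => _; first by rewrite subrr.
by rewrite subr0.
Qed.

Lemma absint_le_hnorm f : L2 f ->
  (absint tm f <= (hilbert_norm ip f * hilbert_norm ip (fun=> 1%R))%:E)%E.
Proof.
move=> Lf; have := absint_mul_conj Lf (L2_const_lty 1).
by under [X in (absint _ X <= _)%E -> _]eq_fun do rewrite rmorph1 mulr1.
Qed.

Section Flow.
Variables (A : V -> V) (a : nat -> R) (phi psi : nat -> V) (S M : R).
Hypotheses (bA : bounded_op A) (sA : svd A a phi psi).
Hypothesis (aS : forall K, \sum_(n <- index_iota 0 K) a n <= S).
Hypothesis hs : forall N, \sum_(k <- sym_range N) hnsq ip (A (e k)) <= M.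

(** At fixed [t] the evolved operator has the same coefficients [a], so the bound [S] is available
    for [rdensity_ae]. The null set of times comes from Fatou for the functions [h N], whose
    integrals tend to 0. *)
Lemma trace_class_flow : is_rdensity_flow A (density_flow A).
Proof.
have [LF cF] := density_flowP (svd_in sA) hs; have [mF _] := LF.
split=> //; pose F := density_flow A.
pose h N t := sqint tm (fun x => F (t, x) - flow_sum A N (t, x)).
have mS N : cmeasurable (flow_sum A N) by have [] := flow_sum_in A N.
have mFS N : cmeasurable (fun z => F z - flow_sum A N z) by exact: cmeasurableB.
have mh N : measurable_fun setT (h N) by have [] := sqint_prod tm tm (mFS N).
have h0 N t : (0 <= h N t)%E by exact: ge0_sqint.
have ih : (fun N => \int[tm]_t h N t)%E @ \oo --> 0%E.
  have -> : (fun N => \int[tm]_t h N t)%E =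
      EFin \o (fun N => hilbert_norm ip2 (F - flow_sum A N) ^+ 2).
    apply: funext => N; have [_ <-] := sqint_prod tm tm (mFS N).
    have LB : LL2 (F - flow_sum A N) by apply: (hilbertB H2) => //; exact: flow_sum_in.
    by rewrite /= (hnorm_sqr H2) // -cinner_nsq.
  apply: cvg_EFin; first exact: nearW.
  pose d N := hilbert_norm ip2 (F - flow_sum A N).
  rewrite (_ : _ \o _ = fun N => d N * d N); last by apply: funext => N; rewrite /= expr2.
  by rewrite -[X in _ --> X](mulr0 (0 : R)); exact: cvgM.
have li : (\int[tm]_t limn_einf (h^~ t) = 0)%E.
  apply/eqP; rewrite eq_le; apply/andP; split.
    apply: le_trans (fatou tm measurableT mh (fun N t _ => h0 N t)) _.
    by have [-> _] := cvg_limn_einf_sup ih.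
  apply: integral_ge0 => t _; rewrite limn_einf_lim; apply: lime_ge.
    exact: is_cvg_einfs.
  by apply: nearW => n; apply: le_ereal_inf_tmp => _ [k _ <-].
have l0 t : (0 <= limn_einf (h^~ t))%E.
  rewrite limn_einf_lim; apply: lime_ge; first exact: is_cvg_einfs.
  by apply: nearW => n; apply: le_ereal_inf_tmp => _ [k _ <-].
have : (\int[tm]_t `|limn_einf (h^~ t)| = 0)%E.
  by rewrite -[RHS]li; apply: eq_integral => t _; rewrite gee0_abs.
move/(ae_eq_integral_abs tm measurableT (measurable_fun_limn_einf mh)).
apply: filterS => t /(_ Logic.I) lt0.
have freq := liminf_eq0_frequently (fun N => h0 N t) lt0.
pose G x := F (t, x); pose s N x := flow_sum A N (t, x).
have mG : cmeasurable G by exact: cmeasurable_section.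
have bs := evolved_svd t sA.
have Ls N : L2 (s N).
  rewrite /s; under eq_fun do rewrite /flow_sum /lincomb fct_sumE.
  have := lincomb_in (hilbert_torus R) (fun p => flow_coef A p * e (p.2 * p.2 - p.1 * p.1) t)
    (box N) (fun p => Le (p.1 - p.2)).
  rewrite /lincomb; congr (L2 _); apply: funext => x; rewrite fct_sumE.
  by apply: eq_bigr => p _; rewrite -[LHS]/(_ * _ * _) -mulrA.
have LGs N : (h N t < +oo)%E -> L2 (fun x => G x - s N x).
  by move=> hN; apply/L2P; split => //; apply: cmeasurableB => //; case: (Ls N).
(* A single [N] with [h N t <= 1] suffices: [G] is then an [L^2] error plus a finite sum of
   exponentials. *)
have LG : L2 G.
  have [N _ hN] := freq 1 0%N ltr01.
  have := L2D (LGs N (le_lt_trans hN (ltry _))) (Ls N).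
  by under [X in cLp _ _ X -> _]eq_fun do rewrite subrK.
apply: (rdensity_ae bs aS (L2_L1 LG)) => eps K0 eps0.
(* The norm of 1 is the cost of passing from [L^2] to [L^1]; the added 1 makes [c] positive without
   computing that norm. *)
pose c := hilbert_norm ip (fun=> 1%R) + 1.
have c0 : 0 < c by rewrite ltr_wpDl ?ge0_hnorm.
have ec0 : 0 < (eps / c) ^+ 2 by rewrite exprn_gt0 // divr_gt0.
have [N K0N hN] := freq _ K0 ec0; exists N => //.
have LN := LGs N (le_lt_trans hN (ltry _)).
under [X in (absint _ X <= _)%E]eq_fun do rewrite flow_sumE //.
apply: le_trans (absint_le_hnorm LN) _; rewrite lee_fin.
have hl : hilbert_norm ip (fun x => G x - s N x) <= eps / c.
  rewrite -ler_sqr ?nnegrE ?ge0_hnorm ?divr_ge0 ?(ltW eps0) ?(ltW c0) //.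
  rewrite (hnorm_sqr (hilbert_torus R)) // -lee_fin; apply: le_trans hN.
  by rewrite /hnsq (cinner_nsq LN).
apply: (@le_trans _ _ (eps / c * c)); last by rewrite divfK // gt_eqF.
apply: ler_pM; rewrite ?ge0_hnorm //; rewrite /c; lra.
Qed.

End Flow.

(** * The estimate in Schatten classes *)

(** Each [s n] is at most [Y], the [r]-th root of [X]. Write its square as the product of its powers
    of exponents [r] and [2 - r], and replace [s n] by [Y] in the second factor. *)
Lemma sum_sqr_le_powR s (I : seq nat) r X : 0 < r <= 2 -> (forall n, 0 <= s n) ->
  \sum_(n <- I) s n `^ r <= X -> \sum_(n <- I) s n ^+ 2 <= (X `^ r^-1) ^+ 2.
Proof.
move=> /andP[r0 r2] s0 sX; set Y := X `^ r^-1.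
have X0 : 0 <= X by apply: le_trans sX; apply: sumr_ge0 => n _; exact: powR_ge0.
have sqE (y : R) : 0 <= y -> y ^+ 2 = y `^ r * y `^ (2 - r).
  have r2E : r + (2 - r) = 2 by ring.
  by move=> y0; rewrite -powRD r2E ?pnatr_eq0 // powR_mulrn.
have YX : Y `^ r = X by rewrite -powRrM mulVf ?gt_eqF // powRr1.
have sY n : n \in I -> s n <= Y.
  move=> nI; have -> : s n = (s n `^ r) `^ r^-1 by rewrite -powRrM mulfV ?gt_eqF // powRr1.
  apply: ge0_ler_powR; rewrite ?nnegrE ?invr_ge0 ?(ltW r0) ?powR_ge0 //.
  apply: le_trans sX; rewrite (big_rem n nI) /= lerDl.
  by apply: sumr_ge0 => k _; exact: powR_ge0.
rewrite sqE ?powR_ge0 // YX; apply: le_trans (ler_wpM2r (powR_ge0 _ _) sX).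
rewrite mulr_suml !big_seq; apply: ler_sum => n nI; rewrite sqE //.
rewrite ler_wpM2l ?powR_ge0 // ge0_ler_powR ?subr_ge0 ?nnegrE ?powR_ge0 //; exact: sY.
Qed.

Lemma svd_hs A s (phi psi : nat -> V) r X : 0 < r <= 2 -> svd A s phi psi ->
  (forall K, \sum_(n <- index_iota 0 K) s n `^ r <= X) ->
  forall N, \sum_(k <- sym_range N) hnsq ip (A (e k)) <= (X `^ r^-1) ^+ 2.
Proof.
move=> r02 sA sX N; rewrite -lee_fin.
apply: le_trans (esum_exhaustion_ge (fun k => hnsq ip (A (e k))) es N) _.
rewrite (svd_hilbert_schmidt H one tot es sA).
apply: (esum_exhaustion_le exhaustion_iota) => [n|K]; first by rewrite sqr_ge0.
by rewrite lee_fin sum_sqr_le_powR //; exact: svd_ge0 sA.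
Qed.

(** An infimum below [+oo] provides a power of [|A|] with finite trace. *)
Lemma schatten_svd A r : 0 < r -> schatten r%:E A ->
  exists s (phi psi : nat -> V) X, svd A s phi psi /\
    forall K, \sum_(n <- index_iota 0 K) s n `^ r <= X.
Proof.
move=> r0 [/bounded_opP bA]; rewrite /schatten_norm.
move=> /ereal_inf_lt[_ [P AP <-]] /lty_poweRy.
have [s [phi [psi [sA ->]]]] := abs_power_svd bA AP.
move=> /(_ (lt0r_neq0 (eq_ind_r (fun x => is_true x) r0 (invr_gt0 r)))).
set E := esum _ _ => Efin; have E0 : (0 <= E)%E by apply: esum_ge0 => n _; rewrite lee_fin powR_ge0.
exists s, phi, psi, (fine E); split=> // K.
rewrite -lee_fin fineK ?ge0_fin_numE //.
exact: (esum_exhaustion_ge (fun n => s n `^ r) exhaustion_iota K).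
Qed.

Lemma schatten_hs A r : 0 < r <= 2 -> schatten r%:E A ->
  exists M, forall N, \sum_(k <- sym_range N) hnsq ip (A (e k)) <= M.
Proof.
move=> r02; have /andP[r0 _] := r02; move=> /(schatten_svd r0)[s [phi [psi [X [sA sX]]]]].
by exists ((X `^ r^-1) ^+ 2); exact: svd_hs sA sX.
Qed.

Lemma bounded_in A : bounded_op A -> forall f, L2 f -> L2 (A f).
Proof. by case. Qed.

Lemma density_flow_in A r : 0 < r <= 2 -> schatten r%:E A -> LL2 (density_flow A).
Proof.
move=> r02 SA; have [M hs] := schatten_hs r02 SA.
by have [] := density_flowP (bounded_in SA.1) hs.
Qed.

(** The bound is proved against every value in the infimum, so it does not matter which power of
    [|A|] is used. *)
Lemma density_flow_schatten A r : 0 < r <= 2 -> schatten r%:E A ->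
  (cLnorm tm2 2%:E (density_flow A) <= schatten_norm r%:E A)%E.
Proof.
move=> r02 SA; have /andP[r0 _] := r02; have LT := density_flow_in r02 SA.
have ri0 : r^-1 != 0 by rewrite invr_eq0 gt_eqF.
rewrite (cLnorm2_hnorm LT); apply: le_ereal_inf_tmp => _ [P AP <-].
have bA := (bounded_opP A).1 SA.1.
have [s [phi [psi [sA ->]]]] := abs_power_svd bA AP.
set E := esum _ _; have E0 : (0 <= E)%E by apply: esum_ge0 => n _; rewrite lee_fin powR_ge0.
have [Efin|Einf] := boolP (E \is a fin_num); last first.
  move: Einf; rewrite ge0_fin_numE // -leNgt leye_eq => /eqP ->.
  by rewrite poweRyr // leey.
have sE K : \sum_(n <- index_iota 0 K) s n `^ r <= fine E.
  by rewrite -lee_fin fineK //; exact: (esum_exhaustion_ge (fun n => s n `^ r) exhaustion_iota K).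
rewrite -(fineK Efin) poweR_EFin lee_fin.
rewrite -ler_sqr ?nnegrE ?ge0_hnorm ?powR_ge0 // (hnorm_sqr H2) //.
exact: (density_flow_nsq (bounded_in SA.1) (svd_hs r02 sA sE)).
Qed.

(** The partial sums are exactly linear in the operator; their limits are then linear up to a null
    vector by uniqueness. *)
Lemma density_flow_lin (c : C) A B MA MB :
  (forall f, L2 f -> L2 (A f)) -> (forall f, L2 f -> L2 (B f)) ->
  (forall N, \sum_(k <- sym_range N) hnsq ip (A (e k)) <= MA) ->
  (forall N, \sum_(k <- sym_range N) hnsq ip (B (e k)) <= MB) ->
  ceq_ae tm2 (density_flow (lin_op c A B)) (fun z => c * density_flow A z + density_flow B z).
Proof.
move=> inA inB hA hB.
have inL f : L2 f -> L2 (lin_op c A B f).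
  by move=> Lf; apply: (hilbert_lin H); [exact: inA|exact: inB].
(* From [(x + y)^2 <= 2 x^2 + 2 y^2] on each basis vector; this guarantees that the combination has
   a flow of its own. *)
have hL N : \sum_(k <- sym_range N) hnsq ip (lin_op c A B (e k)) <=
    2 * normc c ^+ 2 * MA + 2 * MB.
  apply: (@le_trans _ _ (2 * normc c ^+ 2 * (\sum_(k <- sym_range N) hnsq ip (A (e k))) +
    2 * (\sum_(k <- sym_range N) hnsq ip (B (e k))))).
    rewrite !mulr_sumr -big_split /=; apply: ler_sum => k _.
    have LcA : L2 (c *: A (e k)) by apply: (hilbertZ H); exact: inA.
    rewrite -!(hnorm_sqr H); [|exact: inB|exact: inA|exact: inL].
    have le := ler_hnormD H LcA (inB _ (Le k)).
    have := ge0_hnorm ip (c *: A (e k) + B (e k)).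
    rewrite -[lin_op _ _ _ _]/(c *: A (e k) + B (e k)) => h0.
    move: le; rewrite (hnormZ H) //; last exact: inA.
    set x := hilbert_norm _ _ in h0 *; set u := normc c; set v := hilbert_norm _ _;
    set w := hilbert_norm _ _ => le.
    have := sqr_ge0 (u * v - w); have : x ^+ 2 <= (u * v + w) ^+ 2.
      by rewrite ler_sqr ?nnegrE //; exact: le_trans le.
    rewrite sqrrB sqrrD exprMn; lra.
  have u0 : 0 <= 2 * normc c ^+ 2 by rewrite mulr_ge0 ?sqr_ge0.
  apply: lerD; first by rewrite ler_wpM2l.
  by rewrite ler_wpM2l.
have [LA cA] := density_flowP inA hA; have [LB cB] := density_flowP inB hB.
have [LL cL] := density_flowP inL hL.
have LcAB : LL2 (c *: density_flow A + density_flow B) by apply: (hilbert_lin H2).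
have [h _] := hnorm0_ae LL LcAB; apply: h.
have sA := flow_sum_in A; have sB := flow_sum_in B; have sL := flow_sum_in (lin_op c A B).
apply: (hcvg_unique H2 sL LL LcAB cL).
have -> : flow_sum (lin_op c A B) = fun N => c *: flow_sum A N + flow_sum B N.
  apply: funext => N; rewrite /flow_sum /lincomb scaler_sumr -big_split /=.
  apply: eq_bigr => p _; rewrite scalerA -scalerDl; congr (_ *: _).
  rewrite /flow_coef /matrix_coef; case: ifP => _; first by rewrite mulr0 addr0.
  by rewrite -(ip_linr H) //; [exact: inA|exact: inB].
have LcA := hilbertZ H2 c LA; have scA n := hilbertZ H2 c (sA n).
exact: (hcvgD H2 scA sB LcA LB (hcvgZ H2 c sA LA cA) cB).
Qed.

Lemma density_flow_trace_class A : schatten 1%:E A -> is_rdensity_flow A (density_flow A).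
Proof.
move=> SA; have [s [phi [psi [X [sA sX]]]]] := schatten_svd ltr01 SA.
have r12 : 0 < (1 : R) <= 2 by lra.
have [M hs] := schatten_hs r12 SA; apply: (trace_class_flow SA.1 sA (S := X) _ hs) => K.
by apply: le_trans (sX K); apply: ler_sum => n _; rewrite powRr1 //; exact: svd_ge0 sA n.
Qed.

Lemma density_flow_extension : is_rdensity_extension (@density_flow R).
Proof.
have r22 : 0 < (2 : R) <= 2 by lra.
split=> [A SA|c A B SA SB||A SA].
- exact: density_flow_in SA.
- have [MA hA] := schatten_hs r22 SA; have [MB hB] := schatten_hs r22 SB.
  exact: density_flow_lin (bounded_in SA.1) (bounded_in SB.1) hA hB.
- by exists 1 => A SA; rewrite mul1e density_flow_schatten.
- exact: density_flow_trace_class.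
Qed.

Lemma flow_ae A (F G : W) : is_rdensity_flow A F -> is_rdensity_flow A G -> ceq_ae tm2 F G.
Proof.
move=> [mF hF] [mG hG]; apply: ceq_ae_sections => //.
by apply: filterS2 hF hG => t; apply: filterS2 => x -> ->.
Qed.

Lemma orthonormal_sub (J J' : pred nat) (v : nat -> V) : {subset J' <= J} ->
  orthonormal L2 ip J v -> orthonormal L2 ip J' v.
Proof. by move=> sub [Lv on]; split=> // i j /sub Ji /sub Jj; exact: on. Qed.

(* A1 is a partial sum of the singular value decomposition of A. *)
Lemma schatten_approximation A (eps : R) : schatten 2%:E A -> 0 < eps ->
  exists A1, [/\ schatten 1%:E A1, schatten 2%:E A1, schatten 2%:E (lin_op (-1) A1 A)
    & (schatten_norm 2%:E (lin_op (-1)%R A1 A) <= eps%:E)%E].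
Proof.
move=> SA eps0; have [s [phi [psi [X [sA sX]]]]] := schatten_svd (ltr0n R 2) SA.
have s0 := svd_ge0 sA.
have sq0 n : 0 <= s n `^ 2 by exact: powR_ge0.
have eps20 : 0 < eps `^ 2 by exact: powR_gt0.
have [N hN] := tail_sum sq0 sX eps20.
pose lo n := if (n < N)%N then s n else 0; pose hi n := if (n < N)%N then 0 else s n.
have sM n : s n <= X `^ 2^-1.
  have -> : s n = (s n `^ 2) `^ 2^-1 by rewrite -powRrM mulfV // powRr1.
  have X0 : 0 <= X by have := sX 0%N; rewrite big_geq.
  apply: ge0_ler_powR; rewrite ?nnegrE ?invr_ge0 //.
  apply: le_trans (sX n.+1); rewrite big_nat_recr //= lerDr.
  by apply: sumr_ge0 => k _.
have M0 : 0 <= X `^ 2^-1 by exact: powR_ge0.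
have loM n : 0 <= lo n <= X `^ 2^-1 by rewrite /lo; case: ifP => _; rewrite ?s0 ?sM ?lexx ?M0.
have lo_sub : {subset supp lo <= supp s}.
  by move=> n; rewrite /supp !inE /lo; case: ifP => //; rewrite eqxx.
have [A1 sA1] := @hsvd_exists _ _ _ _ H lo phi psi _ loM (orthonormal_sub lo_sub (svd_onl sA))
  (orthonormal_sub lo_sub (svd_onr sA)).
have sD : svd (lin_op (-1) A1 A) hi phi psi by exact: (svd_tail H sA sA1).
(* [A1] has finite rank, so its coefficients are summable to every positive power. *)
have lo_fin (r : R) : 0 < r -> (\esum_(n in [set: nat]) (lo n `^ r)%:E < +oo)%E.
  move=> r0; apply: (@le_lt_trans _ _ (\sum_(n <- index_iota 0 N) s n `^ r)%:E); last exact: ltry.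
  apply: (esum_exhaustion_le exhaustion_iota) => [n|K]; first exact: powR_ge0.
  rewrite lee_fin; have p0 (u : nat -> R) n : 0 <= u n `^ r by exact: powR_ge0.
  apply: le_trans (exhaustion_sum_mono exhaustion_iota (p0 lo) (leq_maxl K N)) _.
  rewrite (@big_cat_nat _ _ _ N) ?leq_maxr //= [X in _ + X]big_nat_cond [X in _ + X]big1.
    rewrite addr0 !big_nat; apply: ler_sum => n /andP[_ nN].
    by rewrite /lo nN.
  by move=> n /andP[/andP[Nn _] _]; rewrite /lo ltnNge Nn powR0 // gt_eqF.
have hi_sum : (\esum_(n in [set: nat]) (hi n `^ 2)%:E <= (eps `^ 2)%:E)%E.
  apply: (esum_exhaustion_le exhaustion_iota) => [n|K]; first exact: powR_ge0.
  rewrite lee_fin; have p0 (u : nat -> R) n : 0 <= u n `^ 2 by exact: powR_ge0.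
  apply: le_trans (exhaustion_sum_mono exhaustion_iota (p0 hi) (leq_maxl K N)) _.
  apply: le_trans (hN N (maxn K N) (leqnn _) (leq_maxr _ _)).
  rewrite (@big_cat_nat _ _ _ N) ?leq_maxr //= big_nat_cond [X in X + _]big1.
    rewrite add0r !big_nat; apply: ler_sum => n /andP[Nn _].
    by rewrite /hi ltnNge Nn.
  by move=> n /andP[/andP[_ nN] _]; rewrite /hi nN powR0 // pnatr_eq0.
have hiM n : hi n <= X `^ 2^-1 by rewrite /hi; case: ifP => _; rewrite ?sM ?M0.
have lo_le n : lo n <= X `^ 2^-1 by have /andP[] := loM n.
have [S2 leS2] := svd_schatten (ler1n R 2) sD hiM (le_lt_trans hi_sum (ltry _)).
have [S11 _] := svd_schatten (lexx 1) sA1 lo_le (lo_fin _ ltr01).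
have [S12 _] := svd_schatten (ler1n R 2) sA1 lo_le (lo_fin _ (ltr0n R 2)).
exists A1; split; [exact: S11|exact: S12|exact: S2|apply: le_trans leS2 _].
apply: (@le_trans _ _ ((eps `^ 2)%:E `^ 2^-1)%E).
  apply: gt0_ler_poweR; rewrite ?invr_ge0 // ?in_itv /= ?leey ?andbT ?lee_fin ?powR_ge0 //.
  by apply: esum_ge0 => n _; rewrite lee_fin powR_ge0.
by rewrite poweR_EFin -powRrM mulfV // powRr1 // ltW.
Qed.

(** On a trace class approximation [A1] both maps give the same flow almost everywhere, so
    [T1 A - T2 A] equals [T1 D - T2 D] with [D = A - A1], which boundedness makes arbitrarily
    small. *)
Lemma rdensity_extension_unique (T1 T2 : (V -> V) -> W) :
  is_rdensity_extension T1 -> is_rdensity_extension T2 ->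
  forall A, schatten 2%:E A -> ceq_ae tm2 (T1 A) (T2 A).
Proof.
move=> [in1 lin1 [M1 b1] flow1] [in2 lin2 [M2 b2] flow2] A SA.
have L1A := in1 _ SA; have L2A := in2 _ SA.
apply/(hnorm0_ae L1A L2A); apply/eqP; rewrite eq_le ge0_hnorm andbT.
apply/ler_addgt0Pr => eps eps0; rewrite add0r.
(* The bounds of the two maps may be zero or negative; absolute values and the added 1 allow
   division by [M]. *)
pose M := `|M1| + `|M2| + 1; have M0 : 0 < M by rewrite ltr_wpDl // addr_ge0.
have [A1 [S1 S2 SD nD]] := schatten_approximation SA (divr_gt0 eps0 M0).
set D := lin_op (-1) A1 A in SD nD.
have fl := flow_ae (flow1 _ S1) (flow2 _ S1).
have L1D := in1 _ SD; have L2D := in2 _ SD.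
have bound (T3 : (V -> V) -> W) M3 : (forall B, schatten 2%:E B ->
    (cLnorm tm2 2%:E (T3 B) <= M3%:E * schatten_norm 2%:E B)%E) -> LL2 (T3 D) ->
    hilbert_norm ip2 (T3 D) <= `|M3| * (eps / M).
  move=> b3 L3; rewrite -lee_fin -(cLnorm2_hnorm L3); apply: le_trans (b3 _ SD) _.
  have n0 : (0 <= schatten_norm 2%:E D)%E.
    by apply: le_ereal_inf_tmp => _ [P _ <-]; exact: poweR_ge0.
  rewrite EFinM; apply: (@le_trans _ _ (`|M3|%:E * schatten_norm 2%:E D)%E).
    by apply: lee_wpmul2r => //; rewrite lee_fin ler_norm.
  by apply: lee_wpmul2l => //; rewrite lee_fin.
have n1 := bound _ _ b1 L1D; have n2 := bound _ _ b2 L2D.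
have ae : ceq_ae tm2 (T1 A - T2 A) (T1 D - T2 D).
  apply: filterS3 fl (lin1 (-1) _ _ S2 SA) (lin2 (-1) _ _ S2 SA) => z h0 h1 h2.
  rewrite !fctE; move: h1 h2; rewrite -/D => -> ->; rewrite h0; ring.
have LAB := hilbertB H2 L1A L2A; have LDB := hilbertB H2 L1D L2D.
rewrite (heq_hnorm H2 LAB LDB); last by apply/(hnorm0_ae LAB LDB).
apply: le_trans (ler_hnormD H2 L1D (hilbertN H2 L2D)) _; rewrite (hnormN H2) //.
apply: le_trans (lerD n1 n2) _; rewrite -mulrDl mulrA ler_pdivrMr // mulrC.
by rewrite ler_pM2l // /M lerDl.
Qed.

(** * Sharpness *)

Let shift_coef (N n : nat) : R := (n < N)%:R.

(* The shift e_k |-> e_(k+1), truncated to 0 <= k < N: all its singular values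
   are 1, and the densities of the |e_(k+1)><e_k| stay orthogonal in
   space-time. *)
Lemma truncated_shift N : exists A,
  svd A (shift_coef N) (fun n => e n.+1%:Z) (fun n => e n%:Z).
Proof.
have sub n : 0 <= shift_coef N n <= 1.
  by rewrite /shift_coef; case: (n < N)%N; rewrite ?lexx ?ler01.
apply: (@hsvd_exists _ _ _ _ H _ _ _ _ sub).
  split=> [n|i j _ _]; first exact: one.1.
  by rewrite one.2.
by split=> [n|i j _ _]; [exact: one.1|rewrite one.2].
Qed.

Section Shift.
Variables (N : nat) (A : V -> V).
Hypothesis sA : svd A (shift_coef N) (fun n => e n.+1%:Z) (fun n => e n%:Z).

Let c1 n : shift_coef N n <= 1.
Proof. by rewrite /shift_coef; case: (n < N)%N. Qed.

Let csum (r : R) : 0 < r -> (\esum_(n in [set: nat]) (shift_coef N n `^ r)%:E <= N%:R%:E)%E.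
Proof.
move=> r0; apply: (esum_exhaustion_le exhaustion_iota) => [n|K]; first exact: powR_ge0.
have p0 n : 0 <= shift_coef N n `^ r by exact: powR_ge0.
rewrite lee_fin; apply: le_trans (exhaustion_sum_mono exhaustion_iota p0 (leq_maxl K N)) _.
rewrite (@big_cat_nat _ _ _ N) ?leq_maxr //= [X in _ + X]big_nat_cond [X in _ + X]big1.
  rewrite addr0 big_nat; under eq_bigr => n /andP[_ nN] do rewrite /shift_coef nN powR1.
  by rewrite -big_nat sumr_const_nat subn0.
by move=> n /andP[/andP[Nn _] _]; rewrite /shift_coef ltnNge Nn powR0 // gt_eqF.
Qed.

Lemma shift_schatten (r : R) : 1 <= r ->
  schatten r%:E A /\ (schatten_norm r%:E A <= (N%:R `^ r^-1)%:E)%E.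
Proof.
move=> r1; have r0 : 0 < r by exact: lt_le_trans r1.
have [S1 le1] := svd_schatten r1 sA c1 (le_lt_trans (csum r0) (ltry _)).
split=> //; apply: le_trans le1 _; rewrite -poweR_EFin.
apply: gt0_ler_poweR; rewrite ?invr_ge0 ?(ltW r0) // ?in_itv /= ?leey ?andbT ?lee_fin //.
  by apply: esum_ge0 => n _; rewrite lee_fin powR_ge0.
exact: csum.
Qed.

Lemma shift_op_norm : (op_norm A <= 1)%E.
Proof.
apply: ub_ereal_sup => _ [f [Lf f1] <-].
rewrite (cLnorm2_inner (svd_in sA Lf)) lee_fin.
move: f1; rewrite (cLnorm2_inner Lf) lee_fin; apply: le_trans.
by apply: le_trans (svd_le H sA c1 Lf) _; rewrite mul1r.
Qed.

(** Bessel in space-time for the [N] pairs [(n + 1, n)]: they lie off the diagonal and the matrix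
    entry at each of them is 1. *)
Lemma shift_flow_ge : is_rdensity_flow A (density_flow A) /\
  ((Num.sqrt N%:R)%:E <= cLnorm tm2 2%:E (density_flow A))%E.
Proof.
have [S1 _] := shift_schatten (lexx 1); have [S2 _] := shift_schatten (ler1n R 2).
split; first exact: density_flow_trace_class.
have r12 : 0 < (1 : R) <= 2 by lra.
have LF := density_flow_in r12 S1; have [M hs] := schatten_hs r12 S1.
rewrite (cLnorm2_hnorm LF) lee_fin ler_wsqrtr //.
pose s : seq (int * int) := [seq (n.+1%:Z, n%:Z) | n <- iota 0 N].
have us : uniq s.
  by rewrite map_inj_uniq ?iota_uniq // => m n [].
have Jn (n : nat) : off_diagonal (n.+1%:Z, n%:Z) by apply/eqP => -[]; lia.
have := bessel_pred H2 (orthonormal_spacetime_basis R) LF us.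
apply: le_trans; rewrite big_map; under eq_bigl do rewrite Jn.
have -> : N%:R = \sum_(n <- iota 0 N) (1 : R).
  by rewrite big_const_seq count_predT size_iota iter_addr addr0.
rewrite !big_seq; apply: ler_sum => n; rewrite mem_iota => /andP[_ nN].
have cn : shift_coef N n = 1 by rewrite /shift_coef nN.
have cf : matrix_coef A (n.+1%:Z, n%:Z) = 1.
  rewrite /matrix_coef (svd_coef H sA (one.1 n%:Z)) ?cn ?oner_neq0 //.
  by rewrite mul1r one.2 // eqxx.
by rewrite (density_flow_coef (svd_in sA) hs (Jn n)) cf Normc.normc1 expr1n.
Qed.

End Shift.

(** The operator norm is a supremum, so a member of its set is needed; the value at the zero
    function serves. *)
Lemma schatten_norm_ge0 (alpha : \bar R) (A : V -> V) : (0 <= schatten_norm alpha A)%E.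
Proof.
have op0 : (0 <= op_norm A)%E.
  apply: (@le_trans _ _ (cLnorm torus_measure 2%:E (A (fun=> 0)))); first exact: Lnorm_ge0.
  apply: ereal_sup_ubound; exists (fun=> 0) => //; split; first exact: L2_0.
  rewrite cLnorm2E /sqint; under eq_integral do rewrite Normc.normc0 expr0n /=.
  by rewrite integral0 poweR_EFin powR0 ?invr_eq0 // lee_fin.
case: alpha => [r||] //.
by apply: le_ereal_inf_tmp => _ [P _ <-]; exact: poweR_ge0.
Qed.

Lemma powR_unbounded (q M : R) : 0 < q -> exists N : nat, M < N%:R `^ q.
Proof.
move=> q0; pose x := (`|M| + 1) `^ q^-1; have M1 : 0 <= `|M| + 1 by rewrite addr_ge0.
have x0 : 0 <= x by exact: powR_ge0.
exists (Num.bound x); apply: (@lt_le_trans _ _ (`|M| + 1)); first by rewrite ltr_pwDr // ler_norm.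
have -> : `|M| + 1 = x `^ q by rewrite /x -powRrM mulVf ?gt_eqF // powRr1.
apply: ge0_ler_powR; rewrite ?nnegrE ?(ltW q0) //; apply: ltW.
by have := archi_boundP x0.
Qed.

(** On the truncated shifts a constant [M] would bound [N^(1/2)] by [|M| N^q] with [q < 1/2], which
    is false for large [N]. *)
Lemma density_estimate_fails (alpha : \bar R) : (2%:E < alpha)%E ->
  ~ exists M : R, forall (A : V -> V) (F : T * T -> C),
      schatten 1%:E A -> is_rdensity_flow A F ->
      (cLnorm tm2 2%:E F <= M%:E * schatten_norm alpha A)%E.
Proof.
move=> alpha2 [M hM].
(* [q = 1 / alpha] for finite exponents; [q = 0] for [+oo], where the shift has operator norm at
   most 1. *)
have [q [q0 hq]] : exists q : R, q < 2^-1 /\ forall N A,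
    hsvd (cLp torus_measure 2%:E : V -> Prop) (@inner R) A (fun n => (n < N)%:R)
      (fun n => fourier_basis n.+1%:Z) (fun n => fourier_basis n%:Z) ->
    (0 < N)%N -> (schatten_norm alpha A <= (N%:R `^ q)%:E)%E.
  case: alpha alpha2 {hM} => [r||] // r2.
    exists r^-1; move: r2; rewrite lte_fin => r2.
    have r0 : 0 < r by exact: lt_trans r2.
    split=> [|N A sA _]; first by rewrite ltf_pV2 ?posrE.
    have r1 : 1 <= r by apply: ltW; apply: lt_trans r2; rewrite ltr1n.
    by have [] := shift_schatten sA r1.
  exists 0; split=> [|N A sA _]; first by rewrite invr_gt0.
  by rewrite powRr0; exact: shift_op_norm sA.
have q2 : 0 < 2^-1 - q by rewrite subr_gt0.
have [N hN] := powR_unbounded `|M| q2.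
have N0 : (0 < N)%N.
  case: N hN => // ; rewrite powR0 ?subr_eq0 ?gt_eqF //.
  by rewrite ltNge normr_ge0.
have NR0 : 0 < N%:R :> R by rewrite ltr0n.
have [A sA] := truncated_shift N.
have [S1 _] := shift_schatten sA (lexx 1).
have [fl ge] := shift_flow_ge sA.
have := le_trans ge (hM _ _ S1 fl).
have : (M%:E * schatten_norm alpha A <= (`|M| * N%:R `^ q)%:E)%E.
  apply: (@le_trans _ _ (`|M|%:E * schatten_norm alpha A)%E).
    by apply: lee_wpmul2r; [exact: schatten_norm_ge0|rewrite lee_fin ler_norm].
  by rewrite EFinM; apply: lee_wpmul2l; [rewrite lee_fin|exact: hq sA N0].
move=> h /le_trans/(_ h); rewrite lee_fin; apply/negP; rewrite -ltNge.
rewrite -powR12_sqrt ?ler0n // -[X in _ < _ `^ X](subrK q) powRD; last first.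
  by apply/implyP => _; rewrite gt_eqF.
by rewrite ltr_pM2r // powR_gt0.
Qed.

End RenormalisedDensity.

Theorem theorem1p12 (R : realType) (alpha : \bar R) (alpha_ge1 : (1 <= alpha)%E) :
  ((alpha <= 2%:E)%E ->
     exists T : operator R -> measurableTypeR R * measurableTypeR R -> R[i],
       [/\ is_rdensity_extension T,
           forall T' : operator R -> measurableTypeR R * measurableTypeR R -> R[i],
             is_rdensity_extension T' ->
             forall gamma0 : operator R, schatten 2%:E gamma0 ->
               ceq_ae torus2_measure (T' gamma0) (T gamma0)
         & exists C : R, 0 < C /\
             forall gamma0 : operator R, schatten alpha gamma0 ->
               (cLnorm torus2_measure 2%:E (T gamma0)
                  <= C%:E * schatten_norm alpha gamma0)%E])
  /\
  ((2%:E < alpha)%E ->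
     ~ exists C : R,
         forall (gamma0 : operator R)
                (F : measurableTypeR R * measurableTypeR R -> R[i]),
           schatten 1%:E gamma0 -> is_rdensity_flow gamma0 F ->
           (cLnorm torus2_measure 2%:E F
              <= C%:E * schatten_norm alpha gamma0)%E).
Proof.
split=> [alpha2|]; last exact: density_estimate_fails.
exists (@density_flow R); split.
- exact: density_flow_extension.
- move=> T' ext A SA.
  exact: (rdensity_extension_unique ext (density_flow_extension R) SA).
(* The bounds 1 and 2 on [alpha] leave only finite exponents. *)
- case: alpha alpha_ge1 alpha2 => [r||] //; rewrite !lee_fin => r1 r2.
  exists 1; split=> // A SA; rewrite mul1e density_flow_schatten //.
  by rewrite r2 (lt_le_trans ltr01).
Qed.
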